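(* Let $d\in\mathbb N$ and let $p,r$ be real numbers with $1<p\le r$. Then for any $\varphi\in L^p(\mathbb R^d,\mu)$ and any $\psi\in L^\infty(\mathbb R^d,\mu)$, the product $\Gamma\big(\sqrt{p-1}/\sqrt{r-1}\big)\varphi\diamond\Gamma\big(\sqrt{r-p}/\sqrt{r-1}\big)\psi$ belongs to $L^r(\mathbb R^d,\mu)$ and $$\Big\|\Big[\Gamma\Big(\tfrac{\sqrt{p-1}}{\sqrt{r-1}}\Big)\varphi\Big]\diamond\Big[\Gamma\Big(\tfrac{\sqrt{r-p}}{\sqrt{r-1}}\Big)\psi\Big]\Big\|_r\le\|\varphi\|_p\,\|\psi\|_\infty.$$ In particular (taking $\psi\equiv1$), $\big\|\Gamma\big(\sqrt{p-1}/\sqrt{r-1}\big)\varphi\big\|_r\le\|\varphi\|_p$.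
   Context: $\mu$ is the standard Gaussian probability measure on $\mathbb R^d$ and $\|\cdot\|_p$ the norm of $L^p(\mathbb R^d,\mu)$. Gaussian chaos setting: $L^2(\mathbb R^d,\mu)=\bigoplus_n G_n$ with $G_0=\mathbb C$, $G_n=\overline{F_n}\ominus\overline{F_{n-1}}$, $F_n$ the polynomials of degree $\le n$ in the coordinates, $P_n$ the projection onto $G_n$. Wick product: $\varphi\diamond\psi=P_{m+n}(\varphi\psi)$ for $\varphi\in G_m,\psi\in G_n$, extended bilinearly. Second quantization $\Gamma(c)\sum f_n=\sum c^nf_n$, which for real $|c|\le 1$ extends to a norm-one operator on each $L^p(\mu)$. With $u=(r-1)/(p-1)$, $v=(r-1)/(r-p)$ one has $1/u+1/v=1$, and the map $(\varphi,\psi)\mapsto\Gamma(1/\sqrt u)\varphi\diamond\Gamma(1/\sqrt v)\psi$ extends uniquely continuously from $L^2\times L^2$ to $L^1\times L^1\to L^1$; the expression in the claim denotes this extension. *)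

(* Defs.v *)
(* MathComp + MathComp-Analysis (+ complex numbers from mathcomp-real-closed). *)
From HB Require Import structures.
From mathcomp Require Import all_boot all_order all_algebra.
From mathcomp Require Import all_classical all_reals all_analysis.
From mathcomp Require Import complex.
Set Implicit Arguments. Unset Strict Implicit. Unset Printing Implicit Defensive.
Import Order.TTheory GRing.Theory Num.Theory.
Local Open Scope classical_set_scope.
Local Open Scope ring_scope.

Section GaussianChaos.
Variables (R : realType) (d : nat).

(* R^d is represented by d.-tuple R, with the product sigma-algebra of the library. *)
Local Notation X := (d.-tuple R).
Local Notation C := (complex R).

(* mu is the standard Gaussian measure on R^d: the unique probability measure whose value
   on every measurable rectangle is the product of the standard normal N(0,1) measures. *)
Definition is_std_gaussian (mu : probability X R) : Prop :=
  forall A : 'I_d -> set R, (forall i, measurable (A i)) ->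
    mu [set x : X | forall i, A i (tnth x i)] = (\prod_(i < d) normal_prob 0 1 (A i))%E.

(* complex-valued functions: measurability and modulus *)
Definition cmeasurable (f : X -> C) : Prop :=
  measurable_fun setT (fun x => complex.Re (f x)) /\
  measurable_fun setT (fun x => complex.Im (f x)).

Definition cabs (f : X -> C) : X -> \bar R := fun x => (Normc.normc (f x))%:E.

(* ||f||_p, p an extended real (p = +oo gives the essential sup norm) *)
Definition cnorm (mu : probability X R) (p : \bar R) (f : X -> C) : \bar R :=
  Lnorm mu p (cabs f).

(* f is in L^p(mu) *)
Definition inLp (mu : probability X R) (p : \bar R) (f : X -> C) : Prop :=
  cmeasurable f /\ (cnorm mu p f < +oo)%E.

(* monomials in the coordinates: x |-> prod_i x_i ^ k_i, of degree sum_i k_i *)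
Definition monomial (k : d.-tuple nat) (x : X) : R := \prod_(i < d) tnth x i ^+ tnth k i.
Definition mdeg (k : d.-tuple nat) : nat := (\sum_(i < d) tnth k i)%N.

(* F_n : polynomial functions (complex coefficients) of degree <= n in the coordinates *)
Definition polyF (n : nat) (f : X -> C) : Prop :=
  exists s : seq (d.-tuple nat * C),
    all (fun a => mdeg a.1 <= n)%N s /\
    f = fun x => \sum_(a <- s) a.2 * ((monomial a.1 x)%:C)%C.

(* orthogonality in L^2(mu): <f, g> = int f * conj g dmu = 0 *)
Definition orth (mu : probability X R) (f g : X -> C) : Prop :=
  \int[mu]_x complex.Re (f x * ((g x)^*)%C) = 0 /\
  \int[mu]_x complex.Im (f x * ((g x)^*)%C) = 0.

(* G_n = F_n (-) F_{n-1} (F_n is finite dimensional, hence closed), G_0 = constants *)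
Definition chaos (mu : probability X R) (n : nat) (f : X -> C) : Prop :=
  polyF n f /\
  match n with
  | 0 => True
  | n'.+1 => forall g, polyF n' g -> orth mu f g
  end.

(* P_n f : the orthogonal projection of f onto G_n *)
Definition proj (mu : probability X R) (n : nat) (f : X -> C) : X -> C :=
  xget (fun _ => 0)
    [set g | chaos mu n g /\ forall h, chaos mu n h -> orth mu (f \- g) h].

(* second quantization on polynomials of degree <= N : Gamma(c) sum f_n = sum c^n f_n *)
Definition GammaN (mu : probability X R) (N : nat) (c : R) (f : X -> C) : X -> C :=
  fun x => \sum_(n < N.+1) (c ^+ n)%:C%C * proj mu n f x.

(* Wick product, bilinear extension of phi <> psi = P_{m+n}(phi psi) (phi in G_m, psi in G_n),
   for functions whose chaos components vanish beyond degree N *)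
Definition wickN (mu : probability X R) (N : nat) (f g : X -> C) : X -> C :=
  fun x => \sum_(m < N.+1) \sum_(n < N.+1)
             proj mu (m + n) (fun y => proj mu m f y * proj mu n g y) x.

Local Open Scope ereal_scope.

(* h is the value at (phi, psi) of the unique continuous extension L^1 x L^1 -> L^1 of
   (phi, psi) |-> Gamma(c1) phi <> Gamma(c2) psi : the L^1-limit of the values along any
   approximation of (phi, psi) in L^1 by polynomials (dense in L^1(mu)). *)
Definition wick_ext (mu : probability X R) (c1 c2 : R) (phi psi h : X -> C) : Prop :=
  cmeasurable h /\
  forall (N : nat -> nat) (phik psik : nat -> X -> C),
    (forall k, polyF (N k) (phik k) /\ polyF (N k) (psik k)) ->
    (fun k => cnorm mu 1 (phik k \- phi)%R) @ \oo --> 0 ->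
    (fun k => cnorm mu 1 (psik k \- psi)%R) @ \oo --> 0 ->
    (fun k => cnorm mu 1
       (wickN mu (N k) (GammaN mu (N k) c1 (phik k)) (GammaN mu (N k) c2 (psik k)) \- h)%R)
      @ \oo --> 0.

(* same for Gamma(c) alone, extended by continuity from polynomials *)
Definition Gamma_ext (mu : probability X R) (c : R) (phi h : X -> C) : Prop :=
  cmeasurable h /\
  forall (N : nat -> nat) (phik : nat -> X -> C),
    (forall k, polyF (N k) (phik k)) ->
    (fun k => cnorm mu 1 (phik k \- phi)%R) @ \oo --> 0 ->
    (fun k => cnorm mu 1 (GammaN mu (N k) c (phik k) \- h)%R) @ \oo --> 0.

End GaussianChaos.

(* Main.v *)
(* With a = c1 and b = c2 one has a^2 + b^2 = 1, and the extended product is the integral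
     h(x) = int phi(a x + b y) psi(b x - a y) dmu(y).
   Indeed, for phi in G_m and psi in G_n this h is a polynomial of degree <= m + n whose
   part of degree m + n is that of a^m b^n phi psi, and since mu x mu is invariant under
   (x, y) |-> (a x + b y, b x - a y) it is orthogonal to all polynomials of lower degree;
   hence h = a^m b^n P_(m+n)(phi psi). The same invariance gives
   ||h||_1 <= ||phi||_1 ||psi||_1, so h depends continuously on (phi, psi).
   Pointwise |h| <= ||psi||_oo P_a|phi| with P_a the Ornstein-Uhlenbeck operator, and the
   bound becomes Nelson's hypercontractivity ||P_a f||_r <= ||f||_p for f >= 0.

   Hypercontractivity is proved in dual form in dimension one and then tensorized. For a
   Gaussian pair (X, Y) of correlation rho with rho^2 <= (p - 1)(q - 1), s = 1/p, t = 1/q,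
   one shows E[F(X)^s G(Y)^t] <= (E F(X))^s (E G(Y))^t for C^{1,1} functions F, G with
   values in [m, M], m > 0. By Taylor expansion this holds for (g X, g Y) up to O(g^3): the
   condition on rho makes the second order term negative. As the sum of two independent
   copies of (g X, g Y) is distributed as (sqrt 2 g X, sqrt 2 g Y), applying the inequality
   twice doubles the error while multiplying g by sqrt 2, and iterating from g = 2^(-n/2)
   makes the error vanish. General F and G are reduced to this case by P_c, c < 1. *)
Require Import Defs.
From HB Require Import structures.
From mathcomp Require Import all_boot all_order all_algebra.
From mathcomp Require Import all_classical all_reals all_analysis.
From mathcomp Require Import measurable_realfun ess_sup_inf complex.
From mathcomp Require Import ring lra.
Set Implicit Arguments. Unset Strict Implicit. Unset Printing Implicit Defensive.
Import Order.TTheory GRing.Theory Num.Theory.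
Import numFieldNormedType.Exports.
Local Open Scope classical_set_scope.
Local Open Scope ring_scope.

(** * The Gaussian measure on the line *)

(** The dual form is used with [f = F^s] and [g = G^t]. A lower bound [m > 0] keeps the powers away
    from their singularity at 0, and the C^{1,1} class has fixed constants preserved by Gaussian
    averaging, so one error bound serves at every doubling. Mollification costs correlation: [P_rho]
    is replaced by [P_c P_rho P_c], one outer factor is moved to the other function by symmetry, and
    Jensen puts both inside the powers. The lost factor [c^2] is bought back with an exponent [p']
    slightly above [p], which then decreases to [p]. In higher dimension the first coordinates are
    split off and the partial norms of the slices are fed into the inequality on the line.
    Real-valued integrals take the value 0 when a nonnegative integral diverges, so inequalities are
    proved for bounded functions and extended by truncation. On the algebraic side [proj] is a
    choice among polynomials that agree almost everywhere; identities about [GammaN] and [wickN] are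
    therefore proved almost everywhere, which is enough since the extension is tested in [L^1]
    norm. *)

Section image.
Context {d1 d2 : measure_display} {T1 : measurableType d1} {T2 : measurableType d2}.
Context {R : realType}.
Variables (m1 : {measure set T1 -> \bar R}) (m2 : {measure set T2 -> \bar R}).
Variable phi : T1 -> T2.
Hypothesis mphi : measurable_fun setT phi.

Definition image_measure : {measure set T2 -> \bar R} :=
  measure_function_pushforward__canonical__measure_function_Measure m1 mphi.

Hypothesis m2E : forall A, measurable A -> m2 A = m1 (phi @^-1` A).

(** [m2] has to agree with the image of [m1] on measurable sets only, so it may be a measure given
    independently. Splitting into positive and negative parts covers every measurable function,
    integrable or not. *)
Lemma integral_image (f : T2 -> \bar R) : measurable_fun setT f ->
  (\int[m2]_y f y = \int[m1]_x f (phi x))%E.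
Proof.
have ge0 (g : T2 -> \bar R) : measurable_fun setT g -> (forall y, 0 <= g y)%E ->
    (\int[m2]_y g y = \int[m1]_x g (phi x))%E.
  move=> mg g0.
  rewrite (@eq_measure_integral _ _ _ setT image_measure)/=.
    by rewrite ge0_integral_pushforward.
  by move=> A mA _; rewrite m2E.
move=> mf; rewrite integralE [RHS]integralE !ge0//.
- by rewrite !unlock.
- exact: measurable_funeneg.
- exact: measurable_funepos.
Qed.

End image.

Section gauss1.
Context {R : realType}.
Local Notation RR := (measurableTypeR R).

(* Copies of the Lebesgue and Gaussian measures on R with its canonical
   measurable structure, whose display differs from that of measurableTypeR. *)
Definition leb : set R -> \bar R := @lebesgue_measure R.

Let leb0 : leb set0 = 0%E. Proof. exact: (measure0 (@lebesgue_measure R)). Qed.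
Let leb_ge0 A : (0 <= leb A)%E.
Proof. exact: (measure_ge0 (@lebesgue_measure R)). Qed.
Let leb_sigma : semi_sigma_additive leb.
Proof. exact: (@measure_semi_sigma_additive _ _ _ (@lebesgue_measure R)). Qed.
HB.instance Definition _ := isMeasure.Build _ R _ leb leb0 leb_ge0 leb_sigma.
Let leb_sfinite : sigma_finite setT leb.
Proof. exact: (@sigma_finiteT _ _ _ (@lebesgue_measure R)). Qed.
HB.instance Definition _ := Measure_isSigmaFinite.Build _ R _ leb leb_sfinite.

Definition gauss : set R -> \bar R := normal_prob 0 1.

Let gauss0 : gauss set0 = 0%E. Proof. exact: (measure0 (normal_prob 0 1)). Qed.
Let gauss_ge0 A : (0 <= gauss A)%E.
Proof. exact: (measure_ge0 (normal_prob 0 1)). Qed.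
Let gauss_sigma : semi_sigma_additive gauss.
Proof. exact: (@measure_semi_sigma_additive _ _ _ (normal_prob 0 1)). Qed.
HB.instance Definition _ := isMeasure.Build _ R _ gauss gauss0 gauss_ge0 gauss_sigma.
Let gauss_setT : gauss setT = 1%E.
Proof. exact: (@probability_setT _ _ _ (normal_prob 0 1)). Qed.
HB.instance Definition _ := Measure_isProbability.Build _ R _ gauss gauss_setT.

Let measurable_toR : measurable_fun setT (fun x : RR => (x : R)).
Proof. by move=> _ A mA; rewrite setTI. Qed.

Let integral_leb (f : R -> \bar R) : measurable_fun setT f ->
  (\int[leb]_x f x = \int[@lebesgue_measure R]_x f x)%E.
Proof. exact: (integral_image (m1 := @lebesgue_measure R) measurable_toR). Qed.

Let integral_gauss_normal (f : R -> \bar R) : measurable_fun setT f ->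
  (\int[gauss]_x f x = \int[normal_prob 0 1]_x f x)%E.
Proof. exact: (integral_image (m1 := normal_prob 0 1) measurable_toR). Qed.

Local Open Scope ereal_scope.
(** The Radon-Nikodym derivative of [normal_prob] is determined only almost everywhere; it agrees
    there with [normal_pdf] because both have the same integral over every measurable set. *)
Lemma ge0_integral_gauss (f : R -> \bar R) : measurable_fun setT f ->
  (forall x, 0 <= f x) ->
  \int[gauss]_x f x = \int[leb]_x (f x * (normal_pdf 0 1 x)%:E).
Proof.
move=> mf f0.
have mpdf : measurable_fun setT (fun x : R => (normal_pdf 0 1 x)%:E).
  by apply/measurable_EFinP; exact: measurable_normal_pdf.
rewrite integral_gauss_normal// integral_leb; last exact: emeasurable_funM.
rewrite -(Radon_Nikodym_SigmaFinite.change_of_variables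
  (normal_prob_dominates 0 1))//.
have mRN := measurable_int _ (Radon_Nikodym_SigmaFinite.f_integrable
  (normal_prob_dominates (R := R) 0 1)).
apply: ae_eq_integral => //; [exact: emeasurable_funM|exact: emeasurable_funM|].
apply: ae_eqe_mul2l => /=; apply: integral_ae_eq => //=.
  exact: Radon_Nikodym_SigmaFinite.f_integrable (normal_prob_dominates 0 1).
by move=> E _ mE; rewrite -Radon_Nikodym_SigmaFinite.f_integral//; exact: normal_prob_dominates.
Qed.

Let affine_preimage_ocitv (a b x y : R) : (0 < a)%R ->
  ((fun z => a * z + b) @^-1` `]x, y]%classic = `](x - b) / a, (y - b) / a]%classic)%R.
Proof.
move=> a0; apply/seteqP; split => z /=; rewrite !in_itv/= ltr_pdivrMr// ler_pdivlMr// ltrBlDr lerBrDr mulrC//.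
Qed.

Lemma measurable_affine (a b : R) : measurable_fun setT (fun z : R => a * z + b)%R.
Proof. by apply: measurable_funD => //; apply: measurable_funM. Qed.

Let measurable_affineRR (a b : R) :
  measurable_fun setT (fun z : RR => (a * z + b)%R : RR).
Proof. exact: measurable_affine. Qed.

(** The measure [m'], [a] times the image of Lebesgue measure under the affine map, gives each
    half-open interval its length, so uniqueness of Lebesgue measure identifies the two. *)
Let ge0_integral_affine_pos (a b : R) (f : R -> \bar R) : (0 < a)%R ->
  measurable_fun setT f -> (forall x, 0 <= f x) ->
  \int[leb]_x f x = a%:E * \int[leb]_x f (a * x + b)%R.
Proof.
move=> a0 mf f0.
rewrite !integral_leb//; last by apply: measurableT_comp => //; exact: measurable_affine.
pose m' := mscale (NngNum (ltW a0)) (image_measure lebesgue_measure (measurable_affineRR a b)).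
rewrite (@eq_measure_integral _ _ _ setT m').
  rewrite ge0_integral_mscale//; congr (_ * _)%E.
  by rewrite (integral_image (m1 := lebesgue_measure) (measurable_affineRR a b)).
move=> A mA _; apply: (@lebesgue_measure_unique R m') => //.
move=> _ [[u v]] _ <-.
rewrite [RHS](_ : _ = a%:E * lebesgue_measure `]((u - b) / a)%R, ((v - b) / a)%R]%classic); last first.
  by rewrite -affine_preimage_ocitv.
rewrite !lebesgue_measure_itv/= !lte_fin ltr_pM2r ?invr_gt0// ltrD2r.
case: ifPn => _; last by rewrite mule0.
by rewrite -!EFinD -EFinM; congr EFin; field; rewrite gt_eqF.
Qed.

Let ge0_integral_opp (f : R -> \bar R) :
  measurable_fun setT f -> (forall x, 0 <= f x) ->
  \int[leb]_x f x = \int[leb]_x f (- x)%R.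
Proof.
move=> mf f0; rewrite !integral_leb//; last exact: measurableT_comp.
have mopp : measurable_fun setT (fun z : RR => (- z)%R : RR).
  exact: (@measurableT_comp _ _ _ _ _ _ (-%R : R -> R) _ idfun).
rewrite (integral_image (m1 := lebesgue_measure) mopp)//.
by move=> A mA; rewrite -[LHS]lebesgue_measureN.
Qed.

Lemma ge0_integral_affine (a b : R) (f : R -> \bar R) : (a != 0)%R ->
  measurable_fun setT f -> (forall x, 0 <= f x) ->
  \int[leb]_x f x = `|a|%:E * \int[leb]_x f (a * x + b)%R.
Proof.
move=> a0 mf f0; have [ap|an|a00] := ltrgt0P a.
- by rewrite -ge0_integral_affine_pos.
- rewrite (@ge0_integral_affine_pos (- a) b)// ?oppr_gt0//.
  rewrite ge0_integral_opp//; last first.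
    by apply: measurableT_comp => //; exact: measurable_affine.
  by under eq_integral do rewrite mulrNN.
- by rewrite a00 eqxx in a0.
Qed.
End gauss1.

(** * Invariance of the planar Gaussian measure under reflections *)

Section gauss_rotation.
Context {R : realType}.
Local Notation phi := (normal_pdf (0 : R) 1).

Lemma measurable_pair_comp {d d1 d2 d'} {T : measurableType d} {T1 : measurableType d1}
    {T2 : measurableType d2} {U : measurableType d'} (F : T1 * T2 -> U)
    (g : T -> T1) (h : T -> T2) :
  measurable_fun setT F -> measurable_fun setT g -> measurable_fun setT h ->
  measurable_fun setT (fun z => F (g z, h z)).
Proof.
by move=> mF mg mh; apply: (measurableT_comp mF); exact: measurable_fun_pair.
Qed.

Lemma measurable_lin {d} {T : measurableType d} (a b : R) (g h : T -> R) :
  measurable_fun setT g -> measurable_fun setT h ->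
  measurable_fun setT (fun z => a * g z + b * h z).
Proof. by move=> mg mh; apply: measurable_funD; apply: measurable_funM. Qed.

Lemma measurable_linB {d} {T : measurableType d} (a b : R) (g h : T -> R) :
  measurable_fun setT g -> measurable_fun setT h ->
  measurable_fun setT (fun z => a * g z - b * h z).
Proof. by move=> mg mh; apply: measurable_funB; apply: measurable_funM. Qed.

Lemma normal_pdf01 (x : R) : phi x = normal_peak 1 * expR (- x ^+ 2 / 2).
Proof. by rewrite normal_pdfE ?oner_neq0// /normal_fun subr0 expr1n. Qed.

Lemma normal_pdf_rot (a b u v : R) : a ^+ 2 + b ^+ 2 = 1 ->
  phi (a * u + b * v) * phi (b * u - a * v) = phi u * phi v.
Proof.
move=> ab; rewrite !normal_pdf01 mulrACA -expRD [RHS]mulrACA -expRD.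
congr (_ * expR _).
transitivity (- (a ^+ 2 + b ^+ 2) * (u ^+ 2 + v ^+ 2) / 2); first by ring.
by rewrite ab; ring.
Qed.

Local Open Scope ereal_scope.

Lemma measurable_normal_pdf2 {d} {T : measurableType d} (g h : T -> R) :
  measurable_fun setT g -> measurable_fun setT h ->
  measurable_fun setT (fun z => (phi (g z) * phi (h z))%:E).
Proof.
move=> mg mh; apply/measurable_EFinP; apply: measurable_funM;
  by apply: measurableT_comp => //; exact: measurable_normal_pdf.
Qed.

Lemma ge0_integral_gauss2 (G : R * R -> \bar R) : measurable_fun setT G ->
  (forall z, 0 <= G z) ->
  \int[gauss]_x \int[gauss]_y G (x, y) =
  \int[leb]_x \int[leb]_y (G (x, y) * (phi x * phi y)%:E).
Proof.
move=> mG G0.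
rewrite ge0_integral_gauss; last 2 first.
- exact: measurable_fun_fubini_tonelli_F.
- by move=> x; exact: integral_ge0.
apply: eq_integral => x _; rewrite ge0_integral_gauss//; last first.
  exact: measurable_pair_comp.
rewrite -ge0_integralZr//; last 3 first.
- apply: emeasurable_funM; first exact: measurable_pair_comp.
  by apply/measurable_EFinP; exact: measurable_normal_pdf.
- by move=> y _; rewrite mule_ge0// lee_fin normal_pdf_ge0.
- by rewrite lee_fin normal_pdf_ge0.
by apply: eq_integral => y _; rewrite -muleA -EFinM mulrC.
Qed.

Lemma ge0_integral_gauss_opp (f : R -> \bar R) : measurable_fun setT f ->
  (forall x, 0 <= f x) ->
  \int[gauss]_x f (- x)%R = \int[gauss]_x f x.
Proof.
move=> mf f0; rewrite !ge0_integral_gauss//; last exact: measurableT_comp.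
rewrite [RHS](@ge0_integral_affine _ (-1) 0)//; last 2 first.
- apply: emeasurable_funM => //.
  by apply/measurable_EFinP; exact: measurable_normal_pdf.
- by move=> x; rewrite mule_ge0// lee_fin normal_pdf_ge0.
rewrite normrN1 mul1e; apply: eq_integral => x _.
by rewrite addr0 mulN1r !normal_pdf01 sqrrN.
Qed.

(** The planar change of variables is made of two affine substitutions on the line, exchanged by
    Tonelli: first [u = a x + b y] in place of [x], then [y = b u - a v]. The factors [|a^-1|] and
    [|a|] cancel, and the density is invariant by [normal_pdf_rot]. *)
Lemma ge0_gauss_rot (a b : R) (F : R * R -> \bar R) : (a ^+ 2 + b ^+ 2 = 1)%R ->
  measurable_fun setT F -> (forall z, 0 <= F z) ->
  \int[gauss]_x \int[gauss]_y F (a * x + b * y, b * x - a * y)%R =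
  \int[gauss]_x \int[gauss]_y F (x, y).
Proof.
move=> ab mF F0.
have mFr : measurable_fun setT
    (fun z : R * R => F (a * z.1 + b * z.2, b * z.1 - a * z.2)%R).
  by apply: measurable_pair_comp => //;
    [exact: measurable_lin|exact: measurable_linB].
(* The first substitution divides by [a]. If [a = 0] then [b] is 1 or -1, and the map is a swap,
   with both signs changed in the second case. *)
have [a0|a0] := eqVneq a 0%R.
  have mFb : measurable_fun setT (fun z : R * R => F (b * z.1, b * z.2)%R).
    by apply: measurable_pair_comp => //; apply: measurable_funM.
  transitivity (\int[gauss]_x \int[gauss]_y F (b * y, b * x)%R).
    apply: eq_integral => x _; apply: eq_integral => y _.
    by rewrite a0 !mul0r add0r subr0.
  transitivity (\int[gauss]_x \int[gauss]_y F (b * x, b * y)%R).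
    rewrite -(fubini_tonelli (fun z : R * R => F (b * z.2, b * z.1)%R))//.
    by apply: measurable_pair_comp => //; apply: measurable_funM.
  have : ((b == 1) || (b == -1))%R.
    by rewrite -sqrf_eq1 -ab a0 expr0n add0r.
  case/orP => /eqP ->.
    by apply: eq_integral => x _; apply: eq_integral => y _; rewrite !mul1r.
  transitivity (\int[gauss]_x \int[gauss]_y F (- x, y)%R).
    apply: eq_integral => x _; under eq_integral do rewrite !mulN1r.
    rewrite (ge0_integral_gauss_opp (f := fun y => F (- x, y)%R))//.
    exact: measurable_pair_comp.
  rewrite (ge0_integral_gauss_opp (f := fun x => \int[gauss]_y F (x, y)))//.
    exact: measurable_fun_fubini_tonelli_F.
  by move=> x; exact: integral_ge0.
transitivity (\int[leb]_x \int[leb]_y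
    (F (a * x + b * y, b * x - a * y)%R * (phi x * phi y)%:E)).
  exact: (ge0_integral_gauss2 mFr).
transitivity (\int[leb]_x \int[leb]_y (F (x, y) * (phi x * phi y)%:E)); last first.
  exact/esym/ge0_integral_gauss2.
pose L := fun z : R * R => F (a * z.1 + b * z.2, b * z.1 - a * z.2)%R * (phi z.1 * phi z.2)%:E.
have mL : measurable_fun setT L.
  by apply: emeasurable_funM => //; exact: measurable_normal_pdf2.
have L0 z : 0 <= L z by rewrite mule_ge0// lee_fin mulr_ge0// normal_pdf_ge0.
transitivity (\int[leb]_y \int[leb]_x L (x, y)); first exact: fubini_tonelli.
have aV0 : (a^-1 != 0)%R by rewrite invr_eq0.
transitivity (\int[leb]_y \int[leb]_x
    (`|a^-1|%:E * L (a^-1 * x + (- (a^-1 * b * y)), y)%R)).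
  apply: eq_integral => y _.
  rewrite (@ge0_integral_affine _ (a^-1) (- (a^-1 * b * y)) (fun x => L (x, y)))//; last first.
    exact: measurable_pair_comp.
  rewrite ge0_integralZl_EFin//.
  by apply: measurable_pair_comp => //; exact: measurable_affine.
transitivity (\int[leb]_u \int[leb]_y
    (`|a^-1|%:E * L (a^-1 * u + (- (a^-1 * b * y)), y)%R)).
  apply: (fubini_tonelli (fun z => `|a^-1|%:E *
    L (a^-1 * z.2 + (- (a^-1 * b * z.1)), z.1)%R)).
    apply: measurable_funeM; apply: measurable_pair_comp => //.
    apply: measurable_funD; first exact: measurable_funM.
    by apply: measurableT_comp => //; apply: measurable_funM.
  by move=> z; rewrite mule_ge0.
apply: eq_integral => u _.
rewrite (@ge0_integral_affine _ (- a) (b * u))//; last 3 first.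
- by rewrite oppr_eq0.
- apply: measurable_funeM; apply: measurable_pair_comp => //.
  by apply: measurable_funD => //; apply: measurableT_comp => //; apply: measurable_funM.
- by move=> y; rewrite mule_ge0.
rewrite -ge0_integralZl_EFin//; last 2 first.
- by move=> y _; rewrite mule_ge0.
- apply: measurable_funeM; apply: measurable_pair_comp => //; last exact: measurable_affine.
  apply: measurable_funD => //; apply: measurableT_comp => //; apply: measurable_funM => //.
  exact: measurable_affine.
apply: eq_integral => v _; rewrite muleA -EFinM normrN -normrM divff// normr1 mul1e.
rewrite /L/= -(normal_pdf_rot u v ab).
have b2 : (b ^+ 2 = 1 - a ^+ 2)%R by rewrite -ab; ring.
have -> : (a^-1 * u - a^-1 * b * (- a * v + b * u) = a * u + b * v)%R.
  transitivity (a^-1 * (1 - b ^+ 2) * u + b * v)%R; first by field.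
  by rewrite b2; field.
congr (F (_, _) * (_ * phi _)%:E).
- transitivity ((a ^+ 2 + b ^+ 2) * u)%R; first by ring.
  by rewrite ab mul1r.
- transitivity ((a ^+ 2 + b ^+ 2) * v)%R; first by ring.
  by rewrite ab mul1r.
- by ring.
Qed.

End gauss_rotation.

Section image_more.
Context {d1 d2 : measure_display} {T1 : measurableType d1} {T2 : measurableType d2}.
Context {R : realType}.
Local Open Scope ereal_scope.

(** Indicators are the test functions. Followed by [integral_image], this extends an identity known
    for nonnegative functions to all measurable ones. *)
Lemma integral_image_ge0 (m1 : {measure set T1 -> \bar R})
    (m2 : {measure set T2 -> \bar R}) (phi : T1 -> T2) :
  measurable_fun setT phi ->
  (forall f : T2 -> \bar R, measurable_fun setT f -> (forall y, 0 <= f y) ->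
    \int[m2]_y f y = \int[m1]_x f (phi x)) ->
  forall A, measurable A -> m2 A = m1 (phi @^-1` A).
Proof.
move=> mphi ge0 A mA.
have mpA : measurable (phi @^-1` A) by rewrite -[X in measurable X]setTI; exact: mphi.
have := ge0 (EFin \o \1_A); rewrite integral_indic// setIT => ->//.
- by rewrite -[in RHS](setIT (phi @^-1` A)) -integral_indic.
- by apply/measurable_EFinP; exact: measurable_indic.
- by move=> y; rewrite lee_fin.
Qed.

Lemma integral_prod_fst (P1 : probability T1 R) (P2 : probability T2 R)
    (f : T1 -> \bar R) : measurable_fun setT f ->
  \int[P1 \x P2]_z f z.1 = \int[P1]_x f x.
Proof.
move=> mf; apply/esym/(integral_image (m1 := (P1 \x P2))) => // A mA.
rewrite [X in _ = (_ \x _) X](_ : _ = A `*` setT); last first.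
  by apply/seteqP; split => [[x y]/=|[x y]/= []].
by rewrite product_measure1E// -[RHS]/(P1 A * P2 setT) probability_setT mule1.
Qed.

Lemma integral_prod_snd (P1 : probability T1 R) (P2 : probability T2 R)
    (f : T2 -> \bar R) : measurable_fun setT f ->
  \int[P1 \x P2]_z f z.2 = \int[P2]_x f x.
Proof.
move=> mf; apply/esym/(integral_image (m1 := (P1 \x P2))) => // A mA.
rewrite [X in _ = (_ \x _) X](_ : _ = setT `*` A); last first.
  by apply/seteqP; split => [[x y]/=|[x y]/= []].
by rewrite product_measure1E// -[RHS]/(P1 setT * P2 A) probability_setT mul1e.
Qed.

End image_more.

(** * Consequences of the invariance: convolution, shifts and moments *)

Section gauss_consequences.
Context {R : realType}.
Local Notation gam := (@gauss R).

(** For [a ^+ 2 + b ^+ 2 = 1] this is a reflection (determinant -1), hence its own inverse, which a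
    rotation would not be. *)
Definition rot (a b : R) (z : R * R) : R * R := (a * z.1 + b * z.2, b * z.1 - a * z.2).

Lemma measurable_rot a b : measurable_fun setT (rot a b).
Proof.
by apply: measurable_fun_pair; [exact: measurable_lin|exact: measurable_linB].
Qed.

Local Open Scope ereal_scope.

Lemma gauss_rot (a b : R) (F : R * R -> \bar R) : (a ^+ 2 + b ^+ 2 = 1)%R ->
  measurable_fun setT F ->
  \int[gam \x gam]_z F (rot a b z) = \int[gam \x gam]_z F z.
Proof.
move=> ab mF; apply/esym; move: F mF.
apply: (integral_image (m1 := gam \x gam) (m2 := gam \x gam) (measurable_rot a b)).
apply: (integral_image_ge0 (m1 := gam \x gam) (m2 := gam \x gam) (measurable_rot a b)) => F mF F0.
have mFr : measurable_fun setT (fun z => F (rot a b z)).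
  by apply: measurableT_comp => //; exact: measurable_rot.
apply: (eq_trans (fubini_tonelli1 F mF F0)).
apply: (eq_trans (esym (ge0_gauss_rot ab mF F0))).
exact/esym/(fubini_tonelli1 (fun z => F (rot a b z)) mFr (fun z => F0 _)).
Qed.

Lemma gauss_conv (a b : R) (f : R -> \bar R) : (a ^+ 2 + b ^+ 2 = 1)%R ->
  measurable_fun setT f ->
  \int[gam \x gam]_z f (a * z.1 + b * z.2)%R = \int[gam]_x f x.
Proof.
move=> ab mf; rewrite -(integral_prod_fst gam gam mf).
exact: (gauss_rot ab (measurableT_comp mf measurable_fst)).
Qed.

Lemma gauss_opp (f : R -> \bar R) : measurable_fun setT f ->
  \int[gam]_x f (- x)%R = \int[gam]_x f x.
Proof.
move=> mf; apply/esym; apply: integral_image => //.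
by apply: integral_image_ge0 => //= g mg g0; rewrite ge0_integral_gauss_opp.
Qed.

(** The Cameron-Martin formula on the line: completing the square in the density produces the
    factor. Exponential moments and the smoothness of Mehler averages both come from it. *)
Lemma gauss_shift (a : R) (f : R -> \bar R) : measurable_fun setT f ->
  (forall x, 0 <= f x) ->
  \int[gam]_x f (x + a)%R = \int[gam]_x (f x * (expR (a * x - a ^+ 2 / 2))%:E).
Proof.
move=> mf f0.
have mpdf (g : R -> R) : measurable_fun setT g -> measurable_fun setT (fun x => (normal_pdf 0 1 (g x))%:E).
  by move=> mg; apply/measurable_EFinP; apply: measurableT_comp => //; exact: measurable_normal_pdf.
have mexp : measurable_fun setT (fun x : R => (expR (a * x - a ^+ 2 / 2))%:E).
  apply/measurable_EFinP/measurableT_comp => //.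
  exact: (measurable_affine a (- (a ^+ 2 / 2))).
have mfa : measurable_fun setT (fun x : R => f (x + a)%R).
  by apply: measurableT_comp => //; apply: measurable_funD.
rewrite ge0_integral_gauss// ge0_integral_gauss//; last 2 first.
- exact: emeasurable_funM.
- by move=> x; rewrite mule_ge0// lee_fin expR_ge0.
rewrite [RHS](@ge0_integral_affine _ 1 a) ?oner_eq0//; last 2 first.
- by apply: emeasurable_funM; [exact: emeasurable_funM|exact: mpdf].
- by move=> x; rewrite !mule_ge0// lee_fin ?expR_ge0 ?normal_pdf_ge0.
rewrite normr1 mul1e; apply: eq_integral => x _; rewrite mul1r -muleA -EFinM.
congr (_ * _%:E); rewrite !normal_pdf01 mulrCA -expRD; congr (_ * expR _)%R.
by field.
Qed.

Lemma gauss_exp (a : R) : \int[gam]_x (expR (a * x))%:E = (expR (a ^+ 2 / 2))%:E.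
Proof.
have mexp (c : R): measurable_fun setT (fun x : R => (expR (a * x + c))%:E).
  by apply/measurable_EFinP/measurableT_comp => //; exact: measurable_affine.
have := @gauss_shift a (cst 1) (measurable_cst _) (fun=> lee01).
rewrite integral_cst//= [gam _]probability_setT mul1e.
under eq_integral do rewrite mul1e.
move=> E; transitivity (\int[gam]_x ((expR (a ^+ 2 / 2))%:E * (expR (a * x - a ^+ 2 / 2))%:E)).
  by apply: eq_integral => x _; rewrite -EFinM -expRD addrCA subrr addr0.
rewrite ge0_integralZl_EFin ?expR_ge0//.
by rewrite -E mule1.
Qed.

Lemma gauss_expabs (a : R) : gam.-integrable setT (fun x => (expR (a * `|x|))%:E).
Proof.
have mexp (c : R): measurable_fun setT (fun x : R => (expR (c * x))%:E).
  by apply/measurable_EFinP/measurableT_comp => //; exact: measurable_funM.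
have iexp (c : R) : gam.-integrable setT (fun x => (expR (c * x))%:E).
  apply/integrableP; split => //; under eq_integral do rewrite gee0_abs ?lee_fin ?expR_ge0//.
  by rewrite gauss_exp ltry.
have /(_ measurableT) := @integrableD _ _ _ gam setT _ _ _ (iexp a) (iexp (- a)%R).
apply: le_integrable => //.
  apply/measurable_EFinP/measurableT_comp => //; apply: measurable_funM => //.
move=> x _; rewrite -EFinD !gee0_abs ?lee_fin ?addr_ge0 ?expR_ge0//.
by case: (ger0P x) => _; rewrite ?lerDl ?lerDr ?expR_ge0// mulrN mulNr lerDr expR_ge0.
Qed.

Lemma gauss_normX (k : nat) : gam.-integrable setT (fun x => (`|x| ^+ k)%:E).
Proof.
have := @integrableZl _ _ _ gam setT measurableT (k`!%:R)%R _ (gauss_expabs 1).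
apply: le_integrable => //.
  by apply/measurable_EFinP; apply: measurable_funX.
move=> x _; rewrite -EFinM !gee0_abs ?lee_fin ?exprn_ge0// ?mulr_ge0 ?expR_ge0//.
rewrite mul1r mulrC -ler_pdivrMr ?ltr0n ?fact_gt0//.
have [k0|k0] := posnP k; first by rewrite k0 expr0 fact0 divr1 -expR0 ler_expR.
have := expR_ge1Dxn k.-1 (normr_ge0 x); rewrite prednK//; apply: le_trans.
by rewrite lerDr.
Qed.
End gauss_consequences.

(** * Integrals of bounded measurable functions *)

Section bm.
Context {d} {T : measurableType d} {R : realType}.
Implicit Types (f g : T -> R).

(** On a probability space these functions have finite integrals and satisfy Fubini without side
    conditions. The inequalities are proved inside this class and reach unbounded functions by
    truncation. *)
Definition bm f := measurable_fun setT f /\ exists M : R, forall x, `|f x| <= M.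

Lemma bm_meas f : bm f -> measurable_fun setT f. Proof. by case. Qed.

Lemma bm_cst (c : R) : bm (fun=> c).
Proof. by split => //; exists `|c|. Qed.

Lemma bmD f g : bm f -> bm g -> bm (fun x => f x + g x).
Proof.
move=> [mf [M fM]] [mg [N gN]]; split; first exact: measurable_funD.
by exists (M + N) => x; rewrite (le_trans (ler_normD _ _))// lerD.
Qed.

Lemma bmM f g : bm f -> bm g -> bm (fun x => f x * g x).
Proof.
move=> [mf [M fM]] [mg [N gN]]; split; first exact: measurable_funM.
by exists (M * N) => x; rewrite normrM ler_pM.
Qed.

Lemma bmZ (c : R) f : bm f -> bm (fun x => c * f x).
Proof. by move=> bf; apply: bmM => //; exact: bm_cst. Qed.

Lemma bm_powR f s : 0 <= s -> bm f -> (forall x, 0 <= f x) -> bm (fun x => f x `^ s).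
Proof.
move=> s0 [mf [M fM]] f0; split.
  exact: (@measurableT_comp _ _ _ _ _ _ (@powR R ^~ s) _ f).
exists (M `^ s) => x; rewrite ger0_norm ?powR_ge0//.
have fx : f x <= M by rewrite -(ger0_norm (f0 x)).
by rewrite ge0_ler_powR// nnegrE// (le_trans (f0 x)).
Qed.

Variable P : probability T R.

Lemma bm_int f : bm f -> P.-integrable setT (EFin \o f).
Proof.
move=> [mf [M fM]]; apply: measurable_bounded_integrable => //.
  by apply: le_lt_trans (ltry 1); rewrite le_eqVlt; apply/orP; left; apply/eqP; exact: probability_setT.
exists M; split; first exact: num_real.
by move=> x Mx y _; exact: le_trans (fM y) (ltW Mx).
Qed.

Lemma bm_EFin f : bm f -> (\int[P]_x f x)%:E = (\int[P]_x (f x)%:E)%E.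
Proof.
by move=> bf; rewrite fineK//; apply: integrable_fin_num => //; exact: bm_int.
Qed.

Lemma Rint_cst (c : R) : \int[P]_x c = c.
Proof. rewrite Rintegral_cst// -[RHS]mulr1; congr (c * _).
by rewrite -[RHS]/(fine 1%E); congr fine; exact: probability_setT. Qed.

Lemma RintD f g : P.-integrable setT (EFin \o f) -> P.-integrable setT (EFin \o g) ->
  \int[P]_x (f x + g x) = \int[P]_x f x + \int[P]_x g x.
Proof. by move=> If Ig; rewrite RintegralD. Qed.

Lemma RintZ (c : R) f : P.-integrable setT (EFin \o f) ->
  \int[P]_x (c * f x) = c * \int[P]_x f x.
Proof. by move=> If; rewrite RintegralZl. Qed.

Lemma integrableDR f g : P.-integrable setT (EFin \o f) ->
  P.-integrable setT (EFin \o g) -> P.-integrable setT (EFin \o (fun x => f x + g x)).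
Proof. by move=> If Ig; have /(_ measurableT) := integrableD _ If Ig. Qed.

Lemma integrableZR (c : R) f : P.-integrable setT (EFin \o f) ->
  P.-integrable setT (EFin \o (fun x => c * f x)).
Proof. by move=> If; have /(_ measurableT c) := integrableZl _ _ If. Qed.

Lemma Rint_le f g : P.-integrable setT (EFin \o f) -> P.-integrable setT (EFin \o g) ->
  (forall x, f x <= g x) -> \int[P]_x f x <= \int[P]_x g x.
Proof. by move=> If Ig fg; apply: le_Rintegral => // x _. Qed.

Lemma Rint_lb f m : bm f -> (forall x, m <= f x) -> m <= \int[P]_x f x.
Proof.
move=> bf mf; rewrite -(Rint_cst m); apply: Rint_le => //; apply: bm_int => //.
exact: bm_cst.
Qed.

Lemma Rint_ub f m : bm f -> (forall x, f x <= m) -> \int[P]_x f x <= m.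
Proof.
move=> bf mf; rewrite -[leRHS](Rint_cst m); apply: Rint_le => //; apply: bm_int => //.
exact: bm_cst.
Qed.

Lemma Rint_normub f m : bm f -> (forall x, `|f x| <= m) -> `|\int[P]_x f x| <= m.
Proof.
move=> bf mf; rewrite ler_norml; apply/andP; split.
  by apply: Rint_lb => // x; have := mf x; rewrite ler_norml => /andP[].
by apply: Rint_ub => // x; have := mf x; rewrite ler_norml => /andP[].
Qed.

End bm.

Lemma bm_comp {d d'} {T : measurableType d} {U : measurableType d'} {R : realType}
    (f : U -> R) (g : T -> U) :
  bm f -> measurable_fun setT g -> bm (fun x => f (g x)).
Proof.
move=> [mf [M fM]] mg; split; first exact: measurableT_comp.
by exists M => x.
Qed.

Section bm2.
Context {d1 d2} {T1 : measurableType d1} {T2 : measurableType d2} {R : realType}.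
Variables (P1 : probability T1 R) (P2 : probability T2 R).
Implicit Types F : T1 * T2 -> R.

Lemma bm_slice1 F y : bm F -> bm (fun x => F (x, y)).
Proof. by move=> bF; apply: (bm_comp bF); exact: measurable_fun_pair. Qed.

Lemma bm_slice2 F x : bm F -> bm (fun y => F (x, y)).
Proof. by move=> bF; apply: (bm_comp bF); exact: measurable_fun_pair. Qed.

Lemma Rint_prod F : bm F ->
  \int[(P1 \x P2)%E]_z F z = \int[P1]_x \int[P2]_y F (x, y).
Proof.
move=> bF; rewrite /Rintegral -integral12_prod_meas1; last exact: bm_int.
congr fine; apply: eq_integral => x _; rewrite /fubini_F.
by rewrite -bm_EFin//; exact: bm_slice2.
Qed.

Lemma Rint_prodr F : bm F ->
  \int[(P1 \x P2)%E]_z F z = \int[P2]_y \int[P1]_x F (x, y).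
Proof.
move=> bF; rewrite /Rintegral -integral21_prod_meas1; last exact: bm_int.
congr fine; apply: eq_integral => x _; rewrite /fubini_G.
by rewrite -bm_EFin//; exact: bm_slice1.
Qed.

Lemma Rint_swap F : bm F ->
  \int[P1]_x \int[P2]_y F (x, y) = \int[P2]_y \int[P1]_x F (x, y).
Proof. by move=> bF; rewrite -Rint_prod// Rint_prodr. Qed.

Lemma bm_Rint F : bm F -> bm (fun x => \int[P2]_y F (x, y)).
Proof.
move=> bF; have [mF [M FM]] := bF; split; last first.
  by exists M => x; apply: Rint_normub => //; exact: bm_slice2.
(* Adding the bound [M] makes the integrand nonnegative, so Tonelli supplies the measurability; the
   constant is subtracted afterwards. *)
have bFM : bm (fun z => F z + M) by apply: bmD => //; exact: bm_cst.
rewrite (_ : (fun x => _) =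
    fun x => fine (\int[P2]_y (F (x, y) + M)%:E)%E - M); last first.
  apply/funext => x; rewrite -[fine _]/(\int[P2]_y (F (x, y) + M)).
  rewrite RintD; last 2 first.
  - by apply: bm_int; exact: bm_slice2.
  - by apply: bm_int; exact: bm_cst.
  by rewrite Rint_cst addrK.
apply: measurable_funB => //; apply: measurableT_comp => //.
apply: (measurable_fun_fubini_tonelli_F (fun z => (F z + M)%:E)).
  by apply/measurable_EFinP; exact: bm_meas bFM.
move=> z; rewrite lee_fin -lerBlDr sub0r.
by have := FM z; rewrite ler_norml => /andP[].
Qed.

End bm2.

(** * The two-point inequality up to third order *)

Section real_ineq.
Context {R : realType}.
Implicit Types (u v w x s t : R).

Lemma derive_ge0_ge (f df : R -> R) : (forall x, is_derive x 1 f (df x)) ->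
  (forall x, 0 <= x -> 0 <= df x) -> forall x, 0 <= x -> f 0 <= f x.
Proof.
move=> fdf df0 x x0.
have fd y : derivable f y 1 by case: (fdf y).
have fE y : derive1 f y = df y by rewrite derive1E; case: (fdf y).
apply: (@ger0_derive1_ndecry _ f 0) => // [y|].
  by rewrite in_itv/= andbT fE => /ltW; exact: df0.
by apply: derivable_within_continuous => y _.
Qed.

Lemma expR_sub1_le x : expR x - 1 <= x * expR x.
Proof.
have := expR_ge1Dx (- x); rewrite -(ler_pM2r (expR_gt0 x)) -expRD addNr expR0.
by rewrite mulrBl mul1r; lra.
Qed.

Lemma expR_taylor1 x : 0 <= x -> expR x - 1 - x <= x ^+ 2 * expR x.
Proof.
move=> x0; rewrite -subr_ge0.
pose f := fun x => x ^+ 2 * expR x - (expR x - 1 - x).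
have -> : 0 = f 0 by rewrite /f expR0 expr0n/=; lra.
pose df := fun x : R => (x *+ 2 * expR x + x ^+ 2 * expR x) - (expR x - 1).
apply: (@derive_ge0_ge f df) => // y.
  rewrite /f /df; apply: is_derive_eq.
  by rewrite /GRing.scale/=; ring.
move=> y0; have := expR_sub1_le y; rewrite /df.
have : 0 <= y ^+ 2 * expR y by rewrite mulr_ge0 ?expR_ge0// sqr_ge0.
have : 0 <= y * expR y by rewrite mulr_ge0 ?expR_ge0.
by rewrite mulrnAl; lra.
Qed.

Lemma expR_taylor2 x : 0 <= x -> expR x - 1 - x - x ^+ 2 / 2 <= x ^+ 3 * expR x.
Proof.
move=> x0; rewrite -subr_ge0.
pose f := fun x : R => x ^+ 3 * expR x - (expR x - 1 - x - x ^+ 2 / 2).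
have -> : 0 = f 0 by rewrite /f expR0 !expr0n/=; lra.
pose df := fun x : R => (3 * x ^+ 2 * expR x + x ^+ 3 * expR x) - (expR x - 1 - x).
apply: (@derive_ge0_ge f df) => // y.
  rewrite /f /df; apply: is_derive_eq.
  by rewrite /GRing.scale/=; field.
move=> y0; have := expR_taylor1 y0; rewrite /df.
have : 0 <= y ^+ 2 * expR y by rewrite mulr_ge0 ?expR_ge0// sqr_ge0.
have : 0 <= y ^+ 3 * expR y by rewrite mulr_ge0 ?expR_ge0// exprn_ge0.
by lra.
Qed.

Lemma expRN_taylor2 x : 0 <= x -> expR (- x) <= 1 - x + x ^+ 2 / 2.
Proof.
move=> x0; rewrite -subr_ge0.
pose f := fun x : R => 1 - x + x ^+ 2 / 2 - expR (- x).
have -> : 0 = f 0 by rewrite /f oppr0 expR0 !expr0n/=; lra.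
pose df := fun x : R => - 1 + x + expR (- x).
apply: (@derive_ge0_ge f df) => // y.
  rewrite /f /df; apply: is_derive_eq.
  by rewrite /GRing.scale/=; field.
by move=> y0; have := expR_ge1Dx (- y); rewrite /df; lra.
Qed.

Lemma expR_ub x : expR x <= 1 + x + x ^+ 2 / 2 + `|x| ^+ 3 * expR `|x|.
Proof.
have [x0|x0] := leP 0 x.
  by rewrite ger0_norm//; have := expR_taylor2 x0; lra.
have := @expRN_taylor2 (- x); rewrite opprK sqrrN => /(_ _)/le_trans; apply.
  by rewrite oppr_ge0 ltW.
by rewrite lerDl mulr_ge0 ?expR_ge0// exprn_ge0.
Qed.

(** This is [ln (1 + u) <= u - u^2/2 + |u|^3] in exponential form, which stays meaningful at
    [u = -1]. Each sign follows from the monotonicity of [1 + u] divided by the exponential; for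
    negative [u] the bound holds already at second order. *)
Lemma onep_le_expR u : - 1 <= u -> 1 + u <= expR (u - u ^+ 2 / 2 + `|u| ^+ 3).
Proof.
have pos x : 0 <= x -> 1 + x <= expR (x - x ^+ 2 / 2 + x ^+ 3).
  move=> x0.
  pose f := fun x : R => - ((1 + x) * expR (- (x - x ^+ 2 / 2 + x ^+ 3))).
  pose df := fun x : R => (2 * x ^+ 2 + 3 * x ^+ 3) * expR (- (x - x ^+ 2 / 2 + x ^+ 3)).
  have : f 0 <= f x.
    apply: (@derive_ge0_ge f df) => // y.
      rewrite /f /df; apply: is_derive_eq.
      by rewrite /GRing.scale/=; field.
    move=> y0; rewrite /df mulr_ge0 ?expR_ge0//.
    by rewrite addr_ge0// mulr_ge0// ?exprn_ge0.
  have -> : f 0 = - 1.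
    by rewrite /f (_ : - (0 - 0 ^+ 2 / 2 + 0 ^+ 3) = 0 :> R) ?expR0; ring.
  by rewrite /f lerN2 expRN ler_pdivrMr ?expR_gt0// mul1r.
have neg x : 0 <= x -> 1 - x <= expR (- x - x ^+ 2 / 2).
  move=> x0.
  pose f := fun x : R => - ((1 - x) * expR (x + x ^+ 2 / 2)).
  pose df := fun x : R => x ^+ 2 * expR (x + x ^+ 2 / 2).
  have : f 0 <= f x.
    apply: (@derive_ge0_ge f df) => // y.
      rewrite /f /df; apply: is_derive_eq.
      by rewrite /GRing.scale/=; field.
    by move=> y0; rewrite /df mulr_ge0 ?expR_ge0// sqr_ge0.
  have -> : f 0 = - 1.
    by rewrite /f (_ : 0 + 0 ^+ 2 / 2 = 0 :> R) ?expR0; ring.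
  by rewrite /f lerN2 -ler_pdivlMr ?expR_gt0// mul1r -expRN opprD.
move=> u1; have [u0|u0] := leP 0 u; first by rewrite ger0_norm// pos.
have := neg (- u); rewrite opprK sqrrN => /(_ _)/le_trans; apply.
  by rewrite oppr_ge0 ltW.
by rewrite ler_expR lerDl exprn_ge0.
Qed.

(* the Hessian-type quadratic form of (a, b) |-> a^s b^t in logarithmic increments *)
Definition qform s t u v := s * (1 - s) * u ^+ 2 + t * (1 - t) * v ^+ 2 - 2 * s * t * u * v.

(** The cubic coefficient of [powR_prod_ub], with [K] bounding [|u|] and [|v|]: 1 from the cubic
    terms of the two logarithms, the middle term from [w^2 - l^2], the last one from the exponential
    remainder, where [|w| <= (1 + 6 K^2) (|u| + |v|)]. *)
Definition Lcst (K : R) := 1 + 3 * K * (2 + 6 * K ^+ 2) / 2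
  + (1 + 6 * K ^+ 2) ^+ 3 * expR (2 * K * (1 + 6 * K ^+ 2)).

(** Both logarithms are expanded to second order into an exponent [w], then [expR w] is expanded in
    turn. The quadratic contributions [-(s u^2 + t v^2)/2] and [(s u + t v)^2/2] add up to
    [- qform s t u v / 2]. *)
Lemma powR_prod_ub s t K u v : 0 <= s <= 1 -> 0 <= t <= 1 -> 1 <= K ->
  - 1 <= u -> - 1 <= v -> `|u| <= K -> `|v| <= K ->
  (1 + u) `^ s * (1 + v) `^ t <=
  1 + s * u + t * v - qform s t u v / 2 + Lcst K * (`|u| + `|v|) ^+ 3.
Proof.
move=> /andP[s0 s1] /andP[t0 t1] K1 u1 v1 uK vK.
set m := `|u| + `|v|.
have m0 : 0 <= m by rewrite addr_ge0.
have K0 : 0 <= K by exact: le_trans ler01 K1.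
have mK : m <= 2 * K by rewrite /m; lra.
pose w := s * (u - u ^+ 2 / 2 + `|u| ^+ 3) + t * (v - v ^+ 2 / 2 + `|v| ^+ 3).
have step1 : (1 + u) `^ s * (1 + v) `^ t <= expR w.
  rewrite /w expRD (mulrC s) (mulrC t) !expRM.
  apply: ler_pM; rewrite ?powR_ge0//.
    by apply: ge0_ler_powR; rewrite ?nnegrE ?expR_ge0 ?onep_le_expR//; lra.
  by apply: ge0_ler_powR; rewrite ?nnegrE ?expR_ge0 ?onep_le_expR//; lra.
apply: (le_trans step1); apply: (le_trans (expR_ub w)).
pose l := s * u + t * v.
have lm : `|l| <= m.
  rewrite (le_trans (ler_normD _ _))// !normrM (ger0_norm s0) (ger0_norm t0).
  by rewrite lerD// ler_piMl.
have um : `|u| ^+ 2 + `|v| ^+ 2 <= m ^+ 2.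
  have : 0 <= `|u| * `|v| by rewrite mulr_ge0.
  by rewrite /m; nra.
have um3 : `|u| ^+ 3 + `|v| ^+ 3 <= m ^+ 3.
  have : 0 <= `|u| ^+ 2 * `|v| by rewrite mulr_ge0 ?exprn_ge0.
  have : 0 <= `|u| * `|v| ^+ 2 by rewrite mulr_ge0 ?exprn_ge0.
  by rewrite /m; nra.
have su2 : 0 <= s * `|u| ^+ 2 + t * `|v| ^+ 2 <= m ^+ 2.
  rewrite addr_ge0 ?mulr_ge0 ?exprn_ge0//=; apply: le_trans um.
  by rewrite lerD// ler_piMl ?exprn_ge0.
have su3 : 0 <= s * `|u| ^+ 3 + t * `|v| ^+ 3 <= m ^+ 3.
  rewrite addr_ge0 ?mulr_ge0 ?exprn_ge0//=; apply: le_trans um3.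
  by rewrite lerD// ler_piMl ?exprn_ge0.
have wl : w = l - (s * `|u| ^+ 2 + t * `|v| ^+ 2) / 2 + (s * `|u| ^+ 3 + t * `|v| ^+ 3).
  by rewrite /w /l !real_normK ?num_real//; ring.
have m3 : m ^+ 3 <= m ^+ 2 * (2 * K).
  by rewrite exprSr ler_wpM2l ?exprn_ge0.
have m2 : m ^+ 2 <= m * (2 * K).
  by rewrite expr2 ler_wpM2l.
have dwl : `|w - l| <= 3 * K * m ^+ 2.
  have mm : m ^+ 2 <= K * m ^+ 2 by rewrite ler_peMl ?exprn_ge0.
  by rewrite ler_norml wl; apply/andP; split; lra.
pose K3 := 1 + 6 * K ^+ 2.
have wK3 : `|w| <= K3 * m.
  rewrite -(subrK l w) (le_trans (ler_normD _ _))// /K3.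
  have : 3 * K * m ^+ 2 <= 3 * K * (m * (2 * K)) by rewrite ler_wpM2l ?mulr_ge0.
  by lra.
have K31 : 1 <= K3 by rewrite /K3 lerDl mulr_ge0// exprn_ge0.
have w2 : w ^+ 2 / 2 <= l ^+ 2 / 2 + 3 * K * (2 + 6 * K ^+ 2) / 2 * m ^+ 3.
  have : (w - l) * (w + l) <= (3 * K * m ^+ 2) * (K3 * m + m).
    rewrite (le_trans (ler_norm _))// normrM ler_pM//.
    by rewrite (le_trans (ler_normD _ _))// lerD.
  by rewrite /K3; lra.
have w3 : `|w| ^+ 3 * expR `|w| <= (K3 ^+ 3 * expR (2 * K * K3)) * m ^+ 3.
  have -> : K3 ^+ 3 * expR (2 * K * K3) * m ^+ 3 = (K3 * m) ^+ 3 * expR (2 * K * K3).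
    by rewrite exprMn; ring.
  apply: ler_pM; rewrite ?exprn_ge0 ?expR_ge0//.
    by rewrite lerXn2r// nnegrE// (le_trans _ wK3).
  by rewrite ler_expR (le_trans wK3)// mulrC ler_wpM2r// (le_trans ler01 K31).
have ql : - (s * `|u| ^+ 2 + t * `|v| ^+ 2) / 2 + l ^+ 2 / 2 = - qform s t u v / 2.
  by rewrite /l /qform !real_normK ?num_real//; ring.
have LE : Lcst K * m ^+ 3 = m ^+ 3 + 3 * K * (2 + 6 * K ^+ 2) / 2 * m ^+ 3
    + K3 ^+ 3 * expR (2 * K * K3) * m ^+ 3 by rewrite /Lcst -/K3; ring.
rewrite LE; move: w2 w3 su3 => w2 w3 /andP[_ su3].
have := ql; rewrite {1}wl /l; lra.
Qed.

Lemma prod_diff_le u v p q e n : `|u - p| <= e -> `|v - q| <= e ->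
  `|u| <= n -> `|q| <= n -> `|u * v - p * q| <= 2 * e * n.
Proof.
move=> up vq un qn; have -> : u * v - p * q = u * (v - q) + (u - p) * q by ring.
rewrite (le_trans (ler_normD _ _))// !normrM.
have : `|u| * `|v - q| <= n * e by rewrite ler_pM.
have : `|u - p| * `|q| <= e * n by rewrite ler_pM.
by lra.
Qed.

Lemma qform_diff s t u v p q e n : 0 <= s <= 1 -> 0 <= t <= 1 ->
  `|u - p| <= e -> `|v - q| <= e -> `|u| <= n -> `|v| <= n ->
  `|p| <= n -> `|q| <= n -> qform s t p q - qform s t u v <= 8 * e * n.
Proof.
move=> /andP[s0 s1] /andP[t0 t1] up vq un vn pn qn.
have A := prod_diff_le up up un pn.
have B := prod_diff_le vq vq vn qn.
have C := prod_diff_le up vq un qn.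
have N0 : 0 <= 2 * e * n.
  by apply: le_trans A; rewrite normr_ge0.
have aux c y : 0 <= c <= 1 -> `|y| <= 2 * e * n -> `|c * y| <= 2 * e * n.
  by move=> /andP[c0 c1] yn; rewrite normrM (ger0_norm c0) (le_trans _ yn)// ler_piMl.
have A' : `|s * (1 - s) * (u * u - p * p)| <= 2 * e * n.
  by apply: aux => //; apply/andP; split; nra.
have B' : `|t * (1 - t) * (v * v - q * q)| <= 2 * e * n.
  by apply: aux => //; apply/andP; split; nra.
have C' : `|s * t * (u * v - p * q)| <= 2 * e * n.
  by apply: aux => //; apply/andP; split; nra.
move: A' B' C'; rewrite !ler_norml /qform => /andP[A1 A2] /andP[B1 B2] /andP[C1 C2].
by lra.
Qed.

(** With [Z = 1 + x^2 + y^2], the first term is the cost of replacing [u] and [v] in [qform] by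
    their linear parts: half of [qform_diff] at [e = c g^2 Z] and [n = 2 c g Z]. The second term is
    the cubic remainder, as [|u| + |v| <= 4 c g Z]. *)
Definition Dcst (c K : R) := 8 * c ^+ 2 + 64 * Lcst K * c ^+ 3.

Lemma Lcst_ge0 K : 0 <= K -> 0 <= Lcst K.
Proof.
move=> K0; rewrite /Lcst; have K2 : 0 <= K ^+ 2 by exact: exprn_ge0.
have : 0 <= 3 * K * (2 + 6 * K ^+ 2) by rewrite !mulr_ge0//; lra.
have : 0 <= (1 + 6 * K ^+ 2) ^+ 3 * expR (2 * K * (1 + 6 * K ^+ 2)).
  by rewrite mulr_ge0 ?expR_ge0// exprn_ge0//; lra.
by lra.
Qed.

(** Once [a^s b^t] is taken out, [A] and [D] enter through their relative deviations from [a] and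
    [b]. The linear terms are kept exact, since they will integrate to zero; in the quadratic form
    the deviations are replaced by [k g x] and [l g y], whose second moments are known. *)
Lemma one_step_pointwise s t c K a b A D k l x y g :
  0 <= s <= 1 -> 0 <= t <= 1 -> 1 <= K -> 0 <= c ->
  0 < a -> 0 < b -> 0 <= A -> 0 <= D -> `|(A - a) / a| <= K -> `|(D - b) / b| <= K ->
  0 <= g <= 1 -> `|k| <= c -> `|l| <= c ->
  `|(A - a) / a - k * (g * x)| <= c * g ^+ 2 * (1 + x ^+ 2 + y ^+ 2) ->
  `|(D - b) / b - l * (g * y)| <= c * g ^+ 2 * (1 + x ^+ 2 + y ^+ 2) ->
  A `^ s * D `^ t <= a `^ s * b `^ t *
    (1 + s * ((A - a) / a) + t * ((D - b) / b) - g ^+ 2 * qform s t (k * x) (l * y) / 2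
     + Dcst c K * g ^+ 3 * (1 + x ^+ 2 + y ^+ 2) ^+ 3).
Proof.
move=> s01 t01 K1 c0 a0 b0 A0 D0 uK vK /andP[g0 g1] kc lc.
set Z := 1 + x ^+ 2 + y ^+ 2; set u := (A - a) / a; set v := (D - b) / b => uk vl.
have Z1 : 1 <= Z by rewrite /Z; have := sqr_ge0 x; have := sqr_ge0 y; lra.
have Z0 : 0 <= Z by exact: le_trans ler01 Z1.
have K0 : 0 <= K by exact: le_trans ler01 K1.
have xZ : `|x| <= Z by rewrite /Z; have := sqr_ge0 y; rewrite -(real_normK (num_real x)); have := sqr_ge0 (`|x| - 1); nra.
have yZ : `|y| <= Z by rewrite /Z; have := sqr_ge0 x; rewrite -(real_normK (num_real y)); have := sqr_ge0 (`|y| - 1); nra.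
have uE : A = a * (1 + u) by rewrite /u; field; rewrite gt_eqF.
have vE : D = b * (1 + v) by rewrite /v; field; rewrite gt_eqF.
have u1 : - 1 <= u by rewrite -subr_ge0 opprK addrC -(pmulr_rge0 _ a0) -uE.
have v1 : - 1 <= v by rewrite -subr_ge0 opprK addrC -(pmulr_rge0 _ b0) -vE.
have -> : A `^ s * D `^ t = a `^ s * b `^ t * ((1 + u) `^ s * (1 + v) `^ t).
  by rewrite {1}uE {1}vE !powRM ?(ltW a0) ?(ltW b0) 1?mulrACA// addrC -lerBlDr sub0r.
rewrite ler_wpM2l ?mulr_ge0 ?powR_ge0//.
apply: le_trans (powR_prod_ub s01 t01 K1 u1 v1 uK vK) _.
have g2 : g ^+ 2 <= g by rewrite expr2 ler_piMl.
have pb k' z : `|k'| <= c -> `|z| <= Z -> `|k' * (g * z)| <= c * g * Z.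
  move=> kc' zZ; rewrite !normrM (ger0_norm g0) mulrA ler_pM ?mulr_ge0//.
  by rewrite ler_wpM2r.
have cgZ : c * g ^+ 2 * Z <= c * g * Z.
  by rewrite ler_wpM2r ?ler_wpM2l.
have pn := pb _ _ kc xZ; have qn := pb _ _ lc yZ.
have cgZ0 : 0 <= c * g * Z by rewrite !mulr_ge0.
have dE : 2 * c * g * Z = c * g * Z + c * g * Z by ring.
have nn : c * g * Z <= 2 * c * g * Z by rewrite dE lerDl.
have un : `|u| <= 2 * c * g * Z.
  rewrite -(subrK (k * (g * x)) u) (le_trans (ler_normD _ _))// dE.
  by rewrite lerD// (le_trans uk cgZ).
have vn : `|v| <= 2 * c * g * Z.
  rewrite -(subrK (l * (g * y)) v) (le_trans (ler_normD _ _))// dE.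
  by rewrite lerD// (le_trans vl cgZ).
have := qform_diff s01 t01 uk vl un vn (le_trans pn nn) (le_trans qn nn).
have -> : qform s t (k * (g * x)) (l * (g * y)) = g ^+ 2 * qform s t (k * x) (l * y).
  by rewrite /qform; ring.
have m3 : (`|u| + `|v|) ^+ 3 <= (4 * c * g * Z) ^+ 3.
  rewrite lerXn2r ?nnegrE ?addr_ge0 ?mulr_ge0//.
  rewrite (_ : 4 * c * g * Z = 2 * c * g * Z + 2 * c * g * Z); last by ring.
  exact: lerD.
have Lm : Lcst K * (`|u| + `|v|) ^+ 3 <= Lcst K * (4 * c * g * Z) ^+ 3.
  by rewrite ler_wpM2l// Lcst_ge0.
have Z2 : c ^+ 2 * g ^+ 3 * Z ^+ 2 <= c ^+ 2 * g ^+ 3 * Z ^+ 3.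
  rewrite ler_wpM2l ?mulr_ge0 ?exprn_ge0//.
  by rewrite (exprSr Z 2) ler_peMr// exprn_ge0.
rewrite /Dcst; move: (qform _ _ _ _) (qform _ _ _ _) Lm Z2 => q1 q2 Lm Z2.
by clear -Lm Z2; lra.
Qed.

End real_ineq.

Section smooth_class.
Context {R : realType}.

(* C^{1,1} functions with values in [m, M]; f1 plays the role of the derivative *)
Definition smooth (m M C : R) (f : R -> R) := exists f1 : R -> R,
  [/\ measurable_fun setT f /\ measurable_fun setT f1,
      forall x, m <= f x <= M, forall x, `|f1 x| <= C &
      forall x k, `|f (x + k) - f x - f1 x * k| <= C * k ^+ 2].

Lemma bm_between {d} {T : measurableType d} (m M : R) (f : T -> R) :
  measurable_fun setT f -> (forall x, m <= f x <= M) -> bm f.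
Proof.
move=> mf fM; split => //; exists (`|m| + `|M|) => x.
have /andP[mx xM] := fM x.
have := ler_norm M; have := ler_norm (- m); rewrite normrN.
have := normr_ge0 m; have := normr_ge0 M.
by rewrite ler_norml; lra.
Qed.

Lemma norm_sub_le_ub (m M z A : R) :
  0 < m -> m <= z <= M -> m <= A <= M -> `|A - z| <= M.
Proof. by move=> m0 /andP[? ?] /andP[? ?]; rewrite ler_norml; apply/andP; split; lra. Qed.

Lemma smooth_bm m M C f : smooth m M C f -> bm f.
Proof. by move=> [f1 [[mf _] fM _ _]]; exact: bm_between fM. Qed.

End smooth_class.

(** * One step for a correlated pair, and its doubling *)

Section one_step.
Context {d} {T : measurableType d} {R : realType}.
Variables (P : probability T R) (X Y : T -> R).
Hypotheses (mX : measurable_fun setT X) (mY : measurable_fun setT Y).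
Let Z (w : T) : R := 1 + X w ^+ 2 + Y w ^+ 2.
Hypothesis iZ : P.-integrable setT (EFin \o (fun w => Z w ^+ 3)).
Hypotheses (X0 : \int[P]_w X w = 0) (Y0 : \int[P]_w Y w = 0).
Variables (m2 rho : R).
Hypotheses (X2 : \int[P]_w (X w ^+ 2) = m2) (Y2 : \int[P]_w (Y w ^+ 2) = m2)
  (XY : \int[P]_w (X w * Y w) = rho * m2).

Let Z1 w : 1 <= Z w.
Proof. by rewrite /Z; have := sqr_ge0 (X w); have := sqr_ge0 (Y w); lra. Qed.

Let ZZ3 w : Z w <= Z w ^+ 3.
Proof.
rewrite exprS ler_peMr//; first exact: le_trans ler01 (Z1 w).
by rewrite exprn_ege1.
Qed.

Let dom (f : T -> R) : measurable_fun setT f -> (forall w, `|f w| <= Z w) ->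
  P.-integrable setT (EFin \o f).
Proof.
move=> mf fZ; apply: le_integrable iZ => //; first exact/measurable_EFinP.
move=> w _ /=; rewrite lee_fin (le_trans (fZ w))// (le_trans (ZZ3 w))//.
exact: ler_norm.
Qed.

Let XZ w : `|X w| <= Z w.
Proof.
rewrite /Z; have := sqr_ge0 (Y w); rewrite -(real_normK (num_real (X w))).
by have := sqr_ge0 (`|X w| - 1); nra.
Qed.
Let YZ w : `|Y w| <= Z w.
Proof.
rewrite /Z; have := sqr_ge0 (X w); rewrite -(real_normK (num_real (Y w))).
by have := sqr_ge0 (`|Y w| - 1); nra.
Qed.
Let iX : P.-integrable setT (EFin \o X). Proof. exact: dom. Qed.
Let iY : P.-integrable setT (EFin \o Y). Proof. exact: dom. Qed.
Let iX2 : P.-integrable setT (EFin \o (fun w => X w ^+ 2)).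
Proof.
apply: dom; first exact: measurable_funX.
by move=> w; rewrite ger0_norm ?sqr_ge0// /Z; have := sqr_ge0 (Y w); lra.
Qed.
Let iY2 : P.-integrable setT (EFin \o (fun w => Y w ^+ 2)).
Proof.
apply: dom; first exact: measurable_funX.
by move=> w; rewrite ger0_norm ?sqr_ge0// /Z; have := sqr_ge0 (X w); lra.
Qed.
Let iXY : P.-integrable setT (EFin \o (fun w => X w * Y w)).
Proof.
apply: dom; first exact: measurable_funM.
move=> w; rewrite normrM /Z -(real_normK (num_real (X w))) -(real_normK (num_real (Y w))).
by have := sqr_ge0 (`|X w| - `|Y w|); nra.
Qed.
Let m20 : 0 <= m2.
Proof. by rewrite -X2; apply: Rintegral_ge0 => w _; exact: sqr_ge0. Qed.

Let bm_shift (f : R -> R) (V : T -> R) (x g : R) : bm f -> measurable_fun setT V ->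
  bm (fun w => f (x + g * V w)).
Proof.
move=> bf mV; apply: bm_comp bf _; apply: measurable_funD => //.
exact: measurable_funM.
Qed.

(** The linear Taylor term has mean zero, so the average differs from [f x] by at most [C g^2 m2];
    the pointwise Taylor error contributes [C g^2 V^2]. *)
Lemma smooth_avg_diff (m M C : R) (f f1 : R -> R) (V : T -> R) (x g : R) : 0 <= C ->
  measurable_fun setT V -> P.-integrable setT (EFin \o V) ->
  P.-integrable setT (EFin \o (fun w => V w ^+ 2)) ->
  \int[P]_w V w = 0 -> \int[P]_w (V w ^+ 2) = m2 ->
  measurable_fun setT f -> (forall x, m <= f x <= M) ->
  (forall x k, `|f (x + k) - f x - f1 x * k| <= C * k ^+ 2) ->
  forall w, `|f (x + g * V w) - \int[P]_w f (x + g * V w) - f1 x * (g * V w)| <=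
    C * g ^+ 2 * (V w ^+ 2 + m2).
Proof.
move=> C0 mV iV iV2 V0 V2 mf fM f1P w.
have bf : bm (fun w => f (x + g * V w)) by apply: bm_shift => //; exact: bm_between fM.
set a := \int[P]_w _.
have ia := bm_int P bf.
have aE : a - f x = \int[P]_w (f (x + g * V w) + (- f x + (- (f1 x * g)) * V w)).
  rewrite RintD//; last first.
    by apply: integrableDR; [exact/bm_int/bm_cst|exact: integrableZR].
  rewrite RintD//; [|exact/bm_int/bm_cst|exact: integrableZR].
  by rewrite Rint_cst RintZ// V0 mulr0 addr0.
have aB : `|a - f x| <= C * g ^+ 2 * m2.
  rewrite aE (le_trans (le_normr_Rintegral _ _))//.
    apply: integrableDR => //.
    by apply: integrableDR; [exact/bm_int/bm_cst|exact: integrableZR].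
  rewrite -V2 -RintZ//; apply: Rint_le.
  - apply: integrable_norm; apply: integrableDR => //.
    by apply: integrableDR; [exact/bm_int/bm_cst|exact: integrableZR].
  - exact: integrableZR.
  - move=> w'; rewrite -mulrA -exprMn; apply: le_trans (f1P x (g * V w')).
    by rewrite le_eqVlt; apply/orP; left; apply/eqP; congr (`|_|); ring.
have fB : `|f (x + g * V w) - f x - f1 x * (g * V w)| <= C * g ^+ 2 * V w ^+ 2.
  by rewrite -mulrA -exprMn; exact: f1P.
have -> : f (x + g * V w) - a - f1 x * (g * V w) =
  (f (x + g * V w) - f x - f1 x * (g * V w)) - (a - f x) by ring.
by rewrite (le_trans (ler_normB _ _))// mulrDr lerD.
Qed.

(** [g] is the scale of the increments and [e] the additive error. The error is uniform over the
    class and over the base points, which is what lets the inequality be iterated on averaged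
    functions. *)
Definition step (s t m M C g e : R) := forall f h : R -> R,
  smooth m M C f -> smooth m M C h -> forall x y,
  \int[P]_w (f (x + g * X w) `^ s * h (y + g * Y w) `^ t) <=
  (\int[P]_w f (x + g * X w)) `^ s * (\int[P]_w h (y + g * Y w)) `^ t + e.

Lemma one_step (s t m M C g : R) : 0 <= s <= 1 -> 0 <= t <= 1 ->
  (forall k l, 0 <= s * (1 - s) * k ^+ 2 + t * (1 - t) * l ^+ 2 - 2 * s * t * rho * k * l) ->
  0 < m -> m <= M -> 0 <= C -> 0 <= g <= 1 ->
  step s t m M C g (M `^ s * M `^ t * (Dcst (C * (1 + m2) / m) (M / m)
    * \int[P]_w (Z w ^+ 3)) * g ^+ 3).
Proof.
move=> s01 t01 qpos m0 mM C0 g01 f h [f1 [[mf mf1] fM f1C f1P]] [h1 [[mh mh1] hM h1C h1P]] x y.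
have /andP[s0 s1] := s01; have /andP[t0 t1] := t01; have /andP[g0 g1] := g01.
(* [K] bounds the relative deviations of numbers in [[m, M]]. [c] bounds the relative slopes, at
   most [C / m], and absorbs the errors of [smooth_avg_diff] through [V^2 + m2 <= (1 + m2) Z]. *)
set c := C * (1 + m2) / m; set K := M / m.
have bf : bm (fun w => f (x + g * X w)) by apply: bm_shift => //; exact: bm_between fM.
have bh : bm (fun w => h (y + g * Y w)) by apply: bm_shift => //; exact: bm_between hM.
set a := \int[P]_w f _; set b := \int[P]_w h _.
have am : m <= a <= M.
  by apply/andP; split; [apply: Rint_lb|apply: Rint_ub] => // w; have /andP[] := fM (x + g * X w).
have bmm : m <= b <= M.
  by apply/andP; split; [apply: Rint_lb|apply: Rint_ub] => // w; have /andP[] := hM (y + g * Y w).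
have /andP[ma aM] := am; have /andP[mb bM] := bmm.
have a0 : 0 < a by exact: lt_le_trans ma.
have b0 : 0 < b by exact: lt_le_trans mb.
have c0 : 0 <= c by rewrite /c divr_ge0 ?mulr_ge0 ?addr_ge0// ltW.
have Cc k : `|k| <= C -> forall z, m <= z -> `|k / z| <= c.
  move=> kC z mz; have z0 : 0 < z by exact: lt_le_trans mz.
  rewrite normrM normfV (gtr0_norm z0) ler_pdivrMr// /c.
  rewrite mulrAC ler_pdivlMr//; apply: le_trans (_ : C * z <= _).
    by apply: ler_pM => //; exact: (ltW m0).
  by rewrite ler_wpM2r ?(ltW z0)// ler_peMr// lerDl.
have K1 : 1 <= K by rewrite /K ler_pdivlMr// mul1r.
have uK z A : m <= z <= M -> m <= A <= M -> `|(A - z) / z| <= K.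
  move=> /andP[mz zM] /andP[mA AM]; have z0 : 0 < z by exact: lt_le_trans mz.
  rewrite normrM normfV (gtr0_norm z0) ler_pdivrMr// /K.
  rewrite mulrAC ler_pdivlMr//; apply: le_trans (_ : M * m <= _); last first.
    by rewrite ler_wpM2l// (le_trans (ltW m0) mM).
  by rewrite (ler_wpM2r (ltW m0))// (norm_sub_le_ub m0) ?mz ?mA.
have eb z (V : T -> R) k A w : m <= z -> V w ^+ 2 <= Z w - 1 ->
    `|A - z - k * (g * V w)| <= C * g ^+ 2 * (V w ^+ 2 + m2) ->
    `|(A - z) / z - k / z * (g * V w)| <= c * g ^+ 2 * (1 + X w ^+ 2 + Y w ^+ 2).
  move=> mz VZ AzV; have z0 : 0 < z by exact: lt_le_trans mz.
  have -> : (A - z) / z - k / z * (g * V w) = (A - z - k * (g * V w)) / z.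
    by field; rewrite gt_eqF.
  rewrite normrM normfV (gtr0_norm z0) ler_pdivrMr// (le_trans AzV)//.
  have -> : c * g ^+ 2 * (1 + X w ^+ 2 + Y w ^+ 2) * z =
      C * g ^+ 2 * ((z / m) * ((1 + m2) * Z w)).
    by rewrite /c /Z; field; rewrite gt_eqF.
  rewrite ler_wpM2l ?mulr_ge0 ?sqr_ge0//; apply: le_trans (_ : (1 + m2) * Z w <= _).
    have : m2 <= m2 * Z w by rewrite ler_peMr.
    by lra.
  rewrite ler_peMl ?mulr_ge0//; [by rewrite addr_ge0|exact: le_trans (Z1 w)|].
  by rewrite ler_pdivlMr// mul1r.
pose k := f1 x / a; pose l := h1 y / b.
have pt w : f (x + g * X w) `^ s * h (y + g * Y w) `^ t <= a `^ s * b `^ t *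
    (1 + s * ((f (x + g * X w) - a) / a) + t * ((h (y + g * Y w) - b) / b)
     - g ^+ 2 * qform s t (k * X w) (l * Y w) / 2 + Dcst c K * g ^+ 3 * Z w ^+ 3).
  have fw := fM (x + g * X w); have hw := hM (y + g * Y w).
  apply: one_step_pointwise => //.
  - by case/andP: fw => + _; apply: le_trans; exact: ltW.
  - by case/andP: hw => + _; apply: le_trans; exact: ltW.
  - exact: uK.
  - exact: uK.
  - exact: Cc.
  - exact: Cc.
  - apply: eb => //; first by rewrite /Z; have := sqr_ge0 (Y w); lra.
    exact: (smooth_avg_diff (M := M) (m := m)).
  - apply: eb => //; first by rewrite /Z; have := sqr_ge0 (X w); lra.
    exact: (smooth_avg_diff (M := M) (m := m)).
pose B := a `^ s * b `^ t.
(* The pointwise bound regrouped into integrable pieces. The first three integrate to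
   [B (1 - s - t) + B s + B t = B], because [a] and [b] are the means. *)
pose rhs w := (B * (1 - s - t)) + ((B * s / a) * f (x + g * X w) +
  ((B * t / b) * h (y + g * Y w) + ((- (B * g ^+ 2 * s * (1 - s) * k ^+ 2 / 2)) * X w ^+ 2 +
   ((- (B * g ^+ 2 * t * (1 - t) * l ^+ 2 / 2)) * Y w ^+ 2 +
   ((B * g ^+ 2 * s * t * k * l) * (X w * Y w) + (B * Dcst c K * g ^+ 3) * Z w ^+ 3))))).
have if_ := bm_int P bf; have ih := bm_int P bh; have ic z := bm_int P (bm_cst z).
apply: le_trans (_ : \int[P]_w rhs w <= _).
  apply: Rint_le.
  - by apply: bm_int; apply: bmM; apply: bm_powR => // w;
      [have /andP[+ _] := fM (x + g * X w)|have /andP[+ _] := hM (y + g * Y w)];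
      apply: le_trans; exact: ltW.
  - by rewrite /rhs; do ?[apply: integrableDR|apply: integrableZR].
  - move=> w; apply: (le_trans (pt w)); rewrite le_eqVlt; apply/orP; left; apply/eqP.
    by rewrite /rhs /qform -/B; field; rewrite ?gt_eqF.
rewrite /rhs; do 6 (rewrite RintD; [|by do ?[apply: integrableDR|apply: integrableZR|apply: ic]..]).
rewrite !RintZ// Rint_cst X2 Y2 XY -/a -/b -/B.
have BM : B <= M `^ s * M `^ t.
  by rewrite /B ler_pM ?powR_ge0// ge0_ler_powR ?nnegrE ?(ltW a0) ?(ltW b0) ?(ltW (lt_le_trans m0 mM)).
have q0 := qpos k l.
have q1 : 0 <= B * g ^+ 2 * m2 / 2 *
    (s * (1 - s) * k ^+ 2 + t * (1 - t) * l ^+ 2 - 2 * s * t * rho * k * l).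
  by rewrite mulr_ge0// divr_ge0// !mulr_ge0 ?sqr_ge0 ?powR_ge0.
have Z30 : 0 <= \int[P]_w (Z w ^+ 3).
  by apply: Rintegral_ge0 => w _; rewrite exprn_ge0// (le_trans ler01 (Z1 w)).
have D0 : 0 <= Dcst c K.
  have K0 : 0 <= K by exact: le_trans ler01 K1.
  have c2 : 0 <= c ^+ 2 by exact: exprn_ge0.
  have c3 : 0 <= c ^+ 3 by exact: exprn_ge0.
  have LK := Lcst_ge0 K0.
  by apply: addr_ge0; apply: mulr_ge0 => //; exact: mulr_ge0.
have : B * (Dcst c K * \int[P]_w (Z w ^+ 3) * g ^+ 3) <=
    M `^ s * M `^ t * (Dcst c K * \int[P]_w (Z w ^+ 3) * g ^+ 3).
  by rewrite ler_wpM2r// !mulr_ge0// exprn_ge0.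
have -> : B * s / a * a = B * s by field; rewrite gt_eqF.
have -> : B * t / b * b = B * t by field; rewrite gt_eqF.
by lra.
Qed.

(** Averaging [f1] gives the derivative of the average, and the bounds pass through the integral
    with the same [m], [M] and [C]. The class is thus stable under the doubling. *)
Lemma smooth_avg (m M C g : R) (V : T -> R) (f : R -> R) :
  measurable_fun setT V -> smooth m M C f ->
  smooth m M C (fun x => \int[P]_w f (x + g * V w)).
Proof.
move=> mV [f1 [[mf mf1] fM f1C f1P]].
have mF : measurable_fun setT (fun z : R * T => z.1 + g * V z.2).
  apply: measurable_funD => //; apply: measurable_funM => //.
  exact: measurableT_comp.
have bf : bm f by exact: bm_between fM.
have bf1 : bm f1 by split => //; exists C.
have bs (h : R -> R) x : bm h -> bm (fun w => h (x + g * V w)) by move=> bh; exact: bm_shift.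
exists (fun x => \int[P]_w f1 (x + g * V w)); split.
- split; apply: bm_meas.
    by have := bm_Rint P (bm_comp bf mF).
  by have := bm_Rint P (bm_comp bf1 mF).
- by move=> x; apply/andP; split; [apply: Rint_lb|apply: Rint_ub] => [|w||w];
    rewrite ?(andP (fM _)).1 ?(andP (fM _)).2//; exact: bs.
- by move=> x; apply: Rint_normub => //; exact: bs.
- move=> x k.
  have -> : \int[P]_w f (x + k + g * V w) - \int[P]_w f (x + g * V w) -
      \int[P]_w f1 (x + g * V w) * k =
      \int[P]_w (f (x + k + g * V w) + ((-1) * f (x + g * V w) + (- k) * f1 (x + g * V w))).
    have iB h y : bm h -> P.-integrable setT (EFin \o (fun w => h (y + g * V w))).
      by move=> bh; apply: bm_int; exact: bs.
    rewrite RintD; [|exact: iB|by apply: integrableDR; apply: integrableZR; exact: iB].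
    rewrite RintD; [|by apply: integrableZR; exact: iB..].
    by rewrite !RintZ; [|exact: iB..]; ring.
  apply: Rint_normub.
    by apply: bmD; [exact: bs|apply: bmD; apply: bmZ; exact: bs].
  move=> w; apply: le_trans (f1P (x + g * V w) k).
  rewrite le_eqVlt; apply/orP; left; apply/eqP; congr (`|_|).
  by rewrite (addrAC x); ring.
Qed.

Hypothesis conv : forall F : R * R -> R, bm F ->
  \int[P]_w F (Num.sqrt 2 * X w, Num.sqrt 2 * Y w) =
  \int[P]_w \int[P]_w' F (X w + X w', Y w + Y w').

(** With [w] frozen, the inequality is used at the base points [x + g X w] and [y + g Y w]. What
    results is an instance of the same inequality for the averages [f'] and [h'], which belong to
    the same class. *)
Lemma step_double (s t m M C g e : R) : 0 <= s -> 0 <= t -> 0 <= m ->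
  step s t m M C g e -> step s t m M C (Num.sqrt 2 * g) (2 * e).
Proof.
move=> s0 t0 m0 st f h sf sh x y.
have [bf bh] := (smooth_bm sf, smooth_bm sh).
have f0 z : 0 <= f z.
  by case: sf => f1 [_ fM _ _]; have /andP[+ _] := fM z; exact: le_trans.
have h0 z : 0 <= h z.
  by case: sh => f1 [_ fM _ _]; have /andP[+ _] := fM z; exact: le_trans.
have maff (u v : R) : measurable_fun setT (fun z : R * R => u + g * z.1) /\
    measurable_fun setT (fun z : R * R => v + g * z.2).
  by split; apply: measurable_funD => //; apply: measurable_funM.
have [ma mb] := maff x y.
have bF : bm (fun z : R * R => f (x + g * z.1) `^ s * h (y + g * z.2) `^ t).
  by apply: bmM; apply: bm_powR => //; [apply: bm_comp bf _|apply: bm_comp bh _].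
pose f' z := \int[P]_w f (z + g * X w); pose h' z := \int[P]_w h (z + g * Y w).
have sf' : smooth m M C f' by exact: smooth_avg.
have sh' : smooth m M C h' by exact: smooth_avg.
have -> : \int[P]_w (f (x + Num.sqrt 2 * g * X w) `^ s * h (y + Num.sqrt 2 * g * Y w) `^ t) =
  \int[P]_w \int[P]_w' (f (x + g * X w + g * X w') `^ s * h (y + g * Y w + g * Y w') `^ t).
  transitivity (\int[P]_w (f (x + g * (Num.sqrt 2 * X w)) `^ s * h (y + g * (Num.sqrt 2 * Y w)) `^ t)).
    by apply: eq_Rintegral => w _; congr (f _ `^ s * h _ `^ t); ring.
  rewrite (conv bF)/=; apply: eq_Rintegral => w _; apply: eq_Rintegral => w' _.
  by congr (f _ `^ s * h _ `^ t); ring.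
have cf (k : R -> R) (V : T -> R) z : bm k -> (V = X \/ V = Y) ->
    \int[P]_w k (z + Num.sqrt 2 * g * V w) =
    \int[P]_w \int[P]_w' k (z + g * V w + g * V w').
  move=> bk VXY.
  have mz (U : R * R -> R) : measurable_fun setT U -> bm (fun u => k (z + g * U u)).
    by move=> mU; apply: bm_comp bk _; apply: measurable_funD => //; exact: measurable_funM.
  transitivity (\int[P]_w k (z + g * (Num.sqrt 2 * V w))).
    by apply: eq_Rintegral => w _; congr (k _); ring.
  transitivity (\int[P]_w \int[P]_w' k (z + g * (V w + V w'))); last first.
    by apply: eq_Rintegral => w _; apply: eq_Rintegral => w' _; congr (k _); ring.
  by case: VXY => ->; [exact: (conv (mz fst _))|exact: (conv (mz snd _))].
rewrite (cf f X)//; last by left.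
rewrite (cf h Y)//; last by right.
have bf' := smooth_bm sf'; have bh' := smooth_bm sh'.
have f'0 z : 0 <= f' z by apply: Rintegral_ge0.
have h'0 z : 0 <= h' z by apply: Rintegral_ge0.
apply: le_trans (_ : \int[P]_w (f' (x + g * X w) `^ s * h' (y + g * Y w) `^ t + e) <= _).
  apply: Rint_le.
  - apply: bm_int.
    have bG : bm (fun z : T * T => f (x + g * X z.1 + g * X z.2) `^ s *
        h (y + g * Y z.1 + g * Y z.2) `^ t).
      apply: bmM; apply: bm_powR => //; [apply: bm_comp bf _|apply: bm_comp bh _];
        do ?apply: measurable_funD => //; apply: measurable_funM => //;
        exact: measurableT_comp.
    exact: (bm_Rint P bG).
  - apply: bm_int; apply: bmD; last exact: bm_cst.
    by apply: bmM; apply: bm_powR => //; apply: bm_shift.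
  - by move=> w; exact: st.
rewrite RintD; last 2 first.
- by apply: bm_int; apply: bmM; apply: bm_powR => //; apply: bm_shift.
- exact/bm_int/bm_cst.
rewrite Rint_cst (_ : 2 * e = e + e); last by ring.
by rewrite addrA lerD2r; exact: st.
Qed.

(* [one_step] has an error of order [g ^ 3]; starting at [g = 2 ^ (- n / 2)], [n] doublings
   multiply it by [2 ^ n] only. *)
Lemma step_limit (s t m M C : R) : 0 <= s <= 1 -> 0 <= t <= 1 ->
  (forall k l, 0 <= s * (1 - s) * k ^+ 2 + t * (1 - t) * l ^+ 2 - 2 * s * t * rho * k * l) ->
  0 < m -> m <= M -> 0 <= C -> step s t m M C 1 0.
Proof.
move=> s01 t01 qpos m0 mM C0.
have [D D0 stD] : exists2 D, 0 <= D & forall g, 0 <= g <= 1 -> step s t m M C g (D * g ^+ 3).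
  exists (`|M `^ s * M `^ t * (Dcst (C * (1 + m2) / m) (M / m) * \int[P]_w (Z w ^+ 3))|) => //.
  move=> g g01 f h sf sh x y.
  apply: le_trans (one_step s01 t01 qpos m0 mM C0 g01 sf sh x y) _.
  rewrite lerD2l ler_wpM2r// ?exprn_ge0 ?(andP g01).1//; exact: ler_norm.
have stn n g e : step s t m M C g e -> step s t m M C (Num.sqrt 2 ^+ n * g) (2 ^+ n * e).
  elim: n => [|n IH] st; first by rewrite !expr0 !mul1r.
  rewrite !exprS -!mulrA; apply: step_double; rewrite ?(andP s01).1 ?(andP t01).1 ?ltW//.
  exact: IH.
(* As [2 q^2 = 1], one has [2^n (q^n)^3 = q^n]: after [n] doublings from scale [q^n] the scale is 1
   and the error tends to 0. *)
pose q : R := (Num.sqrt 2)^-1.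
have s20 : 0 < Num.sqrt 2 :> R by rewrite sqrtr_gt0.
have q0 : 0 < q by rewrite invr_gt0.
have q2 : 2 * q ^+ 2 = 1 by rewrite /q exprVn sqr_sqrtr// mulfV.
have q1 : q < 1 by rewrite -subr_gt0; nra.
have stq n : step s t m M C 1 (D * q ^+ n).
  have qn : 0 <= q ^+ n <= 1 by rewrite exprn_ge0 ?exprn_ile1 ?(ltW q0) ?(ltW q1).
  have := stn n _ _ (stD _ qn).
  rewrite -exprMn mulfV ?gt_eqF// expr1n.
  congr (step _ _ _ _ _ _ _); rewrite mulrCA; congr (_ * _).
  by rewrite -exprM mulnC exprM -exprMn exprSr mulrA q2 mul1r.
move=> f h sf sh x y; rewrite addr0.
set L := (X in X <= _); set B := (X in _ <= X).
apply/ler_addgt0Pr => e e0.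
have cq : D * q ^+ n @[n --> \oo] --> (0 : R).
  rewrite -[X in _ --> X](mulr0 D); apply: cvgMr; apply: cvg_expr.
  by rewrite gtr0_norm.
move/cvgrPdist_lt : cq => /(_ _ e0) [n _ /(_ n (leqnn _))].
rewrite sub0r normrN => Dq; apply: le_trans (stq n f h sf sh x y) _.
by rewrite lerD2l (le_trans (ler_norm _))// ltW.
Qed.

End one_step.

(** * The Ornstein-Uhlenbeck operator on the line *)

Section gauss_bm.
Context {R : realType}.
Local Notation gam := (@gauss R).
Implicit Types f g : R -> R.

Lemma Rint_fst {d1 d2} {T1 : measurableType d1} {T2 : measurableType d2}
    (P1 : probability T1 R) (P2 : probability T2 R) (f : T1 -> R) :
  measurable_fun setT f -> \int[(P1 \x P2)%E]_z f z.1 = \int[P1]_x f x.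
Proof.
move=> mf; congr fine.
by apply: (integral_prod_fst P1 P2 (f := EFin \o f)); exact/measurable_EFinP.
Qed.

Lemma Rint_conv (a b : R) f : a ^+ 2 + b ^+ 2 = 1 -> measurable_fun setT f ->
  \int[(gam \x gam)%E]_z f (a * z.1 + b * z.2) = \int[gam]_x f x.
Proof.
move=> ab mf; congr fine.
by apply: (gauss_conv ab (f := EFin \o f)); exact/measurable_EFinP.
Qed.

Lemma Rint_rot (a b : R) (F : R * R -> R) : a ^+ 2 + b ^+ 2 = 1 ->
  measurable_fun setT F ->
  \int[(gam \x gam)%E]_z F (rot a b z) = \int[(gam \x gam)%E]_z F z.
Proof.
move=> ab mF; congr fine.
by apply: (gauss_rot ab (F := EFin \o F)); exact/measurable_EFinP.
Qed.

Lemma measurable_aff (a b : R) : measurable_fun setT (fun z : R * R => a * z.1 + b * z.2).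
Proof. exact: measurable_lin. Qed.

(** [p x + q y] is distributed as [n x]. The case [n = 0] is separate because the proof normalizes
    by [n]. *)
Lemma Rint_conv_shift (p q n w : R) f : p ^+ 2 + q ^+ 2 = n ^+ 2 -> bm f ->
  \int[gam]_x \int[gam]_y f (w + (p * x + q * y)) = \int[gam]_x f (w + n * x).
Proof.
move=> pqn bf.
have mw (k : R) : measurable_fun setT (fun x : R => w + k * x).
  by apply: measurable_funD => //; exact: measurable_funM.
have [n0|n0] := eqVneq n 0.
  have /eqP : p ^+ 2 + q ^+ 2 = 0 by rewrite pqn n0 expr0n.
  rewrite paddr_eq0 ?sqr_ge0// !sqrf_eq0 => /andP[/eqP-> /eqP->].
  rewrite n0; under eq_Rintegral do under eq_Rintegral do rewrite !mul0r addr0.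
  under [in RHS]eq_Rintegral do rewrite mul0r.
  by rewrite addr0 !Rint_cst.
have ab : (p / n) ^+ 2 + (q / n) ^+ 2 = 1.
  by rewrite !expr_div_n -mulrDl pqn divff// sqrf_eq0.
have bfn : bm (fun x => f (w + n * x)) by exact: bm_comp bf (mw n).
rewrite -(Rint_conv ab (bm_meas bfn)).
rewrite (Rint_prod gam gam (bm_comp bfn (measurable_aff _ _))).
apply: eq_Rintegral => x _; apply: eq_Rintegral => y _ /=; congr f; congr (_ + _).
by field.
Qed.

(* Ornstein-Uhlenbeck operator, in Mehler form *)
Definition ou (c : R) f (x : R) := \int[gam]_y f (c * x + Num.sqrt (1 - c ^+ 2) * y).

Lemma ouE c f x : ou c f x = \int[gam]_y f (c * x + Num.sqrt (1 - c ^+ 2) * y).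
Proof. by []. Qed.

Lemma sqr_cosin (c : R) : 0 <= c <= 1 -> c ^+ 2 + Num.sqrt (1 - c ^+ 2) ^+ 2 = 1.
Proof.
move=> /andP[c0 c1]; rewrite sqr_sqrtr; first by rewrite addrC subrK.
by rewrite subr_ge0 exprn_ile1.
Qed.

Lemma bm_ou2 c f : bm f -> bm (fun z : R * R => f (c * z.1 + Num.sqrt (1 - c ^+ 2) * z.2)).
Proof. by move=> bf; apply: bm_comp bf _; exact: measurable_aff. Qed.

Lemma bm_ou c f : bm f -> bm (ou c f).
Proof. by move=> bf; have := bm_Rint gam (bm_ou2 c bf). Qed.

Lemma bm_ou1 (c : R) f (x : R) : bm f -> bm (fun y : R => f (c * x + Num.sqrt (1 - c ^+ 2) * y)).
Proof. by move=> bf; have := bm_slice2 x (bm_ou2 c bf). Qed.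

Lemma ou_ge0 c f x : (forall x, 0 <= f x) -> 0 <= ou c f x.
Proof. by move=> f0; exact: Rintegral_ge0. Qed.

Lemma ou_le c f g : bm f -> bm g -> (forall x, f x <= g x) -> forall x, ou c f x <= ou c g x.
Proof. by move=> bf bg fg x; apply: Rint_le => //; apply: bm_int; exact: bm_ou1. Qed.

Lemma ou_between c f m M : bm f -> (forall x, m <= f x <= M) -> forall x, m <= ou c f x <= M.
Proof.
move=> bf fM x; apply/andP; split.
  by apply: Rint_lb; [exact: bm_ou1|move=> y; case/andP: (fM (c * x + Num.sqrt (1 - c ^+ 2) * y))].
by apply: Rint_ub; [exact: bm_ou1|move=> y; case/andP: (fM (c * x + Num.sqrt (1 - c ^+ 2) * y))].
Qed.

Lemma Rint_ou c f : 0 <= c <= 1 -> bm f -> \int[gam]_x ou c f x = \int[gam]_x f x.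
Proof.
move=> c01 bf; rewrite -(Rint_conv (sqr_cosin c01) (bm_meas bf)).
by rewrite (Rint_prod gam gam (bm_ou2 c bf)).
Qed.

Lemma Rint_ou_prod c f g : bm f -> bm g ->
  \int[gam]_x (f x * ou c g x) =
  \int[(gam \x gam)%E]_z (f z.1 * g (c * z.1 + Num.sqrt (1 - c ^+ 2) * z.2)).
Proof.
move=> bf bg; rewrite (Rint_prod gam gam (bmM (bm_comp bf measurable_fst) (bm_ou2 c bg))).
apply: eq_Rintegral => x _ /=; rewrite RintZ//.
by apply: bm_int; exact: bm_ou1.
Qed.

(** With [c' = Num.sqrt (1 - c ^+ 2)], the pair formed by [x] and [c x + c' y] is exchangeable: the
    reflection [rot c c'] swaps its entries. *)
Lemma ou_sym c f g : 0 <= c <= 1 -> bm f -> bm g ->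
  \int[gam]_x (f x * ou c g x) = \int[gam]_x (ou c f x * g x).
Proof.
move=> c01 bf bg; rewrite Rint_ou_prod//.
under [in RHS]eq_Rintegral do rewrite mulrC.
rewrite Rint_ou_prod//.
rewrite -[RHS](Rint_rot (sqr_cosin c01)); last first.
  apply: bm_meas; apply: bmM; last exact: bm_ou2.
  exact: (bm_comp bg measurable_fst).
apply: eq_Rintegral => -[x y] _ /=; rewrite mulrC; congr (_ * f _).
rewrite -[LHS]mul1r -{1}(sqr_cosin c01); ring.
Qed.

(** Semigroup law: the independent noises [b a' y] and [b' z] merge into a single one of variance
    [1 - (a b)^2]. *)
Lemma ou_comp a b f : 0 <= a <= 1 -> 0 <= b <= 1 -> bm f ->
  forall x, ou a (ou b f) x = ou (a * b) f x.
Proof.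
move=> a01 b01 bf x; rewrite /ou.
set a' := Num.sqrt (1 - a ^+ 2); set b' := Num.sqrt (1 - b ^+ 2).
have /andP[a0 a1] := a01; have /andP[b0 b1] := b01.
have abn : (b * a') ^+ 2 + b' ^+ 2 = Num.sqrt (1 - (a * b) ^+ 2) ^+ 2.
  rewrite exprMn !sqr_sqrtr ?subr_ge0 ?exprn_ile1 ?mulr_ge0 ?mulr_ile1//.
  by ring.
apply: eq_trans (Rint_conv_shift (a * b * x) abn bf).
apply: eq_Rintegral => y _; apply: eq_Rintegral => z _; congr f; ring.
Qed.

Lemma gauss_int_id : gam.-integrable setT (EFin \o (fun x => x)).
Proof.
apply: le_integrable (gauss_normX 1) => //; first exact/measurable_EFinP.
by move=> x _ /=; rewrite lee_fin normr_id.
Qed.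

Lemma gauss_mean0 : \int[gam]_x x = 0.
Proof.
have E : \int[gam]_x x = - \int[gam]_x x.
  rewrite -[RHS]mulN1r -RintZ; last exact: gauss_int_id.
  rewrite /Rintegral -(gauss_opp (f := EFin))//.
  by congr fine; apply: eq_integral => x _; rewrite mulN1r.
by move/eqP: E; rewrite -addr_eq0 -mulr2n mulrn_eq0/= => /eqP.
Qed.

(** * Two standard Gaussian variables with correlation [rho] *)

Section correlated.
Variable rho : R.
Hypothesis rho01 : 0 <= rho <= 1.
Let X (z : R * R) := z.1.
Let Y (z : R * R) := rho * z.1 + Num.sqrt (1 - rho ^+ 2) * z.2.
Let P := (gam \x gam)%E.

Let mX : measurable_fun setT X. Proof. exact: measurable_fst. Qed.
Let mY : measurable_fun setT Y. Proof. exact: measurable_aff. Qed.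

Let iX f : measurable_fun setT f -> gam.-integrable setT (EFin \o f) ->
  P.-integrable setT (EFin \o (fun z => f (X z))).
Proof.
move=> mf /integrableP[_ fi]; apply/integrableP; split.
  by apply/measurable_EFinP; exact: (measurableT_comp mf mX).
rewrite (integral_prod_fst gam gam (f := fun x => `|(f x)%:E|%E))//.
by apply: measurableT_comp => //; exact/measurable_EFinP.
Qed.

Let iX2 f : measurable_fun setT f -> gam.-integrable setT (EFin \o f) ->
  P.-integrable setT (EFin \o (fun z => f z.2)).
Proof.
move=> mf /integrableP[_ fi]; apply/integrableP; split.
  by apply/measurable_EFinP; exact: (measurableT_comp mf measurable_snd).
rewrite (integral_prod_snd gam gam (f := fun x => `|(f x)%:E|%E))//.
by apply: measurableT_comp => //; exact/measurable_EFinP.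
Qed.

Let iY f : measurable_fun setT f -> gam.-integrable setT (EFin \o f) ->
  P.-integrable setT (EFin \o (fun z => f (Y z))).
Proof.
move=> mf /integrableP[_ fi]; apply/integrableP; split.
  by apply/measurable_EFinP; exact: (measurableT_comp mf mY).
rewrite (gauss_conv (sqr_cosin rho01) (f := fun x => `|(f x)%:E|%E))//.
by apply: measurableT_comp => //; exact/measurable_EFinP.
Qed.

Let mexp k : measurable_fun setT (fun x : R => `|x| ^+ k).
Proof. exact: measurable_funX. Qed.

(** Convexity of the cube, [(1 + u + v)^3 <= 9 (1 + u^3 + v^3)] for nonnegative [u] and [v], reduces
    this to sixth moments. *)
Let iZ : P.-integrable setT (EFin \o (fun z => (1 + X z ^+ 2 + Y z ^+ 2) ^+ 3)).
Proof.
have i1 : P.-integrable setT (EFin \o (fun=> 9 : R)).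
  by apply: bm_int; exact: bm_cst.
have i2 := integrableZR 9 (iX (mexp 6) (gauss_normX 6)).
have i3 := integrableZR 9 (iY (mexp 6) (gauss_normX 6)).
apply: le_integrable (integrableDR i1 (integrableDR i2 i3)) => //.
  apply/measurable_EFinP; apply: measurable_funX; apply: measurable_funD.
    by apply: measurable_funD => //; exact: measurable_funX.
  exact: measurable_funX.
move=> z _ /=; rewrite lee_fin.
have x0 := sqr_ge0 (X z); have y0 := sqr_ge0 (Y z).
rewrite ger0_norm; last by rewrite exprn_ge0//; lra.
rewrite (le_trans _ (ler_norm _))//.
have -> : `|X z| ^+ 6 = (X z ^+ 2) ^+ 3 by rewrite -(real_normK (num_real (X z))) -exprM.
have -> : `|Y z| ^+ 6 = (Y z ^+ 2) ^+ 3 by rewrite -(real_normK (num_real (Y z))) -exprM.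
move: (X z ^+ 2) (Y z ^+ 2) x0 y0 => a b a0 b0.
have h (u v : R) : 0 <= u -> 0 <= v -> u ^+ 2 * v + u * v ^+ 2 <= u ^+ 3 + v ^+ 3.
  move=> u0 v0; have : 0 <= (u + v) * (u - v) ^+ 2 by rewrite mulr_ge0 ?addr_ge0 ?sqr_ge0.
  by lra.
have ab := h _ _ a0 b0; have a1 := h _ _ a0 ler01; have b1 := h _ _ b0 ler01.
have amgm : 3 * (a * b) <= 1 + a ^+ 3 + b ^+ 3.
  have : 0 <= (1 + a + b) * ((1 - a) ^+ 2 + (a - b) ^+ 2 + (1 - b) ^+ 2).
    by rewrite mulr_ge0 ?addr_ge0 ?sqr_ge0.
  by lra.
lra.
Qed.

Let X0 : \int[P]_z X z = 0.
Proof.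
have /= -> := Rint_fst gam gam (f := fun x : R => x) (@measurable_id _ R setT).
exact: gauss_mean0.
Qed.

Let Y0 : \int[P]_z Y z = 0.
Proof.
have /= -> := Rint_conv (sqr_cosin rho01) (f := fun x : R => x) (@measurable_id _ R setT).
exact: gauss_mean0.
Qed.

Let msq : measurable_fun setT (fun x : R => x ^+ 2). Proof. exact: measurable_funX. Qed.

Let isq : gam.-integrable setT (EFin \o (fun x => x ^+ 2)).
Proof.
apply: le_integrable (gauss_normX 2) => //; first exact/measurable_EFinP.
by move=> x _ /=; rewrite lee_fin !normrX normr_id.
Qed.

Let X2 : \int[P]_z (X z ^+ 2) = \int[gam]_x (x ^+ 2).
Proof. by rewrite (Rint_fst gam gam (f := fun x => x ^+ 2)). Qed.

Let Y2 : \int[P]_z (Y z ^+ 2) = \int[gam]_x (x ^+ 2).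
Proof. by rewrite (Rint_conv (sqr_cosin rho01) (f := fun x => x ^+ 2)). Qed.

Let i12 : P.-integrable setT (EFin \o (fun z : R * R => z.1 * z.2)).
Proof.
apply: le_integrable (integrableDR (iX msq isq) (iX2 msq isq)) => //.
  by apply/measurable_EFinP; exact: measurable_funM.
move=> z _ /=; rewrite lee_fin (le_trans _ (ler_norm _))// normrM /X.
rewrite -(real_normK (num_real z.1)) -(real_normK (num_real z.2)).
have := sqr_ge0 (`|z.1| - `|z.2|); have := sqr_ge0 (`|z.1| + `|z.2|); nra.
Qed.

Let I12 : \int[P]_z (z.1 * z.2) = 0.
Proof.
rewrite /Rintegral -integral12_prod_meas1//.
rewrite (eq_integral (cst 0%E)) ?integral0// => x _ /=; rewrite /fubini_F/=.
transitivity ((\int[gam]_y (x * y))%:E).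
  rewrite fineK//; apply: integrable_fin_num => //.
  exact: (integrableZR x gauss_int_id).
by rewrite RintZ ?gauss_int_id// gauss_mean0 mulr0.
Qed.

Let XY : \int[P]_z (X z * Y z) = rho * \int[gam]_x (x ^+ 2).
Proof.
transitivity (\int[P]_z (rho * (X z ^+ 2) + Num.sqrt (1 - rho ^+ 2) * (z.1 * z.2))).
  by apply: eq_Rintegral => z _; rewrite /Y /X; ring.
have iX2' := iX msq isq.
rewrite RintD; [|exact: integrableZR..].
by rewrite !RintZ// I12 mulr0 addr0 X2.
Qed.

Let sqrt2_conv f : bm f -> \int[gam]_x f (Num.sqrt 2 * x) = \int[gam]_x \int[gam]_y f (x + y).
Proof.
move=> bf; have := @Rint_conv_shift 1 1 (Num.sqrt 2) 0 f.
rewrite expr1n sqr_sqrtr// => /(_ erefl bf) E.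
transitivity (\int[gam]_x f (0 + Num.sqrt 2 * x)).
  by apply: eq_Rintegral => x _; rewrite add0r.
by rewrite -E; apply: eq_Rintegral => x _; apply: eq_Rintegral => y _; rewrite add0r !mul1r.
Qed.

(** In the independent coordinates [F (X, Y)] becomes [G]. Each coordinate is split by [sqrt2_conv],
    and Fubini regroups the four variables into two independent pairs. *)
Let conv (F : R * R -> R) : bm F ->
  \int[P]_z F (Num.sqrt 2 * X z, Num.sqrt 2 * Y z) =
  \int[P]_z \int[P]_z' F (X z + X z', Y z + Y z').
Proof.
move=> bF; set r' := Num.sqrt (1 - rho ^+ 2).
pose G (z : R * R) := F (z.1, rho * z.1 + r' * z.2).
have bG : bm G.
  by apply: bm_comp bF _; apply: measurable_fun_pair => //; exact: measurable_aff.
transitivity (\int[P]_z G (Num.sqrt 2 * z.1, Num.sqrt 2 * z.2)).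
  by apply: eq_Rintegral => z _; rewrite /G /X /Y /=; congr (F (_, _)); rewrite -/r'; ring.
have bG2 : bm (fun z : R * R => G (Num.sqrt 2 * z.1, Num.sqrt 2 * z.2)).
  by apply: bm_comp bG _; apply: measurable_fun_pair; apply: measurable_funM.
rewrite (Rint_prod gam gam bG2)/=.
have bGl u : bm (fun y => G (u, y)) by exact: bm_slice2.
transitivity (\int[gam]_u \int[gam]_v \int[gam]_v' G (Num.sqrt 2 * u, v + v')).
  by apply: eq_Rintegral => u _; exact: (sqrt2_conv (bGl (Num.sqrt 2 * u))).
have b3 : bm (fun z : (R * (R * R)) => G (z.1, z.2.1 + z.2.2)).
  apply: bm_comp bG _; apply: measurable_fun_pair => //; apply: measurable_funD.
    by apply: measurableT_comp => //.
  by apply: measurableT_comp => //.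
pose H u := \int[(gam \x gam)%E]_z G (u, z.1 + z.2).
have bH : bm H by have := bm_Rint (gam \x gam)%E b3.
have HE u : H u = \int[gam]_v \int[gam]_v' G (u, v + v').
  by rewrite /H (Rint_prod gam gam (bm_slice2 u b3)).
transitivity (\int[gam]_u H (Num.sqrt 2 * u)).
  by apply: eq_Rintegral => u _; rewrite HE.
rewrite sqrt2_conv//.
have b4 : bm (fun z : (R * R) * (R * R) => G (z.1.1 + z.2.1, z.1.2 + z.2.2)).
  by apply: bm_comp bG _; apply: measurable_fun_pair; apply: measurable_funD;
    exact: measurableT_comp.
transitivity (\int[P]_z \int[P]_z' G (z.1 + z'.1, z.2 + z'.2)); last first.
  apply: eq_Rintegral => z _; apply: eq_Rintegral => z' _; rewrite /G /X /Y /=.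
  by congr (F (_, _)); rewrite -/r'; ring.
have b5 := bm_Rint P b4.
rewrite (Rint_prod gam gam b5)/=; apply: eq_Rintegral => u _.
transitivity (\int[gam]_v \int[gam]_u' \int[gam]_v' G (u + u', v + v')); last first.
  apply: eq_Rintegral => v _.
  by rewrite (Rint_prod gam gam (bm_slice2 (u, v) b4)).
have b6 : bm (fun z : (R * R) * R => G (u + z.1.2, z.1.1 + z.2)).
  by apply: bm_comp bG _; apply: measurable_fun_pair; apply: measurable_funD => //;
    exact: measurableT_comp.
have b7 := bm_Rint gam b6.
rewrite (Rint_swap gam gam b7)/=.
by apply: eq_Rintegral => u' _; rewrite HE.
Qed.

Lemma gauss_two_point_limit (s t m M C : R) f h : 0 <= s <= 1 -> 0 <= t <= 1 ->
  (forall k l, 0 <= s * (1 - s) * k ^+ 2 + t * (1 - t) * l ^+ 2 - 2 * s * t * rho * k * l) ->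
  0 < m -> m <= M -> 0 <= C -> smooth m M C f -> smooth m M C h ->
  \int[gam]_x (f x `^ s * ou rho (fun x => h x `^ t) x) <=
  (\int[gam]_x f x) `^ s * (\int[gam]_x h x) `^ t.
Proof.
move=> s01 t01 qpos m0 mM C0 sf sh.
have := step_limit mX mY iZ X0 Y0 X2 Y2 XY conv s01 t01 qpos m0 mM C0 sf sh 0 0.
have bf := smooth_bm sf; have bh := smooth_bm sh.
have f0 z : 0 <= f z.
  by case: sf => f1 [_ fM _ _]; have /andP[+ _] := fM z; apply: le_trans; exact: ltW.
have h0 z : 0 <= h z.
  by case: sh => f1 [_ fM _ _]; have /andP[+ _] := fM z; apply: le_trans; exact: ltW.
rewrite addr0 Rint_ou_prod; last 2 first.
- by apply: bm_powR => //; case/andP: s01.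
- by apply: bm_powR => //; case/andP: t01.
rewrite -(Rint_fst gam gam (bm_meas bf)) -(Rint_conv (sqr_cosin rho01) (bm_meas bh)).
under eq_Rintegral do rewrite !add0r !mul1r.
under [X in _ <= X `^ _ * _ -> _]eq_Rintegral do rewrite !add0r !mul1r.
by under [X in _ <= _ * X `^ _ -> _]eq_Rintegral do rewrite !add0r !mul1r.
Qed.
End correlated.
End gauss_bm.

(** * Hypercontractivity in dimension one *)

Section hypercontractivity1.
Context {R : realType}.
Local Notation gam := (@gauss R).
Implicit Types f g F G : R -> R.
Local Opaque ou.

Lemma expR_taylor1_abs (w : R) : `|expR w - 1 - w| <= w ^+ 2 * expR `|w|.
Proof.
have h := expR_ge1Dx w; rewrite ger0_norm; last by lra.
have [w0|w0] := leP 0 w; first by rewrite ger0_norm//; exact: expR_taylor1.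
have := @expRN_taylor2 _ (- w); rewrite opprK sqrrN oppr_ge0 (ltW w0) => /(_ isT) h1.
apply: le_trans (_ : w ^+ 2 <= _).
  have := sqr_ge0 w; lra.
by rewrite ler_peMr ?sqr_ge0// -expR0 ler_expR.
Qed.

Lemma sqr_le_expR (y : R) : 0 <= y -> y ^+ 2 <= 2 * expR y.
Proof.
move=> y0; have := expR_ge1Dxn 1 y0.
by rewrite -[2`!%:R]/(2%:R : R); lra.
Qed.

Lemma mollifier_pointwise (a z : R) : `|a| <= 1 ->
  `|expR (a * z - a ^+ 2 / 2) - 1 - a * z| <= a ^+ 2 * (2^-1 + 2 * expR 1 * expR (2 * `|z|)).
Proof.
move=> a1; set w := a * z - a ^+ 2 / 2.
have a2 : a ^+ 2 = `|a| ^+ 2 by rewrite real_normK ?num_real.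
have wub : `|w| <= `|a| * (`|z| + 2^-1).
  rewrite (le_trans (ler_normB _ _))// normrM mulrDr lerD2l.
  rewrite ger0_norm ?divr_ge0 ?sqr_ge0// a2 ler_wpM2r ?invr_ge0//.
  by rewrite expr2 ler_piMl.
have zp : 0 <= `|z| + 2^-1 by rewrite addr_ge0// invr_ge0.
have wub1 : `|w| <= `|z| + 2^-1 by rewrite (le_trans wub)// ler_piMl.
have -> : expR w - 1 - a * z = (expR w - 1 - w) - a ^+ 2 / 2 by rewrite /w; ring.
rewrite (le_trans (ler_normB _ _))// mulrDr addrC lerD//.
  by rewrite ger0_norm// divr_ge0// sqr_ge0.
apply: le_trans (expR_taylor1_abs w) _.
apply: le_trans (_ : (`|a| * (`|z| + 2^-1)) ^+ 2 * expR (`|z| + 2^-1) <= _).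
  apply: ler_pM; rewrite ?sqr_ge0 ?expR_ge0 ?ler_expR//.
  by rewrite -(real_normK (num_real w)) lerXn2r ?nnegrE// mulr_ge0.
rewrite exprMn -a2 -[leLHS]mulrA ler_wpM2l ?sqr_ge0//.
(* [y^2 <= 2 expR y] at [y = |z| + 1/2] turns the polynomial factor into an exponential, whence the
   factor [expR 1 * expR (2 |z|)]. *)
apply: le_trans (_ : 2 * expR (`|z| + 2^-1) * expR (`|z| + 2^-1) <= _).
  by rewrite ler_wpM2r ?expR_ge0//; exact: sqr_le_expR.
rewrite -!mulrA -!expRD ler_wpM2l// ler_expR; lra.
Qed.

Lemma measurable_gexp (a : R) :
  measurable_fun setT (fun z : R => expR (a * z - a ^+ 2 / 2)).
Proof. by apply: measurableT_comp => //; exact: measurable_affine. Qed.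

Lemma gexp_int (a : R) :
  gam.-integrable setT (EFin \o (fun z => expR (a * z - a ^+ 2 / 2))).
Proof.
apply: le_integrable (gauss_expabs `|a|) => //.
  by apply/measurable_EFinP; exact: measurable_gexp.
move=> z _ /=; rewrite lee_fin (ger0_norm (expR_ge0 _)) (ger0_norm (expR_ge0 _)) ler_expR.
rewrite (le_trans (_ : _ <= a * z))//; first by rewrite gerBl divr_ge0// sqr_ge0.
by rewrite -normrM ler_norm.
Qed.

Lemma gauss_shift_bm (a : R) f : bm f -> (forall x, 0 <= f x) ->
  \int[gam]_z f (z + a) = \int[gam]_z (f z * expR (a * z - a ^+ 2 / 2)).
Proof.
move=> bf f0; rewrite /Rintegral (gauss_shift a (f := EFin \o f))//.
exact/measurable_EFinP/bm_meas.
Qed.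

Lemma bmM_int f g : bm f -> measurable_fun setT g ->
  gam.-integrable setT (EFin \o g) ->
  gam.-integrable setT (EFin \o (fun x => f x * g x)).
Proof.
move=> [mf [M fM]] mg ig; apply: le_integrable (integrableZR M ig) => //.
  by apply/measurable_EFinP; exact: measurable_funM.
move=> x _ /=; rewrite lee_fin !normrM ler_wpM2r//.
exact: le_trans (fM x) (ler_norm M).
Qed.

Lemma gauss_int_norm : gam.-integrable setT (EFin \o (fun z => `|z|)).
Proof. by have := integrable_norm gauss_int_id. Qed.

(** The Cameron-Martin density is [1 + a z] up to [O(a^2)] in mean. For small [a] this is Taylor's
    formula. For [|a| > 1] the triangle inequality suffices, since the density has mass 1 and
    [|a| <= a^2]. *)
Lemma mollifier_kernel : exists2 B : R, 0 <= B & forall a,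
  \int[gam]_z `|expR (a * z - a ^+ 2 / 2) - 1 - a * z| <= B * a ^+ 2.
Proof.
pose E1 := \int[gam]_z `|z|.
pose E2 := \int[gam]_z (expR (2 * `|z|)).
have E10 : 0 <= E1 by apply: Rintegral_ge0.
have E20 : 0 <= E2 by apply: Rintegral_ge0 => z _; exact: expR_ge0.
have ic (c : R) : gam.-integrable setT (EFin \o (fun=> c)).
  by apply: bm_int; exact: bm_cst.
have ik a : gam.-integrable setT (EFin \o (fun z => expR (a * z - a ^+ 2 / 2) + (- 1 + (- a) * z))).
  apply: integrableDR; first exact: gexp_int.
  by apply: integrableDR => //; apply: integrableZR; exact: gauss_int_id.
have kE a z : expR (a * z - a ^+ 2 / 2) - 1 - a * z =
    expR (a * z - a ^+ 2 / 2) + (- 1 + (- a) * z) by ring.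
(* [2 + E1] serves the case [|a| > 1], the remaining terms the case [|a| <= 1]. *)
exists (2 + E1 + 2^-1 + 2 * expR 1 * E2).
  by rewrite !addr_ge0 ?mulr_ge0 ?expR_ge0 ?invr_ge0.
move=> a; have X0 : 0 <= 2 * expR 1 * E2 by rewrite !mulr_ge0 ?expR_ge0.
have a20 := sqr_ge0 a.
under eq_Rintegral do rewrite kE.
have [a1|a1] := leP `|a| 1.
  apply: le_trans (_ : (2^-1 + 2 * expR 1 * E2) * a ^+ 2 <= _); last first.
    by rewrite ler_wpM2r//; lra.
  rewrite [leRHS]mulrC.
  apply: le_trans (_ : \int[gam]_z (a ^+ 2 * (2^-1 + 2 * expR 1 * expR (2 * `|z|))) <= _).
    apply: Rint_le.
    - exact: integrable_norm (ik a).
    - by apply: integrableZR; apply: integrableDR => //; apply: integrableZR; exact: gauss_expabs.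
    - by move=> z; rewrite -kE; exact: mollifier_pointwise.
  rewrite RintZ; last first.
    by apply: integrableDR => //; apply: integrableZR; exact: gauss_expabs.
  rewrite RintD//; last by apply: integrableZR; exact: gauss_expabs.
  by rewrite Rint_cst RintZ//; exact: gauss_expabs.
have a2 : `|a| <= a ^+ 2 by rewrite -(real_normK (num_real a)) expr2 ler_peMl// ltW.
apply: le_trans (_ : \int[gam]_z (expR (a * z - a ^+ 2 / 2) + (1 + `|a| * `|z|)) <= _).
  apply: Rint_le.
  - exact: integrable_norm (ik a).
  - apply: integrableDR; first exact: gexp_int.
    by apply: integrableDR => //; apply: integrableZR; exact: gauss_int_norm.
  - move=> z; rewrite (le_trans (ler_normD _ _))// ger0_norm ?expR_ge0// lerD2l.
    by rewrite (le_trans (ler_normD _ _))// normrN1 lerD2l normrM normrN.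
rewrite RintD; [|exact: gexp_int|apply: integrableDR => //; apply: integrableZR; exact: gauss_int_norm].
rewrite RintD//; last by apply: integrableZR; exact: gauss_int_norm.
rewrite Rint_cst RintZ; last exact: gauss_int_norm.
have -> : \int[gam]_z expR (a * z - a ^+ 2 / 2) = 1.
  have := gauss_shift_bm a (bm_cst 1) (fun=> ler01).
  rewrite Rint_cst => E; rewrite [RHS]E.
  by apply: eq_Rintegral => z _; rewrite mul1r.
have : `|a| * E1 <= a ^+ 2 * E1 by rewrite ler_wpM2r.
have : 1 <= a ^+ 2 by lra.
have : 0 <= (2^-1 + 2 * expR 1 * E2) * a ^+ 2 by rewrite mulr_ge0// addr_ge0// invr_ge0.
rewrite -/E1; lra.
Qed.

(** Moving [x] by [k] shifts the Gaussian variable by [q k] with [q = c / c'], and Cameron-Martin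
    transfers the shift to a density. So [F] may be merely measurable, and [C] depends only on [c]
    and on the bounds; [c < 1] makes [c'] positive. *)
Lemma ou_smooth (c m M : R) : 0 <= c < 1 -> 0 <= m -> 0 <= M ->
  exists2 C, 0 <= C & forall F, measurable_fun setT F ->
    (forall x, m <= F x <= M) -> smooth m M C (ou c F).
Proof.
move=> /andP[c0 c1] m0 M0; have [B B0 BP] := mollifier_kernel.
set c' := Num.sqrt (1 - c ^+ 2).
have c'0 : 0 < c' by rewrite sqrtr_gt0 subr_gt0 exprn_ilt1.
pose E1 := \int[gam]_z `|z|.
have E10 : 0 <= E1 by apply: Rintegral_ge0.
pose q := c / c'.
have q0 : 0 <= q by rewrite divr_ge0// ltW.
(* The first summand bounds the second order remainder, the second one the derivative. *)
exists (M * B * q ^+ 2 + M * q * E1).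
  exact: addr_ge0 (mulr_ge0 (mulr_ge0 M0 B0) (sqr_ge0 q)) (mulr_ge0 (mulr_ge0 M0 q0) E10).
move=> F mF FM; have bF := bm_between mF FM.
have F0 x : 0 <= F x by case/andP: (FM x) => + _; exact: le_trans.
have bs x : bm (fun z => F (c * x + c' * z)) by exact: bm_ou1.
have iFz x : gam.-integrable setT (EFin \o (fun z => F (c * x + c' * z) * z)).
  by apply: bmM_int => //; exact: gauss_int_id.
(* The derivative at [k = 0] of the Cameron-Martin density with shift [q k] is [q z]. *)
exists (fun x => q * \int[gam]_z (F (c * x + c' * z) * z)); split.
- split; first exact: bm_meas (bm_ou c bF).
  apply: measurable_funM => //.
  apply: measurableT_comp => //.
  apply: (@measurable_fubini_F _ _ _ _ _ gam gam
    (EFin \o (fun z : R * R => F (c * z.1 + c' * z.2) * z.2))).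
  have mp : measurable_fun setT (fun z : R * R => F (c * z.1 + c' * z.2) * z.2).
    by apply: measurable_funM => //; exact: bm_meas (bm_ou2 c bF).
  apply/integrable12ltyP; first exact/measurable_EFinP.
  apply: le_lt_trans (_ : (\int[gam]_x \int[gam]_y (M%:E * (`|y|)%:E) < +oo)%E).
    apply: ge0_le_integral => //.
    + by move=> x _; exact: integral_ge0.
    + apply: (measurable_fun_fubini_tonelli_F (fun z => `|(F (c * z.1 + c' * z.2) * z.2)%:E|%E)) => //.
      by apply: measurableT_comp => //; exact/measurable_EFinP.
    + move=> x _; apply: ge0_le_integral => //.
      * apply: measurableT_comp => //; apply/measurable_EFinP.
        exact: (measurable_funM (bm_meas (bs x)) (@measurable_id _ R setT)).
      * by apply/measurable_EFinP; apply: measurable_funM.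
      * move=> y _; rewrite /= lee_fin normrM ler_wpM2r//.
        by rewrite ger0_norm//; case/andP: (FM (c * x + c' * y)).
  have -> : (\int[gam]_y (M%:E * `|y|%:E) = (M * E1)%:E)%E.
    transitivity (M%:E * \int[gam]_y (`|y|)%:E)%E; first by rewrite ge0_integralZl_EFin//; apply/measurable_EFinP.
    rewrite [RHS]EFinM; congr (_ * _)%E.
    by rewrite fineK//; apply: integrable_fin_num => //; exact: gauss_int_norm.
  by rewrite integral_cst//= [gam _]probability_setT mule1 ltry.
- by move=> x; exact: ou_between.
- move=> x; apply: le_trans (_ : M * q * E1 <= _); last first.
    by rewrite lerDr; exact: mulr_ge0 (mulr_ge0 M0 B0) (sqr_ge0 q).
  rewrite normrM (ger0_norm q0) [leRHS]mulrAC mulrC ler_wpM2r//.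
  rewrite (le_trans (le_normr_Rintegral _ (iFz x)))// -RintZ; last exact: gauss_int_norm.
  apply: Rint_le.
  + exact: integrable_norm.
  + by apply: integrableZR; exact: gauss_int_norm.
  + move=> z; rewrite normrM ler_wpM2r// ger0_norm//.
    by case/andP: (FM (c * x + c' * z)).
- move=> x k; pose a := q * k.
  have shiftE : ou c F (x + k) = \int[gam]_z (F (c * x + c' * z) * expR (a * z - a ^+ 2 / 2)).
    rewrite -(gauss_shift_bm a (bs x))// ouE.
    by apply: eq_Rintegral => z _; congr F; rewrite -/c' /a /q; field; rewrite gt_eqF.
  have ie : gam.-integrable setT (EFin \o (fun z => F (c * x + c' * z) * expR (a * z - a ^+ 2 / 2))).
    by apply: bmM_int => //; [exact: measurable_gexp|exact: gexp_int].
  have -> : ou c F (x + k) - ou c F x - q * \int[gam]_z (F (c * x + c' * z) * z) * k =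
     \int[gam]_z (F (c * x + c' * z) * expR (a * z - a ^+ 2 / 2) +
       ((-1) * F (c * x + c' * z) + (- a) * (F (c * x + c' * z) * z))).
    rewrite RintD//; last first.
      by apply: integrableDR; apply: integrableZR => //; exact: bm_int.
    rewrite RintD; [|by apply: integrableZR => //; exact: bm_int..].
    rewrite !RintZ//; [|exact: bm_int].
    by rewrite shiftE (ouE c F x) -/c' /a; ring.
  have it : gam.-integrable setT (EFin \o (fun z => F (c * x + c' * z) * expR (a * z - a ^+ 2 / 2) +
       ((-1) * F (c * x + c' * z) + (- a) * (F (c * x + c' * z) * z)))).
    apply: integrableDR => //.
    by apply: integrableDR; apply: integrableZR => //; exact: bm_int.
  have ik : gam.-integrable setT (EFin \o (fun z => `|expR (a * z - a ^+ 2 / 2) - 1 - a * z|)).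
    have : gam.-integrable setT (EFin \o (fun z => expR (a * z - a ^+ 2 / 2) + (- 1 + (- a) * z))).
      apply: integrableDR; first exact: gexp_int.
      by apply: integrableDR; [exact/bm_int/bm_cst|apply: integrableZR; exact: gauss_int_id].
    move/integrable_norm; apply: eq_integrable => // z _ /=.
    by congr (_%:E); congr (`|_|); ring.
  rewrite (le_trans (le_normr_Rintegral _ it))//.
  apply: le_trans (_ : M * (B * a ^+ 2) <= _); last first.
    rewrite /a exprMn; have : 0 <= M * q * E1 * k ^+ 2.
      exact: mulr_ge0 (mulr_ge0 (mulr_ge0 M0 q0) E10) (sqr_ge0 k).
    by lra.
  apply: le_trans (_ : M * \int[gam]_z `|expR (a * z - a ^+ 2 / 2) - 1 - a * z| <= _); last first.
    by rewrite ler_wpM2l.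
  rewrite -RintZ//; apply: Rint_le.
  + exact: integrable_norm.
  + exact: integrableZR.
  + move=> z.
    have -> : F (c * x + c' * z) * expR (a * z - a ^+ 2 / 2) +
       ((-1) * F (c * x + c' * z) + (- a) * (F (c * x + c' * z) * z)) =
       F (c * x + c' * z) * (expR (a * z - a ^+ 2 / 2) - 1 - a * z) by ring.
    rewrite normrM ler_wpM2r// ger0_norm//.
    by case/andP: (FM (c * x + c' * z)).
Qed.

(** Young's inequality for the product of [y^s] and 1, with exponents [1/s] and [1/(1-s)]; the
    right-hand side is the tangent line at 1. *)
Lemma powR_le_tangent (s y : R) : 0 < s < 1 -> 0 <= y -> y `^ s <= s * y + (1 - s).
Proof.
move=> /andP[s0 s1] y0.
have := @conjugate_powR _ (y `^ s) 1 s^-1 (1 - s)^-1.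
rewrite !invr_gt0 s0 subr_gt0 s1 !invrK powR1 mulr1 powR_ge0 => /(_ isT ler01 isT isT).
rewrite addrC subrK => /(_ erefl); rewrite -powRrM mulfV ?gt_eqF// powRr1//.
by rewrite mul1r (mulrC y).
Qed.

(** Jensen's inequality for a concave power: the tangent line at the mean [A] is integrated. *)
Lemma Rint_powR_le {d} {T : measurableType d} (P : probability T R) (f : T -> R) (s m : R) :
  0 < s < 1 -> 0 < m -> bm f -> (forall x, m <= f x) ->
  \int[P]_x (f x `^ s) <= (\int[P]_x f x) `^ s.
Proof.
move=> s01 m0 bf mf; set A := \int[P]_x f x.
have A0 : 0 < A by apply: lt_le_trans m0 _; exact: Rint_lb.
have f0 x : 0 <= f x by apply: le_trans (ltW m0) (mf x).
have /andP[s0 s1] := s01.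
apply: le_trans (_ : \int[P]_x (A `^ s * (s / A) * f x + A `^ s * (1 - s)) <= _).
  apply: Rint_le.
  - by apply: bm_int; apply: bm_powR => //; exact: ltW.
  - by apply: bm_int; apply: bmD; [exact: bmZ|exact: bm_cst].
  - move=> x; rewrite -[X in X `^ s](mulfVK (lt0r_neq0 A0)) mulrC powRM ?divr_ge0 ?(ltW A0)//.
    rewrite -mulrA -mulrDr ler_wpM2l ?powR_ge0//.
    apply: le_trans (powR_le_tangent s01 _) _; first by rewrite divr_ge0// ltW.
    by rewrite lerD2r mulrA mulrAC.
rewrite RintD; [|exact/bm_int/bmZ|exact/bm_int/bm_cst].
rewrite RintZ; last exact: bm_int.
rewrite Rint_cst -/A le_eqVlt; apply/orP; left; apply/eqP.
by field; rewrite gt_eqF.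
Qed.

(** [P_(c rho c) = P_c P_rho P_c], and symmetry moves one outer factor onto [F^s]. By Jensen
    [P_c (F^s) <= (P_c F)^s], so [P_rho] meets only the mollified [P_c F] and [P_c G], which are
    [smooth] and keep their integrals. The price is the factor [c^2] in the correlation. *)
Lemma mollified_two_point (rho c s t m M : R) F G : 0 <= rho <= 1 -> 0 <= c < 1 ->
  0 < s < 1 -> 0 < t < 1 ->
  (forall k l, 0 <= s * (1 - s) * k ^+ 2 + t * (1 - t) * l ^+ 2 - 2 * s * t * rho * k * l) ->
  0 < m -> measurable_fun setT F -> measurable_fun setT G ->
  (forall x, m <= F x <= M) -> (forall x, m <= G x <= M) ->
  \int[gam]_x (F x `^ s * ou (c * (rho * c)) (fun x => G x `^ t) x) <=
  (\int[gam]_x F x) `^ s * (\int[gam]_x G x) `^ t.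
Proof.
move=> rho01 c01 s01 t01 qpos m0 mF mG FM GM.
have mM : m <= M by case/andP: (FM 0) => h1 h2; exact: le_trans h1 h2.
have c01' : 0 <= c <= 1 by case/andP: c01 => -> /ltW.
have /andP[c0 _] := c01'; have /andP[r0 r1] := rho01.
have bF := bm_between mF FM; have bG := bm_between mG GM.
have mf0 f : (forall x, m <= f x <= M) -> forall x, 0 <= f x.
  by move=> h x; case/andP: (h x) => + _; apply: le_trans; exact: ltW.
have /andP[s0 s1] := s01; have /andP[t0 t1] := t01.
have bFs : bm (fun x => F x `^ s) by apply: bm_powR => //; [exact: ltW|exact: mf0].
have bGt : bm (fun x => G x `^ t) by apply: bm_powR => //; [exact: ltW|exact: mf0].
have rc01 : 0 <= rho * c <= 1.
  by case/andP: c01' => ? ?; rewrite mulr_ge0// mulr_ile1.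
have bFc := bm_ou c bF; have bGc := bm_ou c bG.
have mFc := ou_between c bF FM; have mGc := ou_between c bG GM.
have bGct := bm_ou c bGt.
have Fs0 x : 0 <= F x `^ s by exact: powR_ge0.
have Gt0 x : 0 <= G x `^ t by exact: powR_ge0.
have -> : \int[gam]_x (F x `^ s * ou (c * (rho * c)) (fun x => G x `^ t) x) =
    \int[gam]_x (ou c (fun x => F x `^ s) x * ou rho (ou c (fun x => G x `^ t)) x).
  rewrite -(ou_sym c01' bFs (bm_ou rho bGct)).
  apply: eq_Rintegral => x _; congr (_ * _).
  rewrite -(ou_comp c01' rc01 bGt); congr (ou c _ x); apply/funext => y.
  by rewrite -(ou_comp rho01 c01' bGt).
have bFcs : bm (fun x => ou c F x `^ s) by apply: bm_powR => //; [exact: ltW|exact: mf0].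
have bGcs : bm (fun x => ou c G x `^ t) by apply: bm_powR => //; [exact: ltW|exact: mf0].
apply: le_trans (_ : \int[gam]_x (ou c F x `^ s * ou rho (fun x => ou c G x `^ t) x) <= _).
  apply: Rint_le.
  - exact: (bm_int _ (bmM (bm_ou c bFs) (bm_ou rho bGct))).
  - exact: (bm_int _ (bmM bFcs (bm_ou rho bGcs))).
  - have J f r x : 0 < r < 1 -> (forall x, m <= f x <= M) -> bm f ->
        ou c (fun x => f x `^ r) x <= ou c f x `^ r.
      move=> r01' fM bf; rewrite !ouE; apply: (Rint_powR_le gam (f := fun z => f (c * x + Num.sqrt (1 - c ^+ 2) * z)) r01' m0); first exact: bm_ou1.
      by move=> z; case/andP: (fM (c * x + Num.sqrt (1 - c ^+ 2) * z)).
    move=> x; apply: ler_pM.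
    + exact: ou_ge0.
    + by apply: ou_ge0 => y; exact: ou_ge0.
    + exact: J.
    + by apply: (ou_le rho bGct bGcs) => y; exact: J.
have s01' : 0 <= s <= 1 by rewrite !ltW.
have t01' : 0 <= t <= 1 by rewrite !ltW.
have M0 : 0 <= M by exact: le_trans (ltW m0) mM.
have [C C0 CP] := ou_smooth c01 (ltW m0) M0.
rewrite -(Rint_ou c01' bF) -(Rint_ou c01' bG).
by apply: (gauss_two_point_limit rho01 s01' t01' qpos m0 mM C0); exact: CP.
Qed.

Lemma powR_superadd (p a b : R) : 1 <= p -> 0 <= a -> 0 <= b ->
  a `^ p + b `^ p <= (a + b) `^ p.
Proof.
move=> p1 a0 b0; have p0 : 0 < p by exact: lt_le_trans p1.
have p10 : 0 <= p - 1 by rewrite subr_ge0.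
rewrite -(mulr_powRB1 a0 p0) -(mulr_powRB1 b0 p0) -(mulr_powRB1 (addr_ge0 a0 b0) p0) mulrDl lerD// ler_wpM2l// ge0_ler_powR//
  ?nnegrE ?addr_ge0//; lra.
Qed.

(** Superadditivity of the power, applied to [a^(1/p)] and [b]. It turns a constant [e^p] added
    under the integral into an additive error [e] on the norm. *)
Lemma powR_root_subadd (p a b : R) : 1 <= p -> 0 <= a -> 0 <= b ->
  (a + b `^ p) `^ p^-1 <= a `^ p^-1 + b.
Proof.
move=> p1 a0 b0; have p0 : 0 < p by exact: lt_le_trans p1.
have ab : a + b `^ p <= (a `^ p^-1 + b) `^ p.
  apply: le_trans (powR_superadd p1 (powR_ge0 _ _) b0).
  by rewrite -powRrM mulVf ?gt_eqF// powRr1.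
apply: le_trans (_ : ((a `^ p^-1 + b) `^ p) `^ p^-1 <= _).
  by rewrite ge0_ler_powR ?nnegrE ?invr_ge0 ?(ltW p0) ?addr_ge0 ?powR_ge0.
by rewrite -powRrM mulfV ?gt_eqF// powRr1// addr_ge0// powR_ge0.
Qed.

Lemma le_of_lin (d L R0 K : R) : 0 < d ->
  (forall e, 0 < e < d -> L <= R0 + e * K) -> L <= R0.
Proof.
move=> d0 H; rewrite leNgt; apply/negP => LR.
have K1 : 0 < `|K| + 1 by rewrite ltr_wpDl.
pose e := Num.min (d / 2) ((L - R0) / (2 * (`|K| + 1))).
have LR0 : 0 < L - R0 by rewrite subr_gt0.
have e0 : 0 < e by rewrite lt_min !divr_gt0// mulr_gt0.
have ed : e < d by rewrite gt_min ltr_pdivrMr// ltr_pMr// ltr1n.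
have := H e; rewrite e0 ed => /(_ isT).
have : e * K <= e * (`|K| + 1).
  by rewrite ler_wpM2l ?(ltW e0)// (le_trans (ler_norm K))// lerDl.
have : e * (`|K| + 1) <= (L - R0) / 2.
  rewrite -ler_pdivlMr// -mulrA -invfM ge_min; apply/orP; right.
  by rewrite le_eqVlt; apply/orP; left; apply/eqP; field; rewrite gt_eqF.
by lra.
Qed.

Lemma mulDD_le (a b e : R) : 0 < e -> e < 1 ->
  (a + e) * (b + e) <= a * b + e * (a + b + 1).
Proof.
move=> e0 e1; have : e * e <= e by rewrite ler_piMl// ltW.
by lra.
Qed.

(** The correlation is smaller than [rho] by the factor [c^2], so the mollified inequality applies,
    with [s = 1/p] and [t = 1/q]. The positive lower bound comes from adding [e^p] and [e^q] to the
    powers, and [e] then tends to 0. *)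
Lemma hypercontractive1_strict (rho c p q : R) f g : 0 <= rho <= 1 -> 0 <= c < 1 ->
  1 < p -> 1 < q -> rho ^+ 2 <= (p - 1) * (q - 1) ->
  bm f -> bm g -> (forall x, 0 <= f x) -> (forall x, 0 <= g x) ->
  \int[gam]_x (f x * ou (c * (rho * c)) g x) <=
  (\int[gam]_x (f x `^ p)) `^ p^-1 * (\int[gam]_x (g x `^ q)) `^ q^-1.
Proof.
move=> rho01 c01 p1 q1 rpq bf bg f0 g0.
have p0 : 0 < p by exact: lt_trans p1.
have q0 : 0 < q by exact: lt_trans q1.
have p01 : 0 < p^-1 < 1 by rewrite invr_gt0 p0 invf_lt1.
have q01 : 0 < q^-1 < 1 by rewrite invr_gt0 q0 invf_lt1.
have c01' : 0 <= c <= 1 by case/andP: c01 => -> /ltW.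
(* After clearing denominators and multiplying by [p - 1], completing the square leaves
   [((p - 1) (q - 1) - rho^2) v^2]. *)
have qpos k l : 0 <= p^-1 * (1 - p^-1) * k ^+ 2 + q^-1 * (1 - q^-1) * l ^+ 2
    - 2 * p^-1 * q^-1 * rho * k * l.
  have E : p ^+ 2 * q ^+ 2 * (p^-1 * (1 - p^-1) * k ^+ 2 + q^-1 * (1 - q^-1) * l ^+ 2
    - 2 * p^-1 * q^-1 * rho * k * l) =
    (p - 1) * (q * k) ^+ 2 + (q - 1) * (p * l) ^+ 2 - 2 * rho * (q * k) * (p * l).
    by field; rewrite !gt_eqF.
  have pq0 : 0 < p ^+ 2 * q ^+ 2 by rewrite mulr_gt0 ?exprn_gt0.
  rewrite -(pmulr_rge0 _ pq0) E; move: (q * k) (p * l) => u v.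
  have p10 : 0 < p - 1 by rewrite subr_gt0.
  rewrite -(pmulr_rge0 _ p10).
  have -> : (p - 1) * ((p - 1) * u ^+ 2 + (q - 1) * v ^+ 2 - 2 * rho * u * v) =
    ((p - 1) * u - rho * v) ^+ 2 + ((p - 1) * (q - 1) - rho ^+ 2) * v ^+ 2 by ring.
  by rewrite addr_ge0 ?sqr_ge0// mulr_ge0 ?sqr_ge0// subr_ge0.
set A := \int[gam]_x (f x `^ p); set B := \int[gam]_x (g x `^ q).
have A0 : 0 <= A by apply: Rintegral_ge0 => x _; exact: powR_ge0.
have B0 : 0 <= B by apply: Rintegral_ge0 => x _; exact: powR_ge0.
have bfp : bm (fun x => f x `^ p) by apply: bm_powR => //; exact: ltW.
have bgq : bm (fun x => g x `^ q) by apply: bm_powR => //; exact: ltW.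
set L := (X in X <= _).
have key e : 0 < e -> L <= (A `^ p^-1 + e) * (B `^ q^-1 + e).
  move=> e0; pose F x := f x `^ p + e `^ p; pose G x := g x `^ q + e `^ q.
  have ep : 0 < e `^ p by exact: powR_gt0.
  have eq' : 0 < e `^ q by exact: powR_gt0.
  have [_ [Mf fM]] := bfp; have [_ [Mg gM]] := bgq.
  pose m := Num.min (e `^ p) (e `^ q); pose M := Num.max (Mf + e `^ p) (Mg + e `^ q).
  have m0 : 0 < m by rewrite lt_min ep.
  have FM x : m <= F x <= M.
    rewrite ge_min le_max lerD2r (le_trans (ler_norm _) (fM x)) andbT.
    by rewrite lerDr powR_ge0.
  have GM x : m <= G x <= M.
    rewrite ge_min le_max lerD2r (le_trans (ler_norm _) (gM x)) orbT andbT.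
    by rewrite lerDr powR_ge0 orbT.
  have bF : bm F by apply: bmD => //; exact: bm_cst.
  have bG : bm G by apply: bmD => //; exact: bm_cst.
  have F0 x : 0 <= F x by rewrite addr_ge0 ?powR_ge0.
  have G0 x : 0 <= G x by rewrite addr_ge0 ?powR_ge0.
  have fF x : f x <= F x `^ p^-1.
    rewrite -{1}(powRr1 (f0 x)) -(mulfV (lt0r_neq0 p0)) powRrM.
    apply: ge0_ler_powR; rewrite ?nnegrE ?invr_ge0 ?(ltW p0) ?powR_ge0 ?F0//.
    by rewrite lerDl ltW.
  have gG x : g x <= G x `^ q^-1.
    rewrite -{1}(powRr1 (g0 x)) -(mulfV (lt0r_neq0 q0)) powRrM.
    apply: ge0_ler_powR; rewrite ?nnegrE ?invr_ge0 ?(ltW q0) ?powR_ge0 ?G0//.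
    by rewrite lerDl ltW.
  have bFs : bm (fun x => F x `^ p^-1) by apply: bm_powR => //; rewrite invr_ge0 ltW.
  have bGs : bm (fun x => G x `^ q^-1) by apply: bm_powR => //; rewrite invr_ge0 ltW.
  apply: le_trans (_ : \int[gam]_x (F x `^ p^-1 * ou (c * (rho * c)) (fun x => G x `^ q^-1) x) <= _).
    apply: Rint_le.
    - exact: (bm_int _ (bmM bf (bm_ou _ bg))).
    - exact: (bm_int _ (bmM bFs (bm_ou _ bGs))).
    - move=> x; exact: ler_pM (f0 x) (ou_ge0 _ _ g0) (fF x) (ou_le _ bg bGs gG x).
  apply: le_trans (mollified_two_point rho01 c01 p01 q01 qpos m0 (bm_meas bF) (bm_meas bG) FM GM) _.
  rewrite RintD; [|exact: bm_int|exact/bm_int/bm_cst].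
  rewrite RintD; [|exact: bm_int|exact/bm_int/bm_cst].
  rewrite !Rint_cst -/A -/B.
  apply: ler_pM; [exact: powR_ge0|exact: powR_ge0|..].
    exact: powR_root_subadd (ltW p1) A0 (ltW e0).
  exact: powR_root_subadd (ltW q1) B0 (ltW e0).
have le01 (e : R) : 0 < e < 1 -> L <= A `^ p^-1 * B `^ q^-1 + e * (A `^ p^-1 + B `^ q^-1 + 1).
  move=> /andP[e0 e1]; apply: le_trans (key e e0) _.
  exact: mulDD_le.
exact: le_of_lin ltr01 le01.
Qed.

(** An exponent [p' > p] leaves room in the condition on [rho]: one can write [rho = c rho0 c] with
    [c < 1] and [rho0] admissible for [p'] and [q]. Then [p'] decreases to [p], the boundedness of
    [f] serving to compare the two norms. *)
Lemma hypercontractive1 (rho p q : R) f g : 0 <= rho < 1 ->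
  1 < p -> 1 < q -> rho ^+ 2 <= (p - 1) * (q - 1) ->
  bm f -> bm g -> (forall x, 0 <= f x) -> (forall x, 0 <= g x) ->
  \int[gam]_x (f x * ou rho g x) <=
  (\int[gam]_x (f x `^ p)) `^ p^-1 * (\int[gam]_x (g x `^ q)) `^ q^-1.
Proof.
move=> /andP[r0 r1] p1 q1 rpq bf bg f0 g0.
have p0 : 0 < p by exact: lt_trans p1.
have p10 : 0 < p - 1 by rewrite subr_gt0.
set L := (X in X <= _); set B := (X in _ <= _ * X); set A := \int[gam]_x (f x `^ p).
have B0 : 0 <= B by exact: powR_ge0.
have A0 : 0 <= A by apply: Rintegral_ge0 => x _; exact: powR_ge0.
have bfp z : 0 <= z -> bm (fun x => f x `^ z) by move=> z0; apply: bm_powR.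
have key p' : p < p' -> L <= (\int[gam]_x (f x `^ p')) `^ p'^-1 * B.
  move=> pp'; have p'10 : 0 < p' - 1 by rewrite subr_gt0; exact: lt_trans pp'.
  (* The maximum makes [rho0^2 = rho^2 / m] at most 1 and at most [(p' - 1) (q - 1)]. It is below 1
     because [rho < 1] and [p < p'], and [c] is its fourth root. *)
  pose m := Num.max (rho ^+ 2) ((p - 1) / (p' - 1)).
  have m0 : 0 < m by rewrite lt_max divr_gt0 ?orbT.
  have m1 : m < 1.
    rewrite gt_max ltr_pdivrMr// mul1r ltrD2r pp' andbT.
    by rewrite expr2 -[ltRHS]mul1r ltr_pM.
  pose c := Num.sqrt (Num.sqrt m).
  have c0 : 0 < c by rewrite !sqrtr_gt0.
  have c4 : (c * c) ^+ 2 = m by rewrite -expr2 sqr_sqrtr ?sqrtr_ge0// sqr_sqrtr// ltW.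
  have c1 : c < 1.
    have sm : Num.sqrt m < 1 by rewrite -[ltRHS]sqrtr1 ltr_sqrt.
    by rewrite -[ltRHS]sqrtr1 ltr_sqrt.
  pose rho0 := rho / (c * c).
  have -> : L = \int[gam]_x (f x * ou (c * (rho0 * c)) g x).
    by rewrite /L (_ : c * (rho0 * c) = rho)// /rho0; field; rewrite gt_eqF.
  have r02 : rho0 ^+ 2 = rho ^+ 2 / m by rewrite /rho0 expr_div_n c4.
  have r00 : 0 <= rho0 by rewrite divr_ge0// mulr_ge0 ?ltW.
  apply: hypercontractive1_strict => //.
  - rewrite r00/= -(@ler_pXn2r _ 2) ?nnegrE// expr1n r02 ler_pdivrMr// mul1r.
    by rewrite le_max lexx.
  - by rewrite (ltW c0).
  - exact: lt_trans pp'.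
  - rewrite r02 ler_pdivrMr//; apply: (le_trans rpq).
    rewrite mulrAC ler_wpM2r ?subr_ge0 ?(ltW q1)//.
    by rewrite mulrC -ler_pdivrMr// le_max lexx orbT.
have [_ [N' fN']] := bf; pose N := Num.max N' 1.
have N1 : 1 <= N by rewrite le_max lexx orbT.
have N0 : 0 < N by exact: lt_le_trans N1.
have fN x : f x <= N by rewrite le_max (le_trans (ler_norm _) (fN' x)).
have key2 p' : p < p' -> L <= N `^ ((p' - p) / p') * A `^ p'^-1 * B.
  move=> pp'; have p'0 : 0 < p' by exact: lt_trans pp'.
  apply: le_trans (key _ pp') _; rewrite ler_wpM2r//.
  have pp0 : 0 <= p' - p by rewrite subr_ge0 ltW.
  rewrite powRrM -powRM ?powR_ge0// ge0_ler_powR ?nnegrE ?invr_ge0 ?(ltW p'0)//.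
  - by apply: Rintegral_ge0 => x _; exact: powR_ge0.
  - by rewrite mulr_ge0 ?powR_ge0.
  - rewrite -RintZ; last by apply: bm_int; apply: bfp; exact: ltW.
    apply: Rint_le.
    + by apply: bm_int; apply: bfp; exact: ltW.
    + by apply: bm_int; apply: bmZ; apply: bfp; exact: ltW.
    + move=> x; have -> : f x `^ p' = f x `^ (p' - p) * f x `^ p.
        have [->|fx0] := eqVneq (f x) 0.
          by rewrite (powR0 (lt0r_neq0 p'0)) (powR0 (lt0r_neq0 p0)) mulr0.
        by rewrite -powRD ?subrK// fx0 implybT.
      by rewrite ler_wpM2r ?powR_ge0// ge0_ler_powR ?nnegrE// ltW.
(* If [A = 0] the bound [key2] is already zero; the case is set apart because [ln A] enters
   below. *)
have [A00|A00] := eqVneq A 0.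
  have := key2 (p + 1); rewrite ltrDl ltr01 A00 => /(_ isT).
  by rewrite !powR0 ?invr_eq0 ?gt_eqF ?addr_gt0// mulr0 mul0r.
have {}A0 : 0 < A by rewrite lt_neqAle eq_sym A00.
pose K := p * ln N - ln A.
have key3 (e : R) : 0 < e < p^-1 ->
    L <= A `^ p^-1 * B + e * (A `^ p^-1 * B * (`|K| * expR (p^-1 * `|K|))).
  (* With [1/p' = 1/p - e] the factor comparing the norms is exactly [expR (e * K)], so the excess
     is linear in [e] up to a bounded factor. *)
  move=> /andP[e0 ep]; pose p' := (p^-1 - e)^-1.
  have d0 : 0 < p^-1 - e by rewrite subr_gt0.
  have pp' : p < p'.
    rewrite /p' -[ltLHS]invrK ltf_pV2 ?posrE ?invr_gt0//.
    by rewrite gtrBl.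
  apply: le_trans (key2 _ pp') _.
  have -> : N `^ ((p' - p) / p') * A `^ p'^-1 = A `^ p^-1 * expR (e * K).
    rewrite /powR !gt_eqF// -!expRD; congr expR; rewrite /K /p' invrK.
    rewrite mulrBl mulVf ?gt_eqF// mulrBr mulfV ?gt_eqF//; ring.
  have eK : expR (e * K) <= 1 + e * (`|K| * expR (p^-1 * `|K|)).
    have := expR_sub1_le (e * `|K|).
    have : expR (e * K) <= expR (e * `|K|).
      by rewrite ler_expR ler_wpM2l ?ler_norm// ltW.
    have : e * `|K| * expR (e * `|K|) <= e * `|K| * expR (p^-1 * `|K|).
      by rewrite ler_wpM2l ?mulr_ge0 ?(ltW e0)// ler_expR ler_wpM2r// ltW.
    by lra.
  have AB0 : 0 <= A `^ p^-1 * B by rewrite mulr_ge0 ?powR_ge0.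
  have : A `^ p^-1 * B * expR (e * K) <= A `^ p^-1 * B * (1 + e * (`|K| * expR (p^-1 * `|K|))).
    by rewrite ler_wpM2l.
  by lra.
apply: le_of_lin key3.
by rewrite invr_gt0.
Qed.
End hypercontractivity1.

(** * The Gaussian measure on tuples *)

Section std_gaussian_tuples.
Context {R : realType}.
Local Notation gam := (@gauss R).

Lemma prob_lty {d'} {T : measurableType d'} (P : probability T R) : (P setT < +oo)%E.
Proof.
apply: le_lt_trans (ltry 1); rewrite le_eqVlt; apply/orP; left; apply/eqP.
exact: probability_setT.
Qed.

Lemma measurable_rect d (A : 'I_d -> set R) : (forall i, measurable (A i)) ->
  measurable [set x : d.-tuple R | forall i, A i (tnth x i)].
Proof.
move=> mA.
rewrite [X in measurable X](_ : _ =
    \bigcap_(i in [set: 'I_d]) ((fun x : d.-tuple R => tnth x i) @^-1` A i)).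
  apply: fin_bigcap_measurable => // i _.
  by rewrite -[X in measurable X]setTI; exact: measurable_tnth.
by apply/seteqP; split => [x Ax i _|x Ax i]; exact: Ax.
Qed.

(** Measurable rectangles form a pi-system that contains the whole space and generates the
    sigma-algebra of tuples; finiteness of [m1] gives the sigma-finiteness that uniqueness asks
    for. *)
Lemma tuple_measure_unique d (m1 m2 : {measure set (d.-tuple R) -> \bar R}) :
  (m1 setT < +oo)%E ->
  (forall A : 'I_d -> set R, (forall i, measurable (A i)) ->
     m1 [set x | forall i, A i (tnth x i)] = m2 [set x | forall i, A i (tnth x i)]) ->
  forall A, measurable A -> m1 A = m2 A.
Proof.
move=> m1oo m12.
pose G := [set B : set (d.-tuple R) | exists2 A : 'I_d -> set R,
  (forall i, measurable (A i)) & B = [set x | forall i, A i (tnth x i)]].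
have GT : G setT.
  exists (fun=> setT) => //; by apply/seteqP; split.
have Gm : G `<=` measurable by move=> _ [A mA ->]; exact: measurable_rect.
have GI : setI_closed G.
  move=> _ _ [A mA ->] [B mB ->]; exists (fun i => A i `&` B i).
    by move=> i; exact: measurableI.
  by apply/seteqP; split => [x [Ax Bx] i|x ABx]; [split|split => i; case: (ABx i)].
have sG : measurable `<=` <<s G >>.
  apply: smallest_sub; first exact: smallest_sigma_algebra.
  elim/big_ind: _ => //; first by move=> U V UG VG; rewrite subUset.
  move=> i _ _ [B mB <-]; rewrite setTI; apply: sub_sigma_algebra.
  exists (fun j => if j == i then B else setT); first by move=> j; case: ifP.
  apply/seteqP; split => [x Bx j|x /(_ i)]; last by rewrite eqxx.
  by case: ifPn => // /eqP ->.
move=> A mA; apply: (@g_sigma_algebra_measure_unique _ _ _ G Gm (fun=> setT)) => //.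
- by rewrite bigcup_const.
- by move=> _ [B mB ->]; exact: m12.
- exact: sG.
Qed.

Lemma std_gaussian_marginal d (mu : probability (d.-tuple R) R) i (A : set R) :
  is_std_gaussian mu -> measurable A ->
  mu ((fun x => tnth x i) @^-1` A) = gam A.
Proof.
move=> gmu mA.
rewrite (_ : _ @^-1` _ = [set x | forall j, (if j == i then A else setT) (tnth x j)]); last first.
  apply/seteqP; split => [x Ax j|x /(_ i)]; last by rewrite eqxx.
  by case: ifPn => // /eqP ->.
rewrite (gmu (fun j => if j == i then A else setT)); last by move=> j; case: ifP.
rewrite (bigD1 i)//= eqxx big1 ?mule1// => j /negPf ->.
exact: (@probability_setT _ _ _ (normal_prob 0 1)).
Qed.

Definition tcons d (z : R * d.-tuple R) : d.+1.-tuple R := [tuple of z.1 :: z.2].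
Definition tbehead d (x : d.+1.-tuple R) : d.-tuple R := [tuple of behead x].

Lemma measurable_tcons d : measurable_fun setT (@tcons d).
Proof. by apply: measurable_cons. Qed.

Lemma measurable_tbehead d : measurable_fun setT (@tbehead d).
Proof. exact: measurable_behead. Qed.

Definition behead_prob d (mu : probability (d.+1.-tuple R) R) :
    probability (d.-tuple R) R :=
  let X : {mfun (d.+1.-tuple R) >-> (d.-tuple R)} :=
    HB.pack (@tbehead d) (isMeasurableFun.Build _ _ _ _ _ (@measurable_tbehead d)) in
  distribution mu X.

Lemma tnth_tcons0 d z : tnth (@tcons d z) ord0 = z.1.
Proof. by rewrite /tcons (tnth_nth 0). Qed.

Lemma tnth_tconsS d z i : tnth (@tcons d z) (lift ord0 i) = tnth z.2 i.
Proof. by rewrite /tcons !(tnth_nth 0). Qed.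

Lemma tnth_tbehead d (x : d.+1.-tuple R) i : tnth (tbehead x) i = tnth x (lift ord0 i).
Proof. by rewrite /tbehead !(tnth_nth 0)/= nth_behead. Qed.

Lemma behead_std_gaussian d (mu : probability (d.+1.-tuple R) R) :
  is_std_gaussian mu -> is_std_gaussian (behead_prob mu).
Proof.
move=> gmu A mA.
pose B (i : 'I_d.+1) := if unlift ord0 i is Some j then A j else setT.
transitivity (mu [set x | forall i, B i (tnth x i)]).
  congr (mu _); apply/seteqP; split => x /= h i.
    by rewrite /B; case: unliftP => [j ->|] //; rewrite -tnth_tbehead.
  by have := h (lift ord0 i); rewrite /B liftK -tnth_tbehead.
rewrite gmu; last by move=> i; rewrite /B; case: unlift.
rewrite big_ord_recl /B unlift_none.
rewrite [X in (X * _)%E](_ : _ = 1%E) ?mul1e; last exact: (@probability_setT _ _ _ (normal_prob 0 1)).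
by apply: eq_bigr => i _; rewrite liftK.
Qed.

(** [mu] and the image of the product measure under [tcons] agree on rectangles. This splitting of
    the first coordinate is the basis of the inductions on the dimension. *)
Lemma integral_std_gaussianS d (mu : probability (d.+1.-tuple R) R) :
  is_std_gaussian mu -> forall F : d.+1.-tuple R -> \bar R, measurable_fun setT F ->
  (\int[mu]_x F x = \int[gam \x behead_prob mu]_z F (tcons z))%E.
Proof.
move=> gmu F mF; move: F mF.
apply: (integral_image (m1 := (gam \x behead_prob mu)%E) (@measurable_tcons d)).
apply: (tuple_measure_unique (m2 := image_measure (gam \x behead_prob mu)%E (@measurable_tcons d))).
  exact: prob_lty.
move=> A mA; apply: (eq_trans (gmu A mA)).
have mB := measurable_rect (fun i => mA (lift ord0 i)).
rewrite big_ord_recl -(behead_std_gaussian gmu (fun i => mA (lift ord0 i))).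
rewrite -[RHS]/((gam \x behead_prob mu)%E (@tcons d @^-1` [set x | forall i, A i (tnth x i)])).
rewrite [X in _ = (_ \x _)%E X](_ : _ =
   A ord0 `*` [set x | forall i, A (lift ord0 i) (tnth x i)]).
  have /= E := @product_measure1E _ _ _ _ _ gam (behead_prob mu) (A ord0) _ (mA ord0) mB.
  rewrite [RHS]E.
  by [].
apply/seteqP; split => [z /= h|z [/= h0 h] i].
  by split => [|i]; rewrite /= -?tnth_tcons0 -?tnth_tconsS; exact: h.
by case: (unliftP ord0 i) => [j ->|->]; rewrite ?tnth_tconsS ?tnth_tcons0.
Qed.

Definition comb d (a b : R) (x y : d.-tuple R) : d.-tuple R :=
  [tuple a * tnth x i + b * tnth y i | i < d].

Lemma tnth_comb d a b (x y : d.-tuple R) i :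
  tnth (comb a b x y) i = a * tnth x i + b * tnth y i.
Proof. by rewrite tnth_mktuple. Qed.

(** [comb b (- a)] is [b x - a y], so this is the reflection [rot] acting on each pair of
    coordinates. *)
Definition rotd d (a b : R) (z : d.-tuple R * d.-tuple R) :=
  (comb a b z.1 z.2, comb b (- a) z.1 z.2).

Lemma measurable_comb d (a b : R) :
  measurable_fun setT (fun z : d.-tuple R * d.-tuple R => comb a b z.1 z.2).
Proof.
apply/measurable_fun_tnthP => i.
rewrite (_ : _ \o _ = fun z => a * tnth z.1 i + b * tnth z.2 i); last first.
  by apply/funext => z /=; rewrite tnth_comb.
by apply: measurable_lin; [apply: (measurableT_comp (measurable_tnth i))|
  apply: (measurableT_comp (measurable_tnth i))].
Qed.

Lemma measurable_rotd d (a b : R) : measurable_fun setT (@rotd d a b).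
Proof. by apply: measurable_fun_pair; exact: measurable_comb. Qed.

Lemma comb_tcons d (a b : R) (u v : R * d.-tuple R) :
  comb a b (tcons u) (tcons v) = tcons (a * u.1 + b * v.1, comb a b u.2 v.2).
Proof.
apply: eq_from_tnth => i; rewrite tnth_comb.
by case: (unliftP ord0 i) => [j ->|->]; rewrite ?tnth_tconsS ?tnth_tcons0//= tnth_comb.
Qed.

Lemma rotd_invol d (a b : R) z : a ^+ 2 + b ^+ 2 = 1 -> @rotd d a b (rotd a b z) = z.
Proof.
move=> ab; case: z => x y; rewrite /rotd /=; congr (_, _); apply: eq_from_tnth => i;
  rewrite !tnth_comb.
- by rewrite -[RHS]mul1r -{1}ab; ring.
- by rewrite -[RHS]mul1r -{1}ab; ring.
Qed.

Local Open Scope ereal_scope.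

(** The two first coordinates are brought outermost, so that a planar statement handles them and an
    induction hypothesis the inner pair. *)
Lemma tuple_tonelli2 d (mu : probability (d.+1.-tuple R) R) :
  is_std_gaussian mu -> forall F : d.+1.-tuple R * d.+1.-tuple R -> \bar R,
  measurable_fun setT F -> (forall z, 0 <= F z) ->
  \int[mu]_x \int[mu]_y F (x, y) =
  \int[gam]_u \int[gam]_v \int[behead_prob mu]_x \int[behead_prob mu]_y
    F (tcons (u, x), tcons (v, y)).
Proof.
move=> gmu F mF F0; have mt := @measurable_tcons d; set nu := behead_prob mu.
pose H x := \int[mu]_y F (x, y).
have mH : measurable_fun setT H by exact: measurable_fun_fubini_tonelli_F.
have HE x : H x = \int[gam]_v \int[nu]_y F (x, tcons (v, y)).
  rewrite /H (integral_std_gaussianS gmu); last exact: measurable_pair_comp.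
  rewrite (fubini_tonelli1 (fun z => F (x, tcons z)))//.
  exact: measurable_pair_comp.
rewrite (integral_std_gaussianS gmu mH).
rewrite (fubini_tonelli1 (fun z => H (tcons z))); last 2 first.
- exact: measurableT_comp.
- by move=> z; exact: integral_ge0.
apply: eq_integral => u _; rewrite /fubini_F.
under eq_integral do rewrite HE.
apply: (fubini_tonelli (fun z => \int[nu]_y F (tcons (u, z.1), tcons (z.2, y)))); last first.
  by move=> z; exact: integral_ge0.
apply: (measurable_fun_fubini_tonelli_F (fun w : (d.-tuple R * R) * d.-tuple R =>
   F (tcons (u, w.1.1), tcons (w.1.2, w.2)))) => //.
apply: measurable_pair_comp => //; apply: measurableT_comp => //;
  apply: measurable_fun_pair => //; exact: measurableT_comp.
Qed.

(** Induction on [d]: for fixed first coordinates the inner double integral is invariant by the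
    induction hypothesis, and the outer one by [ge0_gauss_rot]. In dimension 0 there is a single
    point. *)
Lemma ge0_tuple_rot d (mu : probability (d.-tuple R) R) (a b : R) :
  is_std_gaussian mu -> (a ^+ 2 + b ^+ 2 = 1)%R ->
  forall F : d.-tuple R * d.-tuple R -> \bar R,
  measurable_fun setT F -> (forall z, 0 <= F z) ->
  \int[mu]_x \int[mu]_y F (rotd a b (x, y)) = \int[mu]_x \int[mu]_y F (x, y).
Proof.
elim: d => [|d IH] in mu *.
  move=> _ _ F _ _; apply: eq_integral => x _; apply: eq_integral => y _.
  by congr (F (_, _)); apply: eq_from_tnth => -[].
move=> gmu ab F mF F0; have gnu := behead_std_gaussian gmu.
set nu := behead_prob mu in gnu *; have mt := @measurable_tcons d.
have mFr : measurable_fun setT (fun z => F (rotd a b z)).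
  by apply: measurableT_comp => //; exact: measurable_rotd.
transitivity (\int[gam]_u \int[gam]_v \int[nu]_x \int[nu]_y
    F (rotd a b (tcons (u, x), tcons (v, y)))).
  exact: (tuple_tonelli2 gmu mFr).
rewrite (tuple_tonelli2 gmu mF F0) -/nu.
pose H z := \int[nu]_x \int[nu]_y F (tcons (z.1, x), tcons (z.2, y)).
have mF4 : measurable_fun setT (fun w : ((R * R) * d.-tuple R) * d.-tuple R =>
   F (tcons (w.1.1.1, w.1.2), tcons (w.1.1.2, w.2))).
  apply: measurable_pair_comp => //; apply: measurableT_comp => //;
    apply: measurable_fun_pair => //; do ?exact: measurableT_comp.
    by apply: (measurableT_comp measurable_fst); exact: measurableT_comp.
  by apply: (measurableT_comp measurable_snd); exact: measurableT_comp.
have mH : measurable_fun setT H.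
  apply: (measurable_fun_fubini_tonelli_F (fun w : (R * R) * d.-tuple R =>
    \int[nu]_y F (tcons (w.1.1, w.2), tcons (w.1.2, y)))).
    exact: (measurable_fun_fubini_tonelli_F _ mF4).
  by move=> z; exact: integral_ge0.
have H0 z : 0 <= H z by apply: integral_ge0 => x _; exact: integral_ge0.
rewrite -[RHS](ge0_gauss_rot ab mH H0).
apply: eq_integral => u _; apply: eq_integral => v _.
have mG : measurable_fun setT (fun w : d.-tuple R * d.-tuple R =>
    F (tcons ((a * u + b * v)%R, w.1), tcons ((b * u - a * v)%R, w.2))).
  by apply: measurable_pair_comp => //; apply: measurableT_comp => //; exact: measurable_fun_pair.
apply: (eq_trans _ (IH nu gnu ab _ mG (fun=> F0 _))).
apply: eq_integral => x _; apply: eq_integral => y _.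
by rewrite /rotd/= !comb_tcons/= mulNr.
Qed.

Lemma tuple_rot d (mu : probability (d.-tuple R) R) (a b : R) :
  is_std_gaussian mu -> (a ^+ 2 + b ^+ 2 = 1)%R ->
  forall F : d.-tuple R * d.-tuple R -> \bar R, measurable_fun setT F ->
  \int[mu \x mu]_z F (rotd a b z) = \int[mu \x mu]_z F z.
Proof.
move=> gmu ab F mF; apply/esym; move: F mF.
apply: (integral_image (m1 := mu \x mu) (m2 := mu \x mu) (measurable_rotd a b)).
apply: (integral_image_ge0 (m1 := mu \x mu) (m2 := mu \x mu) (measurable_rotd a b)) => F mF F0.
have mFr : measurable_fun setT (fun z => F (rotd a b z)).
  by apply: measurableT_comp => //; exact: measurable_rotd.
transitivity (\int[mu]_x \int[mu]_y F (x, y)); first exact: fubini_tonelli1.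
transitivity (\int[mu]_x \int[mu]_y F (rotd a b (x, y))); last first.
  exact/esym/(fubini_tonelli1 (fun z => F (rotd a b z))).
exact/esym/ge0_tuple_rot.
Qed.

End std_gaussian_tuples.

(** * Tensorization *)

Section tensorization.
Context {R : realType}.
Local Notation gam := (@gauss R).
Local Opaque ou.

Lemma Rint_tcons d (mu : probability (d.+1.-tuple R) R) : is_std_gaussian mu ->
  forall f : d.+1.-tuple R -> R, bm f ->
  \int[mu]_x f x = \int[gam]_u \int[behead_prob mu]_x f (tcons (u, x)).
Proof.
move=> gmu f bf.
have bft : bm (fun z => f (@tcons R d z)) by exact: bm_comp bf (@measurable_tcons R d).
rewrite -(Rint_prod gam (behead_prob mu) bft).
congr fine; rewrite (integral_std_gaussianS gmu)//.
exact/measurable_EFinP/bm_meas.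
Qed.

Lemma bm_comb2 d (a b : R) (g : d.-tuple R -> R) : bm g ->
  bm (fun z : d.-tuple R * d.-tuple R => g (comb a b z.1 z.2)).
Proof. by move=> bg; exact: bm_comp bg (measurable_comb a b). Qed.

Lemma bm_combR d (mu : probability (d.-tuple R) R) (a b : R) (g : d.-tuple R -> R) :
  bm g -> bm (fun x => \int[mu]_y g (comb a b x y)).
Proof. by move=> bg; have := bm_Rint mu (bm_comb2 a b bg). Qed.

(** [F u] and [G u] are the partial [L^p] and [L^q] norms of the slices at [u]. For fixed [u] and
    [v] the induction hypothesis bounds the inner integral by [F u * G (a u + b v)]; the inequality
    on the line then applies to [F] and [G], whose norms are the full norms of [f] and [g]. *)
Lemma hypercontractive_tuple d (mu : probability (d.-tuple R) R) (a p q : R)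
    (f g : d.-tuple R -> R) :
  is_std_gaussian mu -> 0 <= a < 1 -> 1 < p -> 1 < q -> a ^+ 2 <= (p - 1) * (q - 1) ->
  bm f -> bm g -> (forall x, 0 <= f x) -> (forall x, 0 <= g x) ->
  \int[mu]_x (f x * \int[mu]_y g (comb a (Num.sqrt (1 - a ^+ 2)) x y)) <=
  (\int[mu]_x (f x `^ p)) `^ p^-1 * (\int[mu]_x (g x `^ q)) `^ q^-1.
Proof.
set b := Num.sqrt _; elim: d => [|d IH] in mu f g *.
  move=> _ _ p1 q1 _ _ _ f0 g0.
  have E (t u : 0.-tuple R) : t = u by apply: eq_from_tnth => -[].
  have [e _] : exists e : 0.-tuple R, True by exists [tuple].
  have cE (h : 0.-tuple R -> R) : \int[mu]_x h x = h e.
    by rewrite -[RHS](Rint_cst mu); apply: eq_Rintegral => x _; rewrite (E x e).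
  have p0 : p != 0 by rewrite gt_eqF// (lt_trans ltr01 p1).
  have q0 : q != 0 by rewrite gt_eqF// (lt_trans ltr01 q1).
  by rewrite !cE (E (comb a b e e) e) -!powRrM !mulfV// !powRr1.
move=> gmu a01 p1 q1 apq bf bg f0 g0; have gnu := behead_std_gaussian gmu.
have p0 : 0 < p by exact: lt_trans p1.
have q0 : 0 < q by exact: lt_trans q1.
set nu := behead_prob mu in gnu *.
have mt := @measurable_tcons R d.
have bft : bm (fun z => f (@tcons R d z)) by exact: bm_comp bf mt.
have bgt : bm (fun z => g (@tcons R d z)) by exact: bm_comp bg mt.
have bfp : bm (fun z => f (@tcons R d z) `^ p) by apply: bm_powR => //; exact: ltW.
have bgq : bm (fun z => g (@tcons R d z) `^ q) by apply: bm_powR => //; exact: ltW.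
(* F and G are kept abstract: unfolding them makes unification very slow *)
have [F FE] : exists F : R -> R, F = fun u => (\int[nu]_x (f (tcons (u, x)) `^ p)) `^ p^-1.
  by exact: (ex_intro _ _ erefl).
have [G GE] : exists G : R -> R, G = fun u => (\int[nu]_x (g (tcons (u, x)) `^ q)) `^ q^-1.
  by exact: (ex_intro _ _ erefl).
have If0 u : 0 <= \int[nu]_x (f (tcons (u, x)) `^ p).
  by apply: Rintegral_ge0 => x _; exact: powR_ge0.
have Ig0 u : 0 <= \int[nu]_x (g (tcons (u, x)) `^ q).
  by apply: Rintegral_ge0 => x _; exact: powR_ge0.
have bIf : bm (fun u => \int[nu]_x (f (tcons (u, x)) `^ p)).
  by have := bm_Rint nu bfp.
have bIg : bm (fun u => \int[nu]_x (g (tcons (u, x)) `^ q)).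
  by have := bm_Rint nu bgq.
have pV0 : 0 <= p^-1 by rewrite invr_ge0 ltW.
have qV0 : 0 <= q^-1 by rewrite invr_ge0 ltW.
have bF : bm F by rewrite FE; exact: bm_powR pV0 bIf If0.
have bG : bm G by rewrite GE; exact: bm_powR qV0 bIg Ig0.
have F0 u : 0 <= F u by rewrite FE; exact: powR_ge0.
have G0 u : 0 <= G u by rewrite GE; exact: powR_ge0.
have FpE : \int[gam]_u (F u `^ p) = \int[mu]_x (f x `^ p).
  apply: eq_trans (esym (Rint_tcons gmu (bm_powR (ltW p0) bf f0))).
  by apply: eq_Rintegral => u _; rewrite FE -powRrM mulVf ?gt_eqF// powRr1.
have GqE : \int[gam]_u (G u `^ q) = \int[mu]_x (g x `^ q).
  apply: eq_trans (esym (Rint_tcons gmu (bm_powR (ltW q0) bg g0))).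
  by apply: eq_Rintegral => u _; rewrite GE -powRrM mulVf ?gt_eqF// powRr1.
have := hypercontractive1 a01 p1 q1 apq bF bG F0 G0.
rewrite FpE GqE; apply: le_trans.
have bgc u : bm (fun y => g (comb a b u y)) by have := bm_slice2 u (bm_comb2 a b bg).
pose K (u v : R) (x : d.-tuple R) := \int[nu]_y g (tcons (a * u + b * v, comb a b x y)).
have m5 : measurable_fun setT (fun w : (R * R) * (d.-tuple R * d.-tuple R) =>
    tcons (a * w.1.1 + b * w.1.2, comb a b w.2.1 w.2.2)).
  apply: measurableT_comp => //; apply: measurable_fun_pair.
    by apply: measurable_lin; exact: measurableT_comp.
  exact: (measurableT_comp (measurable_comb a b)).
have b5 : bm (fun w : ((R * R) * d.-tuple R) * d.-tuple R =>
    g (tcons (a * w.1.1.1 + b * w.1.1.2, comb a b w.1.2 w.2))).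
  apply: bm_comp bg _.
  have m6 : measurable_fun setT (fun w : ((R * R) * d.-tuple R) * d.-tuple R =>
      (w.1.1, (w.1.2, w.2))).
    apply: measurable_fun_pair; first exact: measurableT_comp.
    by apply: measurable_fun_pair => //; exact: measurableT_comp.
  exact: (measurableT_comp m5 m6).
have bK : bm (fun w : (R * R) * d.-tuple R => K w.1.1 w.1.2 w.2).
  by have := bm_Rint nu b5.
have bmain : bm (fun w : (R * R) * d.-tuple R => f (tcons (w.1.1, w.2)) * K w.1.1 w.1.2 w.2).
  apply: bmM => //; apply: (bm_comp bft).
  by apply: measurable_fun_pair => //; exact: measurableT_comp.
have E1 : \int[mu]_x (f x * \int[mu]_y g (comb a b x y)) =
    \int[gam]_u \int[gam]_v \int[nu]_x (f (tcons (u, x)) * K u v x).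
  rewrite (Rint_tcons gmu); last by apply: bmM => //; exact: bm_combR.
  apply: eq_Rintegral => u _.
  have b7 : bm (fun w : d.-tuple R * R => f (tcons (u, w.1)) * K u w.2 w.1).
    apply: (bm_comp bmain (g := fun w : d.-tuple R * R => ((u, w.2), w.1))).
    by apply: measurable_fun_pair => //; exact: measurable_fun_pair.
  rewrite -(Rint_swap nu gam b7)/=.
  apply: eq_Rintegral => x _; rewrite (Rint_tcons gmu); last exact: bgc.
  rewrite -RintZ.
    apply: eq_Rintegral => v _; congr (_ * _).
    by apply: eq_Rintegral => y _; rewrite comb_tcons.
  apply: bm_int.
  have b8 := bm_slice2 (tcons (u, x)) (bm_comb2 a b bg).
  have b9 : bm (fun z => g (comb a b (tcons (u, x)) (@tcons R d z))) by exact: bm_comp b8 mt.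
  by have := bm_Rint nu b9.
rewrite E1.
have bFG : bm (fun w : R * R => F w.1 * G (a * w.1 + b * w.2)).
  by apply: bmM; [exact: bm_comp bF measurable_fst|exact: bm_comp bG (measurable_aff a b)].
have E2 : \int[gam]_u (F u * ou a G u) = \int[gam]_u \int[gam]_v (F u * G (a * u + b * v)).
  apply: eq_Rintegral => u _; rewrite ouE RintZ//.
  by apply: bm_int; exact: (bm_ou1 a u bG).
rewrite E2; have bin := bm_Rint nu bmain.
have bin2 := bm_Rint gam bin; have bFG2 := bm_Rint gam bFG.
apply: Rint_le.
- by apply: bm_int; exact: bin2.
- by apply: bm_int; exact: bFG2.
move=> u; apply: Rint_le.
- by apply: bm_int; have := bm_slice2 u bin.
- by apply: bm_int; have := bm_slice2 u bFG.
move=> v; rewrite FE GE; apply: (IH nu (fun x => f (tcons (u, x))) (fun x => g (tcons (a * u + b * v, x)))) => //.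
- exact: (bm_slice2 u bft).
- exact: (bm_slice2 (a * u + b * v) bgt).
Qed.

(** Monotone convergence in the form suited to truncations, which become stationary at each
    point. *)
Lemma ge0_integral_eventually {d} {T : measurableType d} (P : {measure set T -> \bar R})
    (F_ : nat -> T -> R) (F : T -> R) (B : \bar R) :
  (forall n, measurable_fun setT (F_ n)) -> (forall n x, 0 <= F_ n x) ->
  (forall x, {homo F_ ^~ x : m n / (m <= n)%N >-> m <= n}) ->
  (forall x, exists N, forall n, (N <= n)%N -> F_ n x = F x) ->
  (forall n, (\int[P]_x (F_ n x)%:E <= B)%E) -> (\int[P]_x (F x)%:E <= B)%E.
Proof.
move=> mF F0 ndF evF FB.
have mFE n : measurable_fun setT (fun x => (F_ n x)%:E) by exact/measurable_EFinP.
have F0E n x : setT x -> (0 <= (F_ n x)%:E)%E by rewrite lee_fin.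
have ndFE x : setT x -> {homo (fun n => (F_ n x)%:E) : m n / (m <= n)%N >-> (m <= n)%E}.
  by move=> _ m n mn; rewrite lee_fin ndF.
have -> : (\int[P]_x (F x)%:E = \int[P]_x limn (fun n => (F_ n x)%:E))%E.
  apply: eq_integral => x _; apply/esym/cvg_lim => //.
  have [N NP] := evF x; apply: cvg_near_cst.
  by exists N => // n /= Nn; rewrite NP.
rewrite (monotone_convergence P measurableT mFE F0E ndFE).
apply: lime_le.
  apply: ereal_nondecreasing_is_cvgn => m n mn; apply: ge0_le_integral => //.
  - by move=> x; exact: F0E.
  - by move=> x _; exact: ndFE.
by apply: nearW.
Qed.

Lemma min_eventually (x : R) : exists N, forall n : nat, (N <= n)%N -> Num.min x n%:R = x.
Proof.
exists (Num.truncn `|x|).+1 => n Nn; apply/min_idPl.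
apply: le_trans (ler_norm x) _; apply: ltW; apply: lt_le_trans (truncnS_gt _) _.
by rewrite ler_nat.
Qed.

Lemma bm_min {d} {T : measurableType d} (f : T -> R) (n : nat) :
  measurable_fun setT f -> (forall x, 0 <= f x) -> bm (fun x => Num.min (f x) n%:R).
Proof.
move=> mf f0; split; first exact: measurable_minr.
exists n%:R => x; rewrite ger0_norm ?ge_min ?lexx ?orbT//.
by rewrite le_min f0 ler0n.
Qed.

(** Duality by hand: the truncation [k] of the average [h] is tested through [k^(r-1)]. As
    [(r - 1) q = r], this gives [A <= A^(1/q) N^(1/p)] with [A] the integral of [k^r]. Truncation
    makes [A] finite, so one may divide by [A^(1/q)] before letting the level grow. *)
Lemma OU_norm_le d (mu : probability (d.-tuple R) R) (a p r : R) (f : d.-tuple R -> R) :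
  is_std_gaussian mu -> 1 < p -> p < r -> a = Num.sqrt (p - 1) / Num.sqrt (r - 1) ->
  measurable_fun setT f -> (forall x, 0 <= f x) ->
  (\int[mu]_x (f x `^ p)%:E < +oo)%E ->
  (\int[mu]_x ((\int[mu]_y f (comb a (Num.sqrt (1 - a ^+ 2)) x y)) `^ r)%:E <=
    ((\int[mu]_x (f x `^ p)) `^ (r / p))%:E)%E.
Proof.
move=> gmu p1 pr aE mf f0 fp.
have r1 : 1 < r by exact: lt_trans pr.
have p0 : 0 < p by exact: lt_trans p1.
have r0 : 0 < r by exact: lt_trans r1.
have rm0 : 0 < r - 1 by rewrite subr_gt0.
have pm0 : 0 < p - 1 by rewrite subr_gt0.
have a2 : a ^+ 2 = (p - 1) / (r - 1) by rewrite aE expr_div_n !sqr_sqrtr ?ltW.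
have a0 : 0 <= a by rewrite aE divr_ge0 ?sqrtr_ge0.
have a01 : 0 <= a < 1.
  rewrite a0/= -(@ltr_pXn2r _ 2) ?nnegrE// expr1n a2 ltr_pdivrMr// mul1r.
  by rewrite ltrD2r.
(* [q] is conjugate to [r], and [(q - 1) (p - 1) = (p - 1) / (r - 1) = a^2] is the borderline case
   of the condition on the correlation. *)
set b := Num.sqrt _; pose q := r / (r - 1).
have q1 : 1 < q by rewrite /q ltr_pdivlMr// mul1r gtrBl.
have apq : a ^+ 2 <= (q - 1) * (p - 1).
  rewrite a2 le_eqVlt; apply/orP; left; apply/eqP; rewrite /q; field.
  by rewrite gt_eqF.
set h := fun x => \int[mu]_y f (comb a b x y).
set N := \int[mu]_x (f x `^ p).
have h0 x : 0 <= h x by apply: Rintegral_ge0.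
have mcomb := @measurable_comb R d a b.
have mfc : measurable_fun setT (fun z : d.-tuple R * d.-tuple R => f (comb a b z.1 z.2)).
  exact: (measurableT_comp mf mcomb).
have mh : measurable_fun setT h.
  apply: measurableT_comp => //.
  apply: (measurable_fun_fubini_tonelli_F (fun z => (f (comb a b z.1 z.2))%:E)) => //.
    exact/measurable_EFinP.
  by move=> z; rewrite lee_fin.
have mfp : measurable_fun setT (fun x => f x `^ p).
  exact: (@measurableT_comp _ _ _ _ _ _ (@powR R ^~ p) _ f).
have ifp : mu.-integrable setT (EFin \o (fun x => f x `^ p)).
  apply/integrableP; split; first exact/measurable_EFinP.
  by under eq_integral do rewrite /= ger0_norm ?powR_ge0//.
have N0 : 0 <= N by apply: Rintegral_ge0 => x _; exact: powR_ge0.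
have weak (g : d.-tuple R -> R) : bm g -> (forall x, 0 <= g x) ->
    (\int[mu]_x (g x * h x)%:E <= ((\int[mu]_x (g x `^ q)) `^ q^-1 * N `^ p^-1)%:E)%E.
  move=> bg g0; set B := (X in (_ <= X)%E).
  pose F z := g z.1 * f (comb a b z.1 z.2).
  have step1 : (\int[mu \x mu]_z (F z)%:E <= B)%E.
    apply: (@ge0_integral_eventually _ _ _ (fun n z => g z.1 * Num.min (f (comb a b z.1 z.2)) n%:R)).
    - move=> n; apply: measurable_funM; last exact: measurable_minr.
      exact: (measurableT_comp (bm_meas bg) measurable_fst).
    - by move=> n z; rewrite mulr_ge0// le_min f0 ler0n.
    - move=> z m n mn; rewrite ler_wpM2l// le_min ge_min lexx/= ge_min.
      by rewrite ler_nat mn orbT.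
    - move=> z; have [M MP] := min_eventually (f (comb a b z.1 z.2)).
      by exists M => n Mn; rewrite MP.
    - move=> n; have bfn := bm_min n mf f0.
      have bfc : bm (fun z : d.-tuple R * d.-tuple R => g z.1 * Num.min (f (comb a b z.1 z.2)) n%:R).
        apply: bmM; first exact: (bm_comp bg measurable_fst).
        exact: (bm_comp bfn mcomb).
      rewrite -bm_EFin// (Rint_prod mu mu bfc)/= lee_fin.
      have fn0 x : 0 <= Num.min (f x) n%:R by rewrite le_min f0 ler0n.
      have := hypercontractive_tuple gmu a01 q1 p1 apq bg bfn g0 fn0.
      move=> H; apply: (@le_trans _ _ (\int[mu]_x (g x * \int[mu]_y Num.min (f (comb a b x y)) n%:R))).
        rewrite le_eqVlt; apply/orP; left; apply/eqP; apply: eq_Rintegral => x _.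
        rewrite RintZ//; apply: bm_int.
        exact: (bm_slice2 x (bm_comp bfn mcomb)).
      apply: (le_trans H); apply: ler_wpM2l; first exact: powR_ge0.
      apply: ge0_ler_powR.
      + by rewrite invr_ge0 ltW.
      + by rewrite nnegrE; apply: Rintegral_ge0 => x _; exact: powR_ge0.
      + by rewrite nnegrE.
      + apply: Rint_le.
        * by apply: bm_int; apply: bm_powR => //; exact: ltW.
        * exact: ifp.
        * move=> x; apply: ge0_ler_powR; rewrite ?nnegrE ?(ltW p0)//.
          by rewrite ge_min lexx.
  apply: le_trans step1.
  have mF : measurable_fun setT (fun z => (F z)%:E).
    apply/measurable_EFinP; apply: measurable_funM => //.
    exact: (measurableT_comp (bm_meas bg) measurable_fst).
  rewrite (fubini_tonelli1 (fun z => (F z)%:E))//; last first.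
    by move=> z; rewrite lee_fin mulr_ge0.
  apply: ge0_le_integral => //.
  - by move=> x _; rewrite lee_fin mulr_ge0.
  - apply/measurable_EFinP; exact: (measurable_funM (bm_meas bg) mh).
  - apply: (measurable_fun_fubini_tonelli_F (fun z => (F z)%:E)) => //.
    by move=> z; rewrite lee_fin mulr_ge0.
  - move=> x _; rewrite /fubini_F /F /=.
    rewrite (_ : \int[mu]_y (g x * f (comb a b x y))%:E =
      (g x)%:E * \int[mu]_y (f (comb a b x y))%:E)%E; last first.
      rewrite -ge0_integralZl_EFin//.
        by move=> y _; rewrite lee_fin.
      by apply/measurable_EFinP; exact: (measurableT_comp mfc (pair1_measurable x)).
    (* [h x] is a [fine] value: it is 0 where the inner integral is infinite, and so never exceeds
       that integral. *)
    rewrite EFinM lee_wpmul2l ?lee_fin// /h /Rintegral.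
    have : (0 <= \int[mu]_y (f (comb a b x y))%:E)%E.
      by apply: integral_ge0 => y _; rewrite lee_fin.
    by case: (\int[mu]_y _)%E => //= _; exact: leey.
apply: (@ge0_integral_eventually _ _ _ (fun n x => (Num.min (h x) n%:R) `^ r)).
- move=> n; apply: (@measurableT_comp _ _ _ _ _ _ (@powR R ^~ r) _ (fun x => Num.min (h x) n%:R)) => //.
  exact: measurable_minr.
- by move=> n x; exact: powR_ge0.
- move=> x m n mn; apply: ge0_ler_powR; rewrite ?nnegrE ?(ltW r0)// ?le_min ?h0 ?ler0n//.
  by rewrite ge_min lexx/= ge_min ler_nat mn orbT.
- move=> x; have [M MP] := min_eventually (h x).
  by exists M => n Mn; rewrite MP.
move=> n; have bk := bm_min n mh h0; set k := fun x => Num.min (h x) n%:R.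
have k0 x : 0 <= k x by rewrite le_min h0 ler0n.
have bkr : bm (fun x => k x `^ (r - 1)) by apply: bm_powR => //; exact: ltW.
have bkR : bm (fun x => k x `^ r) by apply: bm_powR => //; exact: ltW.
have := weak _ bkr (fun x => powR_ge0 _ _).
have [A AE] : exists A : R, A = \int[mu]_x (k x `^ r) by exact: (ex_intro _ _ erefl).
have -> : \int[mu]_x ((k x `^ (r - 1)) `^ q) = A.
  rewrite AE; apply: eq_Rintegral => x _; rewrite -powRrM; congr (_ `^ _).
  by rewrite /q; field; rewrite gt_eqF.
move=> H; have A0 : 0 <= A by rewrite AE; apply: Rintegral_ge0 => x _; exact: powR_ge0.
have AH : A <= A `^ q^-1 * N `^ p^-1.
  rewrite -lee_fin; apply: le_trans H; rewrite AE (bm_EFin mu bkR).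
  apply: ge0_le_integral => //.
  - by move=> x _; rewrite lee_fin powR_ge0.
  - by apply/measurable_EFinP; exact: bm_meas.
  - apply/measurable_EFinP; exact: (measurable_funM (bm_meas bkr) mh).
  - move=> x _; rewrite lee_fin -(mulr_powRB1 (k0 x) r0) mulrC.
    by rewrite ler_wpM2l ?powR_ge0// ge_min lexx.
rewrite -(bm_EFin mu bkR) lee_fin -AE.
have [->|An0] := eqVneq A 0; first exact: powR_ge0.
have {}A0 : 0 < A by rewrite lt_neqAle eq_sym An0.
have Aq : A `^ r^-1 <= N `^ p^-1.
  have Aq0 : 0 < A `^ q^-1 by exact: powR_gt0.
  rewrite -(ler_pM2l Aq0); apply: le_trans AH.
  have qr : q^-1 + r^-1 = 1 by rewrite /q; field; rewrite !gt_eqF.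
  by rewrite -powRD ?An0 ?implybT// qr powRr1// ltW.
have : (A `^ r^-1) `^ r <= (N `^ p^-1) `^ r.
  by apply: ge0_ler_powR; rewrite ?nnegrE ?powR_ge0// ltW.
by rewrite -!powRrM (mulVf (lt0r_neq0 r0)) (powRr1 (ltW A0)) (mulrC p^-1).
Qed.
End tensorization.

(** * Complex integrals and the rotated product *)

Section complex_integral.
Context {d} {T : measurableType d} {R : realType}.
Local Notation C := (complex R).
Local Notation normc := Normc.normc.
Implicit Types (f g : T -> C) (z w : C).

Lemma complex_ReD z w : complex.Re (z + w) = complex.Re z + complex.Re w.
Proof. by case: z; case: w. Qed.

Lemma complex_ImD z w : complex.Im (z + w) = complex.Im z + complex.Im w.
Proof. by case: z; case: w. Qed.

Lemma complex_ReN z : complex.Re (- z) = - complex.Re z.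
Proof. by case: z. Qed.

Lemma complex_ImN z : complex.Im (- z) = - complex.Im z.
Proof. by case: z. Qed.

Lemma complex_ReM z w :
  complex.Re (z * w) = complex.Re z * complex.Re w - complex.Im z * complex.Im w.
Proof. by case: z; case: w. Qed.

Lemma complex_ImM z w :
  complex.Im (z * w) = complex.Re z * complex.Im w + complex.Im z * complex.Re w.
Proof. by case: z; case: w. Qed.

Lemma complex_eq z w :
  complex.Re z = complex.Re w -> complex.Im z = complex.Im w -> z = w.
Proof. by case: z; case: w => /= ? ? ? ? -> ->. Qed.

Lemma normc_sqrt z : normc z = Num.sqrt (complex.Re z ^+ 2 + complex.Im z ^+ 2).
Proof. by case: z. Qed.

Lemma normc_ge0 z : 0 <= normc z.
Proof. by rewrite normc_sqrt sqrtr_ge0. Qed.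

Lemma normRe_le z : `|complex.Re z| <= normc z.
Proof. by rewrite normc_sqrt -sqrtr_sqr ler_wsqrtr// lerDl sqr_ge0. Qed.

Lemma normIm_le z : `|complex.Im z| <= normc z.
Proof. by rewrite normc_sqrt -sqrtr_sqr ler_wsqrtr// lerDr sqr_ge0. Qed.

Lemma normc_conj z : normc (z^*)%C = normc z.
Proof. by case: z => x y /=; rewrite sqrrN. Qed.

Lemma normc_leD z : normc z <= `|complex.Re z| + `|complex.Im z|.
Proof.
rewrite -[leRHS]ger0_norm ?addr_ge0// -sqrtr_sqr normc_sqrt ler_wsqrtr//.
rewrite sqrrD -!normrX !(ger0_norm (sqr_ge0 _)) -addrA lerD2l lerDr.
by rewrite mulrn_wge0// mulr_ge0.
Qed.

Definition cmeas f := measurable_fun setT (fun x => complex.Re (f x)) /\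
  measurable_fun setT (fun x => complex.Im (f x)).

Lemma cmeas_cst z : cmeas (fun=> z).
Proof. by split; exact: measurable_cst. Qed.

Lemma cmeasD f g : cmeas f -> cmeas g -> cmeas (fun x => f x + g x).
Proof.
move=> [f1 f2] [g1 g2]; split.
- by under eq_fun do rewrite complex_ReD; exact: measurable_funD.
- by under eq_fun do rewrite complex_ImD; exact: measurable_funD.
Qed.

Lemma cmeasN f : cmeas f -> cmeas (fun x => - f x).
Proof.
move=> [f1 f2]; split.
- by under eq_fun do rewrite complex_ReN; exact: measurableT_comp.
- by under eq_fun do rewrite complex_ImN; exact: measurableT_comp.
Qed.

Lemma cmeasB f g : cmeas f -> cmeas g -> cmeas (fun x => f x - g x).
Proof. by move=> cf cg; apply: cmeasD => //; exact: cmeasN. Qed.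

Lemma cmeasM f g : cmeas f -> cmeas g -> cmeas (fun x => f x * g x).
Proof.
move=> [f1 f2] [g1 g2]; split.
- under eq_fun do rewrite complex_ReM.
  by apply: measurable_funB; exact: measurable_funM.
- under eq_fun do rewrite complex_ImM.
  by apply: measurable_funD; exact: measurable_funM.
Qed.

Lemma measurable_normc f : cmeas f -> measurable_fun setT (fun x => normc (f x)).
Proof.
move=> [f1 f2]; under eq_fun do rewrite normc_sqrt.
apply: (@measurableT_comp _ _ _ _ _ _ (@Num.sqrt R) _
  (fun x => complex.Re (f x) ^+ 2 + complex.Im (f x) ^+ 2)).
  by apply: continuous_measurable_fun; exact: sqrt_continuous.
by apply: measurable_funD; exact: measurable_funX.
Qed.

Variable P : probability T R.

Definition cint f : C :=
  Complex (\int[P]_x complex.Re (f x)) (\int[P]_x complex.Im (f x)).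

Definition cintegrable f := P.-integrable setT (EFin \o (fun x => complex.Re (f x))) /\
  P.-integrable setT (EFin \o (fun x => complex.Im (f x))).

Lemma cintegrable_normc f : cmeas f -> (\int[P]_x (normc (f x))%:E < +oo)%E -> cintegrable f.
Proof.
move=> cf fP; have [f1 f2] := cf.
have mn := measurable_normc cf.
have In : P.-integrable setT (EFin \o (fun x => normc (f x))).
  apply/integrableP; split; first exact/measurable_EFinP.
  by under eq_integral do rewrite /= ger0_norm ?normc_ge0//.
by split; apply: le_integrable In => //; try exact/measurable_EFinP;
  move=> x _ /=; rewrite lee_fin (ger0_norm (normc_ge0 _)) ?normRe_le ?normIm_le.
Qed.

Lemma integrable_cmeas f : cintegrable f -> cmeas f.
Proof. by move=> [/measurable_int/measurable_EFinP ? /measurable_int/measurable_EFinP ?]. Qed.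

Lemma normc_integrable f : cintegrable f -> P.-integrable setT (EFin \o (fun x => normc (f x))).
Proof.
move=> cf; have [f1 f2] := cf; have mf := integrable_cmeas cf.
apply: (le_integrable measurableT _ _ (integrableD measurableT
  (integrable_abse f1) (integrable_abse f2))).
  exact/measurable_EFinP/measurable_normc.
move=> x _ /=; rewrite lee_fin (ger0_norm (normc_ge0 _)).
by rewrite (le_trans (normc_leD _))// ler_norm.
Qed.

Lemma normc_integral_lty f : cintegrable f -> (\int[P]_x (normc (f x))%:E < +oo)%E.
Proof.
move=> /normc_integrable/integrableP[_].
by under eq_integral do rewrite /= ger0_norm ?normc_ge0//.
Qed.

Lemma cintegrableD f g : cintegrable f -> cintegrable g -> cintegrable (fun x => f x + g x).
Proof.
move=> [f1 f2] [g1 g2]; split.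
- by under [X in EFin \o X]eq_fun do rewrite complex_ReD; exact: integrableDR.
- by under [X in EFin \o X]eq_fun do rewrite complex_ImD; exact: integrableDR.
Qed.

Lemma cintegrableZ z f : cintegrable f -> cintegrable (fun x => z * f x).
Proof.
move=> [f1 f2]; split.
- under [X in EFin \o X]eq_fun do rewrite complex_ReM -mulNr.
  by apply: integrableDR; exact: integrableZR.
- under [X in EFin \o X]eq_fun do rewrite complex_ImM.
  by apply: integrableDR; exact: integrableZR.
Qed.

Lemma cintD f g : cintegrable f -> cintegrable g ->
  cint (fun x => f x + g x) = cint f + cint g.
Proof.
move=> [f1 f2] [g1 g2]; apply: complex_eq.
- by rewrite complex_ReD/= -RintD//; apply: eq_Rintegral => x _; rewrite complex_ReD.
- by rewrite complex_ImD/= -RintD//; apply: eq_Rintegral => x _; rewrite complex_ImD.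
Qed.

Lemma cintZ z f : cintegrable f -> cint (fun x => z * f x) = z * cint f.
Proof.
move=> [f1 f2]; apply: complex_eq.
- rewrite complex_ReM/= -mulNr -!RintZ// -RintD; try exact: integrableZR.
  by apply: eq_Rintegral => x _; rewrite complex_ReM mulNr.
- rewrite complex_ImM/= -!RintZ// -RintD; try exact: integrableZR.
  by apply: eq_Rintegral => x _; rewrite complex_ImM.
Qed.

Lemma cint_cst z : cint (fun=> z) = z.
Proof. by case: z => x y; rewrite /cint/= !Rint_cst. Qed.

Lemma cintegrable_cst z : cintegrable (fun=> z).
Proof. by split; apply: bm_int; exact: bm_cst. Qed.

Lemma cintegrableB f g : cintegrable f -> cintegrable g -> cintegrable (fun x => f x - g x).
Proof.
move=> cf cg; under eq_fun do rewrite -[- g _]mulN1r.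
by apply: cintegrableD => //; exact: cintegrableZ.
Qed.

Lemma cintB f g : cintegrable f -> cintegrable g ->
  cint (fun x => f x - g x) = cint f - cint g.
Proof.
move=> cf cg; under eq_fun do rewrite -[- g _]mulN1r.
by rewrite cintD ?cintZ ?mulN1r//; exact: cintegrableZ.
Qed.

(* With [I] the integral, [|I|^2 = Re (int (conj I * f)) <= |I| int |f|]. *)
Lemma normc_cint f : cmeas f -> ((normc (cint f))%:E <= \int[P]_x (normc (f x))%:E)%E.
Proof.
move=> mf; have [fP|] := ltP (\int[P]_x (normc (f x))%:E)%E +oo%E; last first.
  by move=> /(le_trans (leey _)).
have cf := cintegrable_normc mf fP; have nf := normc_integrable cf.
have -> : (\int[P]_x (normc (f x))%:E)%E = (\int[P]_x (normc (f x)))%:E.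
  by rewrite fineK//; exact: integrable_fin_num.
set N := normc _; rewrite lee_fin.
have [->|N0] := eqVneq N 0; first by apply: Rintegral_ge0 => x _; exact: normc_ge0.
have {}N0 : 0 < N by rewrite lt_neqAle eq_sym N0 normc_ge0.
rewrite -(ler_pM2l N0) -RintZ//.
have -> : N * N = complex.Re (cint (fun x => ((cint f)^*)%C * f x)).
  rewrite cintZ// complex_ReM -expr2 /N normc_sqrt sqr_sqrtr ?addr_ge0 ?sqr_ge0//.
  by case: (cint f) => x y /=; rewrite mulNr opprK.
apply: Rint_le.
- by have [] := cintegrableZ (((cint f)^*)%C) cf.
- exact: integrableZR.
move=> x; apply: (le_trans (ler_norm _)); apply: (le_trans (normRe_le _)).
by rewrite Normc.normcM normc_conj.
Qed.

Lemma cint_ae f g : cmeas f -> cmeas g -> {ae P, forall x, f x = g x} -> cint f = cint g.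
Proof.
move=> [f1 f2] [g1 g2] fg; congr (Complex (fine _) (fine _)).
- apply: ae_eq_integral => //; try exact/measurable_EFinP.
  by apply: filterS fg => x -> _.
- apply: ae_eq_integral => //; try exact/measurable_EFinP.
  by apply: filterS fg => x -> _.
Qed.

Lemma cint_normc0_ae f : cmeas f ->
  (\int[P]_x (normc (f x))%:E = 0)%E -> {ae P, forall x, f x = 0}.
Proof.
move=> mf f0.
have : ae_eq P setT (fun x => (normc (f x))%:E) (cst 0%E).
  apply/ae_eq_integral_abs => //; first exact/measurable_EFinP/measurable_normc.
  by under eq_integral do rewrite /= ger0_norm ?normc_ge0//.
by apply: filterS => x /(_ I) [] /Normc.eq0_normc.
Qed.

End complex_integral.

Lemma cmeas_comp {d d'} {T : measurableType d} {U : measurableType d'} {R : realType}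
    (f : U -> complex R) (g : T -> U) :
  cmeas f -> measurable_fun setT g -> cmeas (fun x => f (g x)).
Proof.
by move=> [f1 f2] mg; split; [exact: (measurableT_comp f1 mg)|exact: (measurableT_comp f2 mg)].
Qed.

(** * The rotated product and its [L^1] estimates *)

Section rotated_product.
Context {R : realType} {d : nat}.
Local Notation X := (d.-tuple R).
Local Notation C := (complex R).
Local Notation normc := Normc.normc.
Variables (mu : probability X R) (a b : R).
Hypotheses (gmu : is_std_gaussian mu) (ab : a ^+ 2 + b ^+ 2 = 1).
Implicit Types (f g : X -> C).

Definition rot_ker f g (z : X * X) : C := f (comb a b z.1 z.2) * g (comb b (- a) z.1 z.2).

Definition rot_prod f g (x : X) : C := cint mu (fun y => rot_ker f g (x, y)).

Lemma cmeas_rot_ker f g : cmeas f -> cmeas g -> cmeas (rot_ker f g).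
Proof. by move=> cf cg; apply: cmeasM; exact: cmeas_comp (measurable_comb _ _). Qed.

Lemma prod_L1 f g : cmeas f -> cmeas g ->
  (\int[mu \x mu]_z (normc (f z.1 * g z.2))%:E =
   \int[mu]_x (normc (f x))%:E * \int[mu]_x (normc (g x))%:E)%E.
Proof.
move=> cf cg; pose F (z : X * X) := (normc (f z.1 * g z.2))%:E.
have mF : measurable_fun setT F.
  apply/measurable_EFinP/measurable_normc/cmeasM.
    exact: cmeas_comp cf measurable_fst.
  exact: cmeas_comp cg measurable_snd.
rewrite (fubini_tonelli1 F)//; last by move=> z; rewrite lee_fin normc_ge0.
transitivity (\int[mu]_x ((normc (f x))%:E * \int[mu]_y (normc (g y))%:E))%E.
  apply: eq_integral => x _; rewrite /fubini_F /F /=.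
  under eq_integral do rewrite Normc.normcM EFinM.
  rewrite ge0_integralZl_EFin ?normc_ge0//.
    by move=> y _; rewrite lee_fin normc_ge0.
  exact/measurable_EFinP/measurable_normc.
rewrite ge0_integralZr//.
- exact/measurable_EFinP/measurable_normc.
- by move=> x _; rewrite lee_fin normc_ge0.
- by apply: integral_ge0 => x _; rewrite lee_fin normc_ge0.
Qed.

Lemma rot_ker_L1 f g : cmeas f -> cmeas g ->
  (\int[mu \x mu]_z (normc (rot_ker f g z))%:E =
   \int[mu]_x (normc (f x))%:E * \int[mu]_x (normc (g x))%:E)%E.
Proof.
move=> cf cg; rewrite -prod_L1//.
apply: (tuple_rot gmu ab (F := fun z => (normc (f z.1 * g z.2))%:E)).
apply/measurable_EFinP/measurable_normc/cmeasM.
  exact: cmeas_comp cf measurable_fst.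
exact: cmeas_comp cg measurable_snd.
Qed.

Local Notation L1 f := (\int[mu]_x (normc (f x))%:E < +oo)%E.

Lemma L1_ge0 f : (0 <= \int[mu]_x (normc (f x))%:E)%E.
Proof. by apply: integral_ge0 => x _; rewrite lee_fin normc_ge0. Qed.

Lemma L1_mul f g : L1 f -> L1 g ->
  (\int[mu]_x (normc (f x))%:E * \int[mu]_x (normc (g x))%:E < +oo)%E.
Proof.
move=> lf lg; rewrite lte_mul_pinfty ?L1_ge0// fin_real// lf.
by rewrite (lt_le_trans _ (L1_ge0 _)).
Qed.

Lemma prod_integrable f g : cintegrable mu f -> cintegrable mu g ->
  cintegrable (mu \x mu)%E (fun z => f z.1 * g z.2).
Proof.
move=> If Ig; have [cf cg] := (integrable_cmeas If, integrable_cmeas Ig).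
apply: cintegrable_normc.
  apply: cmeasM; first exact: cmeas_comp cf measurable_fst.
  exact: cmeas_comp cg measurable_snd.
rewrite prod_L1//; apply: L1_mul; exact: normc_integral_lty.
Qed.

Lemma rot_ker_integrable f g : cmeas f -> cmeas g -> L1 f -> L1 g ->
  cintegrable (mu \x mu)%E (rot_ker f g).
Proof.
move=> cf cg lf lg; apply: cintegrable_normc; first exact: cmeas_rot_ker.
by rewrite rot_ker_L1//; exact: L1_mul.
Qed.

Lemma cmeas_rot_prod f g : cmeas f -> cmeas g -> L1 f -> L1 g -> cmeas (rot_prod f g).
Proof.
move=> cf cg lf lg; have [i1 i2] := rot_ker_integrable cf cg lf lg.
by split; apply: measurableT_comp => //; [exact: measurable_fubini_F i1|exact: measurable_fubini_F i2].
Qed.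

Lemma cmeas_rot_ker_slice f g x : cmeas f -> cmeas g -> cmeas (fun y => rot_ker f g (x, y)).
Proof.
move=> cf cg; apply: (cmeas_comp (cmeas_rot_ker cf cg)); exact: pair1_measurable.
Qed.

Lemma rot_prod_L1 f g : cmeas f -> cmeas g -> L1 f -> L1 g ->
  (\int[mu]_x (normc (rot_prod f g x))%:E <=
   \int[mu]_x (normc (f x))%:E * \int[mu]_x (normc (g x))%:E)%E.
Proof.
move=> cf cg lf lg; rewrite -rot_ker_L1//.
have mk : measurable_fun setT (fun z => (normc (rot_ker f g z))%:E).
  exact/measurable_EFinP/measurable_normc/cmeas_rot_ker.
have k0 z : (0 <= (normc (rot_ker f g z))%:E)%E by rewrite lee_fin normc_ge0.
rewrite (fubini_tonelli1 (fun z => (normc (rot_ker f g z))%:E))//.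
apply: ge0_le_integral => //.
- by move=> x _; rewrite lee_fin normc_ge0.
- exact/measurable_EFinP/measurable_normc/cmeas_rot_prod.
- exact: measurable_fun_fubini_tonelli_F.
- move=> x _; apply: normc_cint; exact: cmeas_rot_ker_slice.
Qed.

(** [cint] is additive on integrable functions, and the slices of an integrable kernel are
    integrable for almost every [x]. Bilinearity of [rot_prod] on [L^1] is therefore obtained almost
    everywhere. *)
Lemma rot_ker_ae_integrable f g : cmeas f -> cmeas g -> L1 f -> L1 g ->
  {ae mu, forall x, cintegrable mu (fun y => rot_ker f g (x, y))}.
Proof.
move=> cf cg lf lg; have [/ae_integrable1 i1 /ae_integrable1 i2] := rot_ker_integrable cf cg lf lg.
by near=> x; split; near: x.
Unshelve. all: by end_near.
Qed.

Lemma L1B f g : cmeas f -> cmeas g -> L1 f -> L1 g -> L1 (fun x => f x - g x).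
Proof.
move=> cf cg lf lg.
have If := cintegrable_normc cf lf; have Ig := cintegrable_normc cg lg.
exact: normc_integral_lty (cintegrableB If Ig).
Qed.

(** The difference is split as [(f' - f) g' + f (g' - g)], and each piece is controlled by
    [rot_prod_L1]. *)
Lemma rot_prod_L1B f g f' g' :
  cmeas f -> cmeas g -> cmeas f' -> cmeas g' -> L1 f -> L1 g -> L1 f' -> L1 g' ->
  (\int[mu]_x (normc (rot_prod f' g' x - rot_prod f g x))%:E <=
   \int[mu]_x (normc (f' x - f x))%:E * \int[mu]_x (normc (g' x))%:E +
   \int[mu]_x (normc (f x))%:E * \int[mu]_x (normc (g' x - g x))%:E)%E.
Proof.
move=> cf cg cf' cg' lf lg lf' lg'.
have cdf := cmeasB cf' cf; have cdg := cmeasB cg' cg.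
have ldf := L1B cf' cf lf' lf; have ldg := L1B cg' cg lg' lg.
have H1 := rot_prod_L1 cdf cg' ldf lg'; have H2 := rot_prod_L1 cf cdg lf ldg.
apply: le_trans (leeD H1 H2).
have m1 := measurable_normc (cmeas_rot_prod cdf cg' ldf lg').
have m2 := measurable_normc (cmeas_rot_prod cf cdg lf ldg).
rewrite -ge0_integralD//; [|by move=> x _; rewrite lee_fin normc_ge0|exact/measurable_EFinP
  |by move=> x _; rewrite lee_fin normc_ge0|exact/measurable_EFinP].
apply: ae_ge0_le_integral => //.
- by move=> x _; rewrite lee_fin normc_ge0.
- apply/measurable_EFinP/measurable_normc/cmeasB; exact: cmeas_rot_prod.
- by move=> x _; rewrite -EFinD lee_fin addr_ge0 ?normc_ge0.
- by apply: emeasurable_funD; exact/measurable_EFinP.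
have I1 := rot_ker_ae_integrable cf' cg' lf' lg'.
have I2 := rot_ker_ae_integrable cf cg lf lg.
have I3 := rot_ker_ae_integrable cdf cg' ldf lg'.
have I4 := rot_ker_ae_integrable cf cdg lf ldg.
near=> x; move=> _; rewrite -EFinD lee_fin.
rewrite (_ : rot_prod f' g' x - rot_prod f g x =
  rot_prod (fun x => f' x - f x) g' x + rot_prod f (fun x => g' x - g x) x).
  exact: (@le_normcD R).
rewrite /rot_prod -cintB -?cintD; first by congr cint; apply/funext => y; rewrite /rot_ker; ring.
all: by near: x.
Unshelve. all: by end_near.
Qed.

Lemma normc_rot_prod_le f g (K : R) x : cmeas f -> cmeas g ->
  (forall y, normc (g y) <= K) ->
  ((normc (rot_prod f g x))%:E <= K%:E * \int[mu]_y (normc (f (comb a b x y)))%:E)%E.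
Proof.
move=> cf cg gK; have K0 : 0 <= K by exact: le_trans (normc_ge0 _) (gK x).
have cfx : cmeas (fun y => f (comb a b x y)).
  by apply: (cmeas_comp cf); exact: (measurableT_comp (measurable_comb a b) (pair1_measurable x)).
have mfx := measurable_normc cfx.
rewrite -ge0_integralZl_EFin//; last 2 first.
- by move=> y _; rewrite lee_fin normc_ge0.
- exact/measurable_EFinP.
apply: (le_trans (normc_cint mu (cmeas_rot_ker_slice x cf cg))).
apply: ge0_le_integral => //.
- by move=> y _; rewrite lee_fin normc_ge0.
- exact/measurable_EFinP/measurable_normc/cmeas_rot_ker_slice.
- by apply: emeasurable_funM; [exact: measurable_cst|exact/measurable_EFinP].
- by move=> y _; rewrite -EFinM lee_fin /rot_ker Normc.normcM mulrC ler_wpM2r ?normc_ge0.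
Qed.

End rotated_product.

(** * Polynomials and chaos decomposition *)

Section polynomials.
Context {R : realType} {d : nat}.
Local Notation X := (d.-tuple R).
Local Notation C := (complex R).
Local Notation mono k := (fun x : X => ((monomial k x)%:C)%C : C).
Implicit Types (f g : X -> C).

(** The bound is strict: [lowF n.+1] is convertible to [polyF n], while [lowF 0] contains only zero.
    So [G_n] is the orthogonal complement of [lowF n] in [lowF n.+1] for every [n], including 0. *)
Definition lowF (n : nat) f : Prop :=
  exists s : seq (d.-tuple nat * C), all (fun a => mdeg a.1 < n)%N s /\
    f = fun x => \sum_(a <- s) a.2 * mono a.1 x.

Lemma lowF0 n : lowF n (fun=> 0).
Proof. by exists [::]; split => //; apply/funext => x; rewrite big_nil. Qed.

Lemma lowF_cons n c k g : (mdeg k < n)%N -> lowF n g -> lowF n (fun x => c * mono k x + g x).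
Proof.
move=> kn [s [sn ->]]; exists ((k, c) :: s); split; first by rewrite /= kn.
by apply/funext => x; rewrite big_cons.
Qed.

Lemma lowF_rect (Pr : (X -> C) -> Prop) n : Pr (fun=> 0) ->
  (forall c k g, (mdeg k < n)%N -> lowF n g -> Pr g -> Pr (fun x => c * mono k x + g x)) ->
  forall f, lowF n f -> Pr f.
Proof.
move=> P0 PS f [s [sn ->]]; elim: s sn => [_|[k c] s IH /= /andP[kn sn]].
  by rewrite (_ : (fun x => _) = fun=> 0)//; apply/funext => x; rewrite big_nil.
rewrite (_ : (fun x => _) = fun x => c * mono k x + \sum_(a <- s) a.2 * mono a.1 x).
  by apply: PS => //; [exists s|exact: IH].
by apply/funext => x; rewrite big_cons.
Qed.

Lemma lowF_0 f : lowF 0 f -> f = fun=> 0.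
Proof. by apply: (@lowF_rect (fun f => f = fun=> 0)). Qed.

Lemma lowF_le m n f : (m <= n)%N -> lowF m f -> lowF n f.
Proof.
move=> mn [s [sn ->]]; exists s; split => //; apply: sub_all sn => k /= km.
exact: leq_trans km mn.
Qed.

Lemma lowFD n f g : lowF n f -> lowF n g -> lowF n (fun x => f x + g x).
Proof.
move=> lf lg; elim/lowF_rect: lf => [|c k h kn lh lhg].
  by under eq_fun do rewrite add0r.
by under eq_fun do rewrite -addrA; exact: lowF_cons.
Qed.

Lemma lowFZ n c f : lowF n f -> lowF n (fun x => c * f x).
Proof.
elim/lowF_rect => [|z k h kn lh lhg].
  by under eq_fun do rewrite mulr0; exact: lowF0.
by under eq_fun do rewrite mulrDr mulrA; exact: lowF_cons.
Qed.

Lemma lowFN n f : lowF n f -> lowF n (fun x => - f x).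
Proof. by move=> /(@lowFZ _ (-1)); under eq_fun do rewrite mulN1r. Qed.

Lemma lowFB n f g : lowF n f -> lowF n g -> lowF n (fun x => f x - g x).
Proof. by move=> lf lg; apply: lowFD => //; exact: lowFN. Qed.

Lemma lowF_mono n k : (mdeg k < n)%N -> lowF n (mono k).
Proof.
move=> kn; rewrite (_ : (fun x => _) = fun x => 1 * mono k x + 0).
  by apply: lowF_cons => //; exact: lowF0.
by apply/funext => x; rewrite mul1r addr0.
Qed.

Lemma lowF_sum n (I : Type) (r : seq I) (F : I -> X -> C) :
  (forall i, lowF n (F i)) -> lowF n (fun x => \sum_(i <- r) F i x).
Proof.
move=> lF; elim: r => [|i r IH].
  by under eq_fun do rewrite big_nil; exact: lowF0.
by under eq_fun do rewrite big_cons; exact: lowFD.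
Qed.

Lemma lowF_conj n f : lowF n f -> lowF n (fun x => ((f x)^*)%C).
Proof.
elim/lowF_rect => [|z k h kn lh lhg].
  by rewrite (_ : (fun x => _) = fun=> 0); [exact: lowF0|apply/funext => x; rewrite rmorph0].
rewrite (_ : (fun x => _) = fun x => (z^*)%C * mono k x + ((h x)^*)%C); first exact: lowF_cons.
apply/funext => x; rewrite rmorphD rmorphM; congr (_ * _ + _).
by rewrite /= oppr0.
Qed.

Lemma lowF_cst n c : lowF n.+1 (fun=> c).
Proof.
pose k : d.-tuple nat := [tuple 0%N | i < d].
rewrite (_ : (fun _ => c) = fun x => c * mono k x); last first.
  apply/funext => x; rewrite [monomial _ _]big1 ?mulr1// => i _.
  by rewrite tnth_mktuple expr0.
apply/lowFZ/lowF_mono; rewrite /mdeg big1// => i _; by rewrite tnth_mktuple.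
Qed.

Lemma lowF_coord i : lowF 2 (fun x => ((tnth x i)%:C)%C).
Proof.
pose k : d.-tuple nat := [tuple (j == i) : nat | j < d].
rewrite (_ : (fun _ => _) = mono k).
  apply: lowF_mono; rewrite /mdeg (bigD1 i)//= tnth_mktuple eqxx big1// => j /negbTE ji.
  by rewrite tnth_mktuple ji.
apply/funext => x; congr (_%:C)%C; rewrite /monomial (bigD1 i)//= tnth_mktuple eqxx expr1.
by rewrite big1 ?mulr1// => j /negbTE ji; rewrite tnth_mktuple ji expr0.
Qed.

(** One degree is at most [m] and the other below [n]; mixing the two forms gives the sharp bound
    [m + n] without a predecessor. *)
Lemma lowFM m n f g : lowF m.+1 f -> lowF n g -> lowF (m + n) (fun x => f x * g x).
Proof.
move=> lf lg; elim/lowF_rect: lf => [|c k f' km lf' IH].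
  by under eq_fun do rewrite mul0r; exact: lowF0.
under eq_fun do rewrite mulrDl -mulrA; apply: lowFD => //; apply: lowFZ.
elim/lowF_rect: lg {f' lf' IH} => [|c' l h ln lh IH].
  by under eq_fun do rewrite mulr0; exact: lowF0.
under eq_fun do rewrite mulrDr mulrCA; apply: lowFD => //; apply: lowFZ.
pose kl : d.-tuple nat := [tuple (tnth k i + tnth l i)%N | i < d].
rewrite (_ : (fun _ => _) = mono kl).
  apply: lowF_mono; rewrite /mdeg; under eq_bigr do rewrite tnth_mktuple.
  by rewrite big_split/= -addnS leq_add.
apply/funext => x; rewrite -rmorphM -big_split/=; congr (_%:C)%C.
by apply: eq_bigr => i _; rewrite tnth_mktuple exprD.
Qed.

Variable mu : probability X R.
Hypothesis gmu : is_std_gaussian mu.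

(** Integrability alone is not preserved by products. This class is, since [|f g|^n] is at most
    [|f|^(2n) + |g|^(2n)]. *)
Definition all_moments (f : X -> R) : Prop := measurable_fun setT f /\
  forall n, mu.-integrable setT (EFin \o (fun x => `|f x| ^+ n)).

Lemma all_moments1 : all_moments (fun=> 1).
Proof.
split => [|n]; first exact: measurable_cst.
by apply: bm_int; under eq_fun do rewrite normr1 expr1n; exact: bm_cst.
Qed.

Lemma all_momentsM (f g : X -> R) :
  all_moments f -> all_moments g -> all_moments (fun x => f x * g x).
Proof.
move=> [mf If] [mg Ig]; split => [|n]; first exact: measurable_funM.
apply: (le_integrable measurableT _ _ (integrableD measurableT (If (2 * n)%N) (Ig (2 * n)%N))).
  apply/measurable_EFinP/measurable_funX/measurableT_comp => //.
  exact: measurable_funM.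
move=> x _ /=; rewrite lee_fin (ger0_norm (exprn_ge0 _ _))//.
rewrite [leRHS]ger0_norm ?addr_ge0 ?exprn_ge0// normrM exprMn mulnC !exprM.
have [u0 v0] := (exprn_ge0 n (normr_ge0 (f x)), exprn_ge0 n (normr_ge0 (g x))).
move: (`|f x| ^+ n) (`|g x| ^+ n) u0 v0 => u v u0 v0.
by have := sqr_ge0 (u - v); nra.
Qed.

Lemma all_moments_coord i : all_moments (fun x => tnth x i).
Proof.
split => [|n]; first exact: measurable_tnth.
have /integrableP[mf If] := @gauss_normX R n.
apply/integrableP; split; first exact: (measurableT_comp mf (measurable_tnth i)).
have mAf : measurable_fun setT (fun x : R => `|(`|x| ^+ n)%:E|)%E by exact: measurableT_comp.
have := integral_image (m1 := mu) (@measurable_tnth _ _ d i)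
  (fun A mA => esym (std_gaussian_marginal i gmu mA)) mAf.
by move=> <-.
Qed.

Lemma all_moments_monomial k : all_moments (@monomial R d k).
Proof.
rewrite (_ : monomial k = fun x => \prod_(i <- index_enum 'I_d) tnth x i ^+ tnth k i)//.
elim: (index_enum _) => [|i r IH].
  by under eq_fun do rewrite big_nil; exact: all_moments1.
under eq_fun do rewrite big_cons; apply: all_momentsM => //.
elim: (tnth k i) => [|m IHm].
  by under eq_fun do rewrite expr0; exact: all_moments1.
by under eq_fun do rewrite exprS; apply: all_momentsM => //; exact: all_moments_coord.
Qed.

Lemma cintegrable_mono k : cintegrable mu (mono k).
Proof.
have [mk /(_ 1%N) Ik] := all_moments_monomial k; split => /=.
  apply: (le_integrable measurableT _ _ Ik) => [|x _ /=]; first exact/measurable_EFinP.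
  by rewrite lee_fin expr1 normr_id.
by apply: bm_int; exact: bm_cst.
Qed.

Lemma cintegrable_lowF n f : lowF n f -> cintegrable mu f.
Proof.
elim/lowF_rect => [|c k h kn lh Ih]; first exact: cintegrable_cst.
by apply: cintegrableD => //; apply: cintegrableZ; exact: cintegrable_mono.
Qed.

End polynomials.

Section inner_product.
Context {R : realType} {d : nat}.
Local Notation X := (d.-tuple R).
Local Notation C := (complex R).
Local Notation normc := Normc.normc.
Variable mu : probability X R.
Hypothesis gmu : is_std_gaussian mu.
Implicit Types (f g h : X -> C).

Definition ip f g : C := cint mu (fun x => f x * ((g x)^*)%C).

Lemma orthP f g : orth mu f g <-> ip f g = 0.
Proof.
split => [[h1 h2]|h]; first by apply: complex_eq.
by split; [move: h => /(congr1 (@complex.Re R))|move: h => /(congr1 (@complex.Im R))].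
Qed.

Definition poly f := exists n, lowF n f.

Lemma lowF_poly n f : lowF n f -> poly f. Proof. by exists n. Qed.

Lemma poly0 : poly (fun=> 0). Proof. by exists 0%N; exact: lowF0. Qed.

Lemma polyD f g : poly f -> poly g -> poly (fun x => f x + g x).
Proof.
move=> [m lf] [n lg]; exists (maxn m n); apply: lowFD.
  by apply: lowF_le lf; rewrite leq_maxl.
by apply: lowF_le lg; rewrite leq_maxr.
Qed.

Lemma polyZ c f : poly f -> poly (fun x => c * f x).
Proof. by move=> [m lf]; exists m; exact: lowFZ. Qed.

Lemma polyB f g : poly f -> poly g -> poly (fun x => f x - g x).
Proof.
by move=> pf /(polyZ (-1)) pg; have := polyD pf pg; under eq_fun do rewrite mulN1r.
Qed.

Lemma polyM f g : poly f -> poly g -> poly (fun x => f x * g x).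
Proof.
move=> [m lf] [n lg]; exists (m + n)%N; apply: lowFM => //.
by apply: lowF_le lf.
Qed.

Lemma poly_conj f : poly f -> poly (fun x => ((f x)^*)%C).
Proof. by move=> [m lf]; exists m; exact: lowF_conj. Qed.

Lemma poly_sum (I : Type) (r : seq I) (F : I -> X -> C) : (forall i, poly (F i)) ->
  poly (fun x => \sum_(i <- r) F i x).
Proof.
move=> pF; elim: r => [|i r IH]; first by under eq_fun do rewrite big_nil; exact: poly0.
by under eq_fun do rewrite big_cons; exact: polyD.
Qed.

Lemma poly_cint f : poly f -> cintegrable mu f.
Proof. by move=> [n /(cintegrable_lowF gmu)]. Qed.

Lemma poly_cmeas f : poly f -> cmeas f.
Proof. by move=> /poly_cint/integrable_cmeas. Qed.

Lemma poly_ip f g : poly f -> poly g -> cintegrable mu (fun x => f x * ((g x)^*)%C).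
Proof. by move=> pf pg; apply/poly_cint/polyM => //; exact: poly_conj. Qed.

Lemma ipDl f g h : poly f -> poly g -> poly h ->
  ip (fun x => f x + g x) h = ip f h + ip g h.
Proof.
move=> pf pg ph; rewrite /ip -cintD; try exact: poly_ip.
by congr cint; apply/funext => x; rewrite mulrDl.
Qed.

Lemma ipZl c f h : poly f -> poly h -> ip (fun x => c * f x) h = c * ip f h.
Proof.
move=> pf ph; rewrite /ip -cintZ; try exact: poly_ip.
by congr cint; apply/funext => x; rewrite mulrA.
Qed.

Lemma ipBl f g h : poly f -> poly g -> poly h ->
  ip (fun x => f x - g x) h = ip f h - ip g h.
Proof.
move=> pf pg ph; rewrite /ip -cintB; try exact: poly_ip.
by congr cint; apply/funext => x; rewrite mulrBl.
Qed.

Lemma ip0l h : ip (fun=> 0) h = 0.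
Proof. by rewrite /ip; under eq_fun do rewrite mul0r; rewrite cint_cst. Qed.

Lemma ipC f g : poly f -> poly g -> ip g f = ((ip f g)^*)%C.
Proof.
move=> pf pg; have [i1 i2] := poly_ip pf pg.
apply: complex_eq => /=.
- apply: eq_Rintegral => x _; rewrite !complex_ReM.
  by case: (f x) => ? ?; case: (g x) => ? ? /=; ring.
- rewrite -mulN1r -RintZ//; apply: eq_Rintegral => x _; rewrite !complex_ImM.
  by case: (f x) => ? ?; case: (g x) => ? ? /=; ring.
Qed.

Lemma ip_sym0 f g : poly f -> poly g -> ip f g = 0 -> ip g f = 0.
Proof. by move=> pf pg fg; rewrite ipC// fg rmorph0. Qed.

Lemma ipZr c f h : poly f -> poly h -> ip f (fun x => c * h x) = (c^*)%C * ip f h.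
Proof.
move=> pf ph; rewrite ipC//; last exact: polyZ.
by rewrite (ipC ph pf) ipZl// rmorphM.
Qed.

Lemma ipDr f g h : poly f -> poly g -> poly h ->
  ip f (fun x => g x + h x) = ip f g + ip f h.
Proof.
move=> pf pg ph; rewrite ipC//; last exact: polyD.
by rewrite (ipC pg pf) (ipC ph pf) ipDl// rmorphD.
Qed.

Lemma ip_ae f f' g : poly f -> poly f' -> poly g -> {ae mu, forall x, f x = f' x} ->
  ip f g = ip f' g.
Proof.
move=> pf pf' pg ff'; apply: cint_ae.
- by apply/poly_cmeas/polyM => //; exact: poly_conj.
- by apply/poly_cmeas/polyM => //; exact: poly_conj.
- by apply: filterS ff' => x ->.
Qed.

Lemma ip_eq0_ae f : poly f -> ip f f = 0 -> {ae mu, forall x, f x = 0}.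
Proof.
move=> pf ff.
have aeff : {ae mu, forall x, f x * ((f x)^*)%C = 0}.
  apply: cint_normc0_ae; first by apply/poly_cmeas/polyM => //; exact: poly_conj.
  have [i1 i2] := poly_ip pf pf.
  transitivity ((\int[mu]_x complex.Re (f x * ((f x)^*)%C))%:E).
    rewrite fineK; last exact: integrable_fin_num.
    apply: eq_integral => x _; congr EFin; rewrite Normc.normcM normc_conj -expr2.
    rewrite normc_sqrt sqr_sqrtr ?addr_ge0 ?sqr_ge0// complex_ReM.
    by case: (f x) => u v /=; ring.
  by congr EFin; move: ff => /(congr1 (@complex.Re R)).
apply: filterS aeff => x /eqP; rewrite mulf_eq0 conjc_eq0 orbb.
by move/eqP.
Qed.

End inner_product.

(** * Projections onto the chaos spaces *)

Section chaos_decomposition.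
Context {R : realType} {d : nat}.
Local Notation X := (d.-tuple R).
Local Notation C := (complex R).
Local Notation mono k := (fun x : X => ((monomial k x)%:C)%C : C).
Variable mu : probability X R.
Hypothesis gmu : is_std_gaussian mu.
Implicit Types (f g h : X -> C).
Local Notation ip := (ip mu).
Local Notation chaos := (chaos mu).
Local Notation proj := (Defs.proj mu).

(** The span of a list of monomials, by recursion on the list so that an orthogonal projection can
    be built one direction at a time. *)
Fixpoint cspan (K : seq (d.-tuple nat)) f : Prop :=
  if K is k :: K' then exists c g, cspan K' g /\ f = fun x => c * mono k x + g x
  else f = fun=> 0.

Lemma cspan0 K : cspan K (fun=> 0).
Proof.
elim: K => //= k K IH; exists 0, (fun=> 0); split => //.
by apply/funext => x; rewrite mul0r addr0.
Qed.

Lemma cspanD K f g : cspan K f -> cspan K g -> cspan K (fun x => f x + g x).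
Proof.
elim: K f g => [f g -> ->|k K IH f g [c [f' [sf ->]]] [c' [g' [sg ->]]]] /=.
  by apply/funext => x; rewrite addr0.
exists (c + c'), (fun x => f' x + g' x); split; first exact: IH.
by apply/funext => x; rewrite mulrDl addrACA.
Qed.

Lemma cspanZ K c f : cspan K f -> cspan K (fun x => c * f x).
Proof.
elim: K f => [f ->|k K IH f [c' [f' [sf ->]]]] /=.
  by apply/funext => x; rewrite mulr0.
exists (c * c'), (fun x => c * f' x); split; first exact: IH.
by apply/funext => x; rewrite mulrDr mulrA.
Qed.

Lemma cspan_mem K k : k \in K -> cspan K (mono k).
Proof.
elim: K => //= k' K IH; rewrite inE => /predU1P[->|/IH kK].
  exists 1, (fun=> 0); split; first exact: cspan0.
  by apply/funext => x; rewrite mul1r addr0.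
exists 0, (mono k); split => //.
by apply/funext => x; rewrite mul0r add0r.
Qed.

Lemma cspan_lowF n K f : all (fun k => mdeg k < n)%N K -> cspan K f -> lowF n f.
Proof.
elim: K f => [f _ ->|k K IH f /= /andP[kn Kn] [c [g [sg ->]]]]; first exact: lowF0.
by apply: lowF_cons => //; exact: IH.
Qed.

Lemma poly_mono k : poly (mono k).
Proof. by exists (mdeg k).+1; exact: lowF_mono. Qed.

Lemma cspan_poly K f : cspan K f -> poly f.
Proof.
elim: K f => [f ->|k K IH f [c [g [/IH pg ->]]]]; first exact: poly0.
by apply: polyD => //; apply: polyZ; exact: poly_mono.
Qed.

(* Gram-Schmidt; when the new direction [v'] is null the inverse of [ip v' v'] is 0. *)
Lemma cspan_proj K f : poly f ->
  exists g, cspan K g /\ forall h, cspan K h -> ip (fun x => f x - g x) h = 0.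
Proof.
elim: K f => [f pf|k K IH f pf].
  exists (fun=> 0); split => // h /= ->.
  by apply: (ip_sym0 gmu); [exact: poly0|apply: polyB => //; exact: poly0|exact: ip0l].
have pk := poly_mono k.
have [v [sv vK]] := IH _ pk; have [w [sw wK]] := IH _ pf.
have pv := cspan_poly sv; have pw := cspan_poly sw.
pose v' x := mono k x - v x; pose w' x := f x - w x.
have pv' : poly v' by exact: polyB. have pw' : poly w' by exact: polyB.
pose c := ip w' v' / ip v' v'.
have cE : ip w' v' - c * ip v' v' = 0.
  have [v0|v0] := eqVneq (ip v' v') 0; last by rewrite /c mulfVK ?subrr.
  rewrite v0 mulr0 subr0; apply: (ip_sym0 gmu) => //.
  rewrite -(ip0l mu w'); apply: (ip_ae gmu) => //; first exact: poly0.
  exact: (ip_eq0_ae gmu).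
exists (fun x => c * mono k x + (w x - c * v x)); split.
  exists c, (fun x => w x - c * v x); split => //.
  have := cspanD sw (cspanZ (- c) sv); congr cspan; apply/funext => x.
  by rewrite mulNr.
move=> _ [z [h [sh ->]]]; have ph := cspan_poly sh.
rewrite (_ : (fun x => _ - _) = fun x => w' x - c * v' x); last first.
  by apply/funext => x; rewrite /w' /v'; ring.
have pu : poly (fun x => w' x - c * v' x) by apply: polyB => //; exact: polyZ.
have uK h' : cspan K h' -> ip (fun x => w' x - c * v' x) h' = 0.
  move=> sh'; have ph' := cspan_poly sh'.
  by rewrite (ipBl gmu)// ?(ipZl gmu)// ?wK ?vK ?mulr0 ?subr0//; exact: polyZ.
rewrite (_ : (fun x => _ + _) = fun x => z * v' x + (z * v x + h x)); last first.
  by apply/funext => x; rewrite /v'; ring.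
rewrite (ipDr gmu)//; [|exact: polyZ|by apply: polyD => //; exact: polyZ].
rewrite (ipZr gmu)// (ipBl gmu)//; last exact: polyZ.
rewrite (ipZl gmu)// cE mulr0 add0r; apply: uK.
by apply: cspanD => //; exact: cspanZ.
Qed.

Lemma lowF_proj n f : poly f ->
  exists g, lowF n g /\ forall h, lowF n h -> ip (fun x => f x - g x) h = 0.
Proof.
move=> pf.
(* Each exponent is at most the degree, hence below [n], so finitely many tuples over ['I_n] cover
   all monomials of degree below [n]. *)
pose K := [seq k <- [seq map_tuple val t | t : d.-tuple 'I_n] | (mdeg k < n)%N].
have [g [sg gK]] := cspan_proj K pf; exists g; split.
  by apply: cspan_lowF sg; exact: filter_all.
move=> h lh; apply: gK; elim/(@lowF_rect R d): lh => [|c k h' kn lh' IH]; first exact: cspan0.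
apply: cspanD => //; apply: cspanZ; apply: cspan_mem; rewrite mem_filter kn/=.
case: n {K sg lh' IH} kn => // n kn; apply/mapP.
exists [tuple inord (tnth k i) | i < d]; first by rewrite mem_enum.
apply: eq_from_tnth => i; rewrite tnth_map tnth_mktuple/= inordK//.
by apply: leq_ltn_trans kn; rewrite /mdeg (bigD1 i)//= leq_addr.
Qed.

Lemma chaosE n f :
  chaos n f <-> lowF n.+1 f /\ forall g, lowF n g -> ip f g = 0.
Proof.
split => [[lf lo]|[lf lo]].
  split => // g; case: n {lf} lo => [_ /lowF_0 ->|n lo lg]; last exact/orthP/lo.
  by rewrite /ip; under eq_fun do rewrite rmorph0 mulr0; rewrite cint_cst.
by split => //; case: n {lf} lo => // n lo g lg; apply/orthP/lo.
Qed.

Lemma chaos_lowF n f : chaos n f -> lowF n.+1 f. Proof. by case. Qed.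

Lemma chaos_poly n f : chaos n f -> poly f.
Proof. by move=> /chaos_lowF; exists n.+1. Qed.

Lemma chaos_ip n f g : chaos n f -> lowF n g -> ip f g = 0.
Proof. by move=> /chaosE[_]; exact. Qed.

Lemma chaos0 n : chaos n (fun=> 0).
Proof. by apply/chaosE; split => [|g _]; [exact: lowF0|exact: ip0l]. Qed.

Lemma chaosZ n c f : chaos n f -> chaos n (fun x => c * f x).
Proof.
move=> cf; have /chaosE[lf lo] := cf; apply/chaosE; split=> [|g lg]; first exact: lowFZ.
by rewrite (ipZl gmu) ?lo ?mulr0//; [exact: chaos_poly cf|exists n].
Qed.

Lemma chaosB n f g : chaos n f -> chaos n g -> chaos n (fun x => f x - g x).
Proof.
move=> cf cg; have [/chaosE[lf lo] /chaosE[lg og]] := (cf, cg).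
apply/chaosE; split=> [|h lh]; first exact: lowFB.
rewrite (ipBl gmu) ?lo ?og ?subr0//; [exact: chaos_poly cf|exact: chaos_poly cg|].
by exists n.
Qed.

Lemma chaos_orth m n f g : m != n -> chaos m f -> chaos n g -> ip f g = 0.
Proof.
move=> mn cf cg; have [pf pg] := (chaos_poly cf, chaos_poly cg).
move: mn; rewrite neq_ltn => /orP[mn|nm].
  apply: (ip_sym0 gmu) => //; apply: (chaos_ip cg).
  exact: lowF_le (chaos_lowF cf).
by apply: (chaos_ip cf); exact: lowF_le (chaos_lowF cg).
Qed.

(** Subtracting the projection onto lower degrees leaves the top component. Components are indexed
    by all of [nat] and vanish beyond [N], so that [proj_sum] can treat every index alike. *)
Lemma chaos_decomp N f : lowF N.+1 f -> exists fs : nat -> X -> C,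
  [/\ forall n, chaos n (fs n), forall n, (N < n)%N -> fs n = fun=> 0 &
      f = fun x => \sum_(n < N.+1) fs n x].
Proof.
elim: N f => [f lf|N IH f lf].
  exists (fun n => if n == 0%N then f else fun=> 0); split => [[|n]|[|n]|]//.
    exact: chaos0.
  by apply/funext => x; rewrite big_ord1.
have pf : poly f by exists N.+2.
have [g [lg fg]] := lowF_proj N.+1 pf; have [fs [cfs fs0 gE]] := IH _ lg.
exists (fun n => if n == N.+1 then fun x => f x - g x else fs n); split => [n|n Nn|].
- case: eqP => [->|_]; last exact: cfs.
  apply/chaosE; split => //; apply: lowFB => //; exact: lowF_le lg.
- by rewrite gtn_eqF// fs0// ltnW.
- apply/funext => x; rewrite big_ord_recr/= eqxx [X in X + _](_ : _ = g x) 1?subrKC//.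
  by rewrite gE; apply: eq_bigr => i _; rewrite ltn_eqF.
Qed.

Lemma ip_suml (I : Type) (r : seq I) (F : I -> X -> C) h : (forall i, poly (F i)) -> poly h ->
  ip (fun x => \sum_(i <- r) F i x) h = \sum_(i <- r) ip (F i) h.
Proof.
move=> pF ph; elim: r => [|i r IH].
  by rewrite big_nil; under eq_fun do rewrite big_nil; exact: ip0l.
rewrite big_cons -IH -(ipDl gmu)//; last exact: poly_sum.
by congr ip; apply/funext => x; rewrite big_cons.
Qed.

Lemma ip_chaos_sum N fs n h : (forall n, chaos n (fs n)) ->
  (forall n, (N < n)%N -> fs n = fun=> 0) -> chaos n h ->
  ip (fun x => \sum_(n < N.+1) fs n x) h = ip (fs n) h.
Proof.
move=> cfs fs0 ch.
rewrite (ip_suml _ (fun i : 'I_N.+1 => chaos_poly (cfs i)) (chaos_poly ch)).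
have [nN|Nn] := ltnP n N.+1; last first.
  rewrite fs0// ip0l big1// => i _; apply: chaos_orth (cfs i) ch.
  by rewrite ltn_eqF// (leq_trans (ltn_ord i)).
rewrite (bigD1 (Ordinal nN))//= big1 ?addr0// => i ni.
exact: chaos_orth (cfs i) ch.
Qed.

(** [g] shows that the set behind the [xget] is inhabited, so the chosen value has the defining
    property. Its difference with [g] lies in the chaos and is orthogonal to itself, hence null
    almost everywhere. *)
Lemma projP n f g : poly f -> chaos n g -> (forall h, chaos n h -> ip f h = ip g h) ->
  chaos n (proj n f) /\ {ae mu, forall x, proj n f x = g x}.
Proof.
move=> pf cg fg; have pg := chaos_poly cg.
have : [set g | chaos n g /\ forall h, chaos n h -> orth mu (f \- g) h] (proj n f).
  apply: (@xgetPex _ _ [set g | chaos n g /\ forall h, chaos n h -> orth mu (f \- g) h]).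
  exists g; split => // h ch; apply/orthP.
  by have := ipBl gmu pf pg (chaos_poly ch) => ->; rewrite fg ?subrr.
move=> /= [cp op]; split => //; have pp := chaos_poly cp.
have cd := chaosB cp cg; have pd := chaos_poly cd.
have : ip (fun x => proj n f x - g x) (fun x => proj n f x - g x) = 0.
  have /orthP := op _ cd; have := ipBl gmu pf pp pd => -> /eqP.
  by rewrite subr_eq0 fg// eq_sym -subr_eq0 -(ipBl gmu)// => /eqP.
move=> /(ip_eq0_ae gmu pd); apply: filterS => x /eqP.
by rewrite subr_eq0 => /eqP.
Qed.

Lemma proj_sum N fs n : (forall n, chaos n (fs n)) ->
  (forall n, (N < n)%N -> fs n = fun=> 0) ->
  chaos n (proj n (fun x => \sum_(n < N.+1) fs n x)) /\
  {ae mu, forall x, proj n (fun x => \sum_(n < N.+1) fs n x) x = fs n x}.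
Proof.
move=> cfs fs0; apply: projP => // [|h ch]; last exact: ip_chaos_sum.
exists N.+1; apply: lowF_sum => i; exact: lowF_le (ltn_ord i) (chaos_lowF (cfs i)).
Qed.

End chaos_decomposition.

(** * The rotated product on chaos *)

Section tensor_polynomials.
Context {R : realType} {d : nat}.
Local Notation X := (d.-tuple R).
Local Notation C := (complex R).
Local Notation mono k := (fun x : X => ((monomial k x)%:C)%C : C).
Implicit Types (f g q : X -> C) (u v : X * X -> C).
Implicit Types Q : (X -> C) -> (X -> C) -> Prop.

(** Finite sums of products [f(x) g(y)]. The relation [Q] between the two factors carries the degree
    information, so that one set of closure lemmas serves [tpoly], [xdeg] and [tdeg]. *)
Inductive tens Q : (X * X -> C) -> Prop :=
| tens0 : tens Q (fun=> 0)
| tens_cons f g u : Q f g -> tens Q u -> tens Q (fun z => f z.1 * g z.2 + u z).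

Lemma tens1 Q f g : Q f g -> tens Q (fun z => f z.1 * g z.2).
Proof.
move=> fg; have := tens_cons fg (tens0 Q).
by congr tens; apply/funext => z; rewrite addr0.
Qed.

Lemma tensD Q u v : tens Q u -> tens Q v -> tens Q (fun z => u z + v z).
Proof.
move=> tu tv; elim: tu => [|f g w fg tw IH]; first by under eq_fun do rewrite add0r.
by under eq_fun do rewrite -addrA; exact: tens_cons.
Qed.

Lemma tens_le Q Q' u : (forall f g, Q f g -> Q' f g) -> tens Q u -> tens Q' u.
Proof.
move=> QQ'; elim => [|f g w fg tw IH]; first exact: tens0.
by apply: tens_cons => //; exact: QQ'.
Qed.

Lemma tensM Q Q' Q'' u v :
  (forall f g f' g', Q f g -> Q' f' g' -> Q'' (fun x => f x * f' x) (fun x => g x * g' x)) ->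
  tens Q u -> tens Q' v -> tens Q'' (fun z => u z * v z).
Proof.
move=> QQ tu tv; elim: tu => [|f g w fg tw IH].
  by under eq_fun do rewrite mul0r; exact: tens0.
under eq_fun do rewrite mulrDl; apply: tensD => //.
elim: tv {IH} => [|f' g' w' fg' tw' IH].
  by under eq_fun do rewrite mulr0; exact: tens0.
under eq_fun do rewrite mulrDr; apply: tensD => //.
have := tens1 (QQ _ _ _ _ fg fg'); congr tens; apply/funext => z; ring.
Qed.

Definition tpoly f g := poly f /\ poly g.
Definition xdeg N f g := lowF N f /\ poly g.
(** Total degree below [N], with the two partial degrees kept visible because [rot_prod_orth]
    compares them with [m] and [n]. *)
Definition tdeg N f g := exists i j, [/\ lowF i.+1 f, lowF j.+1 g & (i + j < N)%N].

Lemma poly_cst (c : C) : poly (fun _ : X => c).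
Proof. by exists 1%N; exact: lowF_cst. Qed.

Lemma tdeg_le M N f g : (M <= N)%N -> tdeg M f g -> tdeg N f g.
Proof.
move=> MN [i [j [fi gj ijM]]]; exists i, j; split => //.
exact: leq_trans ijM MN.
Qed.

Lemma tdeg_xdeg N f g : tdeg N f g -> xdeg N f g.
Proof.
move=> [i [j [fi gj ijM]]]; split; last by exists j.+1.
apply: lowF_le fi; apply: leq_trans ijM; by rewrite ltnS leq_addr.
Qed.

Lemma xdeg_tpoly N f g : xdeg N f g -> tpoly f g.
Proof. by move=> [lf pg]; split => //; exists N. Qed.

(* [q] is the leading part of [u] in the first variable, up to the factor [c] *)
Definition leads (c : C) (N : nat) q u :=
  [/\ lowF N.+1 q, tens (tdeg N.+1) u & tens (xdeg N) (fun z => u z - c * q z.1)].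

Lemma leads_cst z : leads 1 0 (fun=> z) (fun=> z).
Proof.
split; first exact: lowF_cst.
  have t1 : tdeg 1 (fun=> z) (fun=> 1) by exists 0%N, 0%N; split => //; exact: lowF_cst.
  by have := tens1 t1; under eq_fun do rewrite mulr1.
by under eq_fun do rewrite mul1r subrr; exact: tens0.
Qed.

Lemma leads0 c N : leads c N (fun=> 0) (fun=> 0).
Proof.
split; [exact: lowF0|exact: tens0|].
by under eq_fun do rewrite mulr0 subr0; exact: tens0.
Qed.

Lemma leadsD c N q u q' u' : leads c N q u -> leads c N q' u' ->
  leads c N (fun x => q x + q' x) (fun z => u z + u' z).
Proof.
move=> [lq tu xu] [lq' tu' xu']; split; [exact: lowFD|exact: tensD|].
by have := tensD xu xu'; congr tens; apply/funext => z; ring.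
Qed.

Lemma tens_xdeg1 N q : lowF N q -> tens (xdeg N) (fun z => q z.1).
Proof.
move=> lq; have := @tens1 (xdeg N) q (fun=> 1) (conj lq (poly_cst 1)).
by under eq_fun do rewrite mulr1.
Qed.

(** [u u' - c c' q q' = (u - c q) u' + c q (u' - c' q')], where each summand has a factor of lower
    degree in the first variable. *)
Lemma leadsM c N q u c' N' q' u' : leads c N q u -> leads c' N' q' u' ->
  leads (c * c') (N + N') (fun x => q x * q' x) (fun z => u z * u' z).
Proof.
move=> [lq tu xu] [lq' tu' xu']; split.
- by rewrite -addnS; exact: lowFM.
- apply: tensM tu tu' => f g f' g' [i [j [fi gj ij]]] [i' [j' [fi' gj' ij']]].
  exists (i + i')%N, (j + j')%N; split; rewrite -?addnS; try exact: lowFM.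
  by rewrite addnACA leq_add// addnS.
rewrite (_ : (fun z => _) = fun z => (u z - c * q z.1) * u' z +
    (c * q z.1) * (u' z - c' * q' z.1)); last by apply/funext => z; ring.
apply: tensD.
  apply: tensM xu tu' => f g f' g' [lf pg] [i [j [fi gj ij]]]; split.
    under eq_fun do rewrite mulrC.
    rewrite addnC; apply: lowFM => //; apply: lowF_le fi.
    by rewrite (leq_trans _ ij)// ltnS leq_addr.
  by apply: polyM => //; exists j.+1.
apply: (tensM _ (tens_xdeg1 (lowFZ c lq)) xu') => f g f' g' [lf pg] [lf' pg']; split.
  exact: lowFM.
exact: polyM.
Qed.

Lemma leadsZ z c N q u : leads c N q u -> leads c N (fun x => z * q x) (fun w => z * u w).
Proof.
by move=> lu; have := leadsM (leads_cst z) lu; rewrite mul1r.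
Qed.

(** Below the top degree the factor [c'] is arbitrary, because [c' * q] itself is absorbed by the
    remainder. Hence the single factor [a ^+ N] serves all monomials of a polynomial. *)
Lemma leads_lower c c' j N q u : (j < N)%N -> leads c j q u -> leads c' N q u.
Proof.
move=> jN [lq tu xu]; split.
- by apply: lowF_le lq; rewrite ltnS ltnW.
- by apply: tens_le tu => f g; apply: tdeg_le; rewrite ltnS ltnW.
apply: tensD.
  by apply: tens_le tu => f g tfg; apply/tdeg_xdeg/(tdeg_le jN).
have := tens_xdeg1 (lowF_le jN (lowFZ (- c') lq)); congr tens.
by apply/funext => z; rewrite mulNr.
Qed.

Variables a b : R.

Lemma leads_coord i : leads (a%:C)%C 1 (fun x => ((tnth x i)%:C)%C)
  (fun z => ((tnth (comb a b z.1 z.2) i)%:C)%C).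
Proof.
have tE z : ((tnth (comb a b z.1 z.2) i)%:C)%C =
    (a%:C)%C * ((tnth z.1 i)%:C)%C * 1 + 1 * ((b%:C)%C * ((tnth z.2 i)%:C)%C) :> C.
  by rewrite tnth_comb rmorphD !rmorphM mulr1 mul1r.
have lb : lowF 2 (fun x : X => (b%:C)%C * ((tnth x i)%:C)%C).
  exact/lowFZ/lowF_coord.
split; first exact: lowF_coord.
- under eq_fun do rewrite tE; apply: tensD.
    apply: (@tens1 _ (fun x => (a%:C)%C * ((tnth x i)%:C)%C) (fun=> 1)).
    exists 1%N, 0%N; split => //; last exact: lowF_cst.
    exact/lowFZ/lowF_coord.
  apply: (@tens1 _ (fun=> 1) (fun x => (b%:C)%C * ((tnth x i)%:C)%C)).
  by exists 0%N, 1%N; split => //; exact: lowF_cst.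
- have := @tens1 (xdeg 1) (fun=> 1) _ (conj (lowF_cst 0 1) (lowF_poly lb)).
  congr tens; apply/funext => z; rewrite tE; ring.
Qed.

Lemma leads_monomial k : leads ((a ^+ mdeg k)%:C)%C (mdeg k) (mono k)
  (fun z => mono k (comb a b z.1 z.2)).
Proof.
rewrite /mdeg /monomial; elim: (index_enum _) => [|i r IH].
  have := leads_cst 1; rewrite big_nil expr0.
  by congr leads; apply/funext => x; rewrite big_nil.
have li : leads ((a ^+ tnth k i)%:C)%C (tnth k i) (fun x => ((tnth x i ^+ tnth k i)%:C)%C)
    (fun z => ((tnth (comb a b z.1 z.2) i ^+ tnth k i)%:C)%C).
  elim: (tnth k i) => [|n IHn].
    by have := leads_cst 1; congr leads; apply/funext => x; rewrite expr0.
  have := leadsM (leads_coord i) IHn; rewrite -rmorphM -exprS add1n.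
  by congr leads; apply/funext => x; rewrite exprS rmorphM.
have := leadsM li IH; rewrite big_cons exprD rmorphM.
by congr leads; apply/funext => x; rewrite big_cons rmorphM.
Qed.

Lemma leads_comb N f : lowF N.+1 f ->
  leads ((a ^+ N)%:C)%C N f (fun z => f (comb a b z.1 z.2)).
Proof.
elim/(@lowF_rect R d) => [|c k g kN lg IH]; first exact: leads0.
apply: leadsD => //; apply: leadsZ.
move: kN; rewrite ltnS leq_eqVlt => /predU1P[<-|kN]; first exact: leads_monomial.
exact: leads_lower kN (leads_monomial k).
Qed.

End tensor_polynomials.

Section rotated_chaos.
Context {R : realType} {d : nat}.
Local Notation X := (d.-tuple R).
Local Notation C := (complex R).
Variables (mu : probability X R) (a b : R).
Hypotheses (gmu : is_std_gaussian mu) (ab : a ^+ 2 + b ^+ 2 = 1).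
Implicit Types (f g q : X -> C) (u v : X * X -> C).
Local Notation ip := (ip mu).
Local Notation chaos := (chaos mu).
Local Notation proj := (Defs.proj mu).
Local Notation rot_prod := (rot_prod mu a b).
Local Notation rot_ker := (rot_ker a b).

Lemma tens_slice u x : tens (@tpoly R d) u -> cintegrable mu (fun y => u (x, y)).
Proof.
elim => [|f g v [pf pg] tv IH]; first exact: cintegrable_cst.
exact: cintegrableD (cintegrableZ (f x) (poly_cint gmu pg)) IH.
Qed.

(** Integrating out [y] replaces each second factor by a number, so any additive property [S] is
    obtained by induction on [tens]. It is used for a degree bound and for the vanishing of the
    integral. *)
Lemma tens_cint (S : (X -> C) -> Prop) (Q : (X -> C) -> (X -> C) -> Prop) u :
  (forall f g, Q f g -> tpoly f g) ->
  S (fun=> 0) -> (forall f g, S f -> S g -> S (fun x => f x + g x)) ->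
  (forall f g, Q f g -> S (fun x => f x * cint mu g)) ->
  tens Q u -> S (fun x => cint mu (fun y => u (x, y))).
Proof.
move=> Qp S0 SD SZ; elim => [|f g v fg tv IH].
  by under eq_fun do rewrite cint_cst.
have [pf pg] := Qp _ _ fg.
have := SD _ _ (SZ _ _ fg) IH; congr S; apply/funext => x.
rewrite -cintZ; last exact: poly_cint.
rewrite -cintD//; first by apply: cintegrableZ; exact: poly_cint.
by apply: tens_slice; exact: tens_le tv.
Qed.

Lemma tens_cint_lowF N u : tens (xdeg N) u -> lowF N (fun x => cint mu (fun y => u (x, y))).
Proof.
apply: tens_cint; [exact: xdeg_tpoly|exact: lowF0|exact: lowFD|].
by move=> f g [lf pg]; under eq_fun do rewrite mulrC; exact: lowFZ.
Qed.

Lemma tens_integrable u : tens (@tpoly R d) u -> cintegrable (mu \x mu)%E u.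
Proof.
elim => [|f g v [pf pg] tv IH]; first exact: cintegrable_cst.
by apply: cintegrableD => //; apply: prod_integrable; exact: poly_cint.
Qed.

Lemma cint_prod u : cintegrable (mu \x mu)%E u ->
  (forall x, cintegrable mu (fun y => u (x, y))) ->
  cint (mu \x mu)%E u = cint mu (fun x => cint mu (fun y => u (x, y))).
Proof.
move=> [i1 i2] us; apply: complex_eq; rewrite /= /Rintegral -integral12_prod_meas1//.
- congr fine; apply: eq_integral => x _; have [s1 _] := us x.
  by rewrite fineK//; exact: integrable_fin_num.
- congr fine; apply: eq_integral => x _; have [_ s2] := us x.
  by rewrite fineK//; exact: integrable_fin_num.
Qed.

Lemma cint_rot u : cmeas u ->
  cint (mu \x mu)%E (fun z => u (rotd a b z)) = cint (mu \x mu)%E u.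
Proof.
move=> [m1 m2]; apply: complex_eq; congr fine.
- apply: (tuple_rot gmu ab (F := fun z => (complex.Re (u z))%:E)); exact/measurable_EFinP.
- apply: (tuple_rot gmu ab (F := fun z => (complex.Im (u z))%:E)); exact/measurable_EFinP.
Qed.

Lemma leads_rot_ker m n f g : lowF m.+1 f -> lowF n.+1 g ->
  leads ((a ^+ m * b ^+ n)%:C)%C (m + n) (fun x => f x * g x) (rot_ker f g).
Proof.
move=> lf lg; rewrite rmorphM.
exact: leadsM (leads_comb a b lf) (leads_comb b (- a) lg).
Qed.

Lemma tdeg_tpoly N f g : @tdeg R d N f g -> tpoly f g.
Proof. by move=> [i [j [li lj _]]]; split; [exists i.+1|exists j.+1]. Qed.

Lemma rot_ker_tpoly f g : poly f -> poly g -> tens (@tpoly R d) (rot_ker f g).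
Proof.
move=> [m lf] [n lg].
have [_ tu _] := leads_rot_ker (lowF_le (leqnSn m) lf) (lowF_le (leqnSn n) lg).
apply: tens_le tu; exact: tdeg_tpoly.
Qed.

Lemma rot_prod_lowF m n f g : lowF m.+1 f -> lowF n.+1 g -> lowF (m + n).+1 (rot_prod f g).
Proof.
move=> lf lg; have [_ tu _] := leads_rot_ker lf lg.
by apply: tens_cint_lowF; apply: tens_le tu; exact: tdeg_xdeg.
Qed.

Lemma rot_prod_lead m n f g : lowF m.+1 f -> lowF n.+1 g ->
  lowF (m + n) (fun x => rot_prod f g x - ((a ^+ m * b ^+ n)%:C)%C * (f x * g x)).
Proof.
move=> lf lg; have [lq tu xu] := leads_rot_ker lf lg.
have := tens_cint_lowF xu; congr lowF; apply/funext => x.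
have Ik : cintegrable mu (fun y => rot_ker f g (x, y)).
  by apply: tens_slice; apply: tens_le tu; exact: tdeg_tpoly.
have := cintB Ik (cintegrable_cst mu (((a ^+ m * b ^+ n)%:C)%C * (f x * g x))).
by rewrite cint_cst.
Qed.

(* Undoing the rotation, [<rot_prod f g, q> = int int f(x) g(y) conj (q (a x + b y))]. *)
Lemma rot_prod_orth m n f g q : chaos m f -> chaos n g -> lowF (m + n) q ->
  ip (rot_prod f g) q = 0.
Proof.
move=> cf cg lq; have [pf pg] := (chaos_poly cf, chaos_poly cg).
pose q' x := ((q x)^*)%C; have lq' : lowF (m + n) q' by exact: lowF_conj.
pose u z := f z.1 * g z.2 * q' (comb a b z.1 z.2).
pose Q0 f g := tpoly f g /\ (cint mu f = 0 \/ cint mu g = 0).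
have tq : tens (tdeg (m + n)) (fun z => q' (comb a b z.1 z.2)).
  case: (m + n)%N lq' => [/lowF_0 ->|N lN]; first exact: tens0.
  by have [] := leads_comb a b lN.
have tu : tens Q0 u.
  have fg : f = f /\ g = g by [].
  apply: (tensM _ (@tens1 _ _ (fun f' g' => f' = f /\ g' = g) f g fg) tq).
  move=> _ _ f' g' [-> ->] [i [j [li lj ij]]]; split.
    by split; apply: polyM => //; [exists i.+1|exists j.+1].
  (* [chaos_ip] pairs a chaos element with a conjugate, so the factor coming from [q'] is written as
     a double conjugate. *)
  have conjK (h : X -> C) : h = fun x => ((((h x)^*)%C)^*)%C.
    by apply/funext => x; rewrite conjcK.
  (* [i + j < m + n] forces [i < m] or [j < n], so one of the two factors integrates to zero by
     orthogonality to lower degrees. *)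
  have [im|mi] := ltnP i m; [left|right].
    rewrite (conjK f'); apply: (chaos_ip cf); apply: lowF_conj; exact: lowF_le li.
  rewrite (conjK g'); apply: (chaos_ip cg); apply: lowF_conj; apply: lowF_le lj.
  by rewrite -(ltn_add2l m) (leq_ltn_trans _ ij)// leq_add2r.
have tpu : tens (@tpoly R d) u by apply: tens_le tu => ? ? [].
(* The reflection is an involution: after composition with it, the argument [a x + b y] of [q']
   becomes the first variable. *)
have ruE z : u (rotd a b z) = rot_ker f g z * q' z.1.
  have := rotd_invol z ab; rewrite /u /rotd/= => rz.
  by congr (_ * q' _); case: z rz => x y /= [].
have tru : tens (@tpoly R d) (fun z => u (rotd a b z)).
  under eq_fun do rewrite ruE; have [N lN] : poly q' by exists (m + n)%N.
  have tq1 : tens (@tpoly R d) (fun z => q' z.1).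
    by apply: tens_le (tens_xdeg1 lq'); exact: xdeg_tpoly.
  apply: (tensM _ (rot_ker_tpoly pf pg) tq1) => f1 g1 f2 g2 [? ?] [? ?].
  by split; exact: polyM.
transitivity (cint mu (fun x => cint mu (fun y => u (rotd a b (x, y))))).
  congr cint; apply/funext => x; under [in RHS]eq_fun do rewrite ruE mulrC.
  rewrite (cintZ (q' x) (tens_slice x (rot_ker_tpoly pf pg))).
  by rewrite mulrC.
rewrite -(cint_prod (tens_integrable tru)) => [|x]; last exact: tens_slice tru.
rewrite cint_rot; last by apply: integrable_cmeas; exact: tens_integrable.
rewrite cint_prod => [||x]; [|exact: tens_integrable|exact: tens_slice].
have [] : poly (fun x => cint mu (fun y => u (x, y))) /\
  cint mu (fun x => cint mu (fun y => u (x, y))) = 0; last by [].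
apply: (tens_cint (S := fun h => poly h /\ cint mu h = 0) (Q := Q0)) tu => [f' g' []//||f1 g1 [pf1 f10] [pg1 g10]|f1 g1 [[pf1 pg1] fg0]].
- by split; [exact: poly0|rewrite cint_cst].
- split; first exact: polyD.
  by rewrite cintD ?f10 ?g10 ?addr0//; exact: poly_cint.
- under eq_fun do rewrite mulrC; split; first exact: polyZ.
  rewrite cintZ; last exact: poly_cint.
  by case: fg0 => ->; rewrite ?mulr0 ?mul0r.
Qed.

Lemma rot_prod_chaos m n f g : chaos m f -> chaos n g -> chaos (m + n) (rot_prod f g).
Proof.
move=> cf cg; apply/chaosE; split.
  exact: rot_prod_lowF (chaos_lowF cf) (chaos_lowF cg).
by move=> q lq; exact: rot_prod_orth cf cg lq.
Qed.

(** Equality almost everywhere is all that is known of components chosen by [proj], whence the form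
    of the hypotheses. Modulo degree below [m + n], which is orthogonal to the chaos of order
    [m + n], [rot_prod f g] is [a^m b^n f g]. *)
Lemma proj_mul_chaos m n f g f' g' : chaos m f -> chaos n g -> poly f' -> poly g' ->
  {ae mu, forall x, f' x = ((a ^+ m)%:C)%C * f x} ->
  {ae mu, forall x, g' x = ((b ^+ n)%:C)%C * g x} ->
  {ae mu, forall x, proj (m + n) (fun y => f' y * g' y) x = rot_prod f g x}.
Proof.
move=> cf cg pf' pg' ff' gg'; have [pf pg] := (chaos_poly cf, chaos_poly cg).
have cT := rot_prod_chaos cf cg.
suff H h : chaos (m + n) h -> ip (fun y => f' y * g' y) h = ip (rot_prod f g) h.
  by have [] := projP gmu (polyM pf' pg') cT H.
move=> ch; have ph := chaos_poly ch.
rewrite (ip_ae gmu (f' := fun x => ((a ^+ m * b ^+ n)%:C)%C * (f x * g x)))//; last 3 first.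
- exact: polyM.
- by apply: polyZ; exact: polyM.
- by near=> x; rewrite (near ff' x)// (near gg' x)// rmorphM/=; ring.
apply/eqP; rewrite eq_sym -subr_eq0 -(ipBl gmu)//; [|exact: chaos_poly cT|].
- have lr := rot_prod_lead (chaos_lowF cf) (chaos_lowF cg).
  apply/eqP/(ip_sym0 gmu ph); first by exists (m + n)%N.
  exact: chaos_ip ch lr.
- by apply: polyZ; exact: polyM.
Unshelve. all: by end_near.
Qed.

End rotated_chaos.

(** * Wick products of polynomials as rotated products *)

Section wick_rotation.
Context {R : realType} {d : nat}.
Local Notation X := (d.-tuple R).
Local Notation C := (complex R).
Variables (mu : probability X R).
Hypotheses (gmu : is_std_gaussian mu).
Implicit Types (f g q : X -> C) (c : R).
Local Notation chaos := (chaos mu).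
Local Notation proj := (Defs.proj mu).

Definition decomposes N f (fs : nat -> X -> C) : Prop :=
  [/\ forall n, chaos n (fs n), forall n, (N < n)%N -> fs n = fun=> 0 &
      f = fun x => \sum_(n < N.+1) fs n x].

Lemma GammaN_ae N c f fs : decomposes N f fs ->
  {ae mu, forall x, GammaN mu N c f x = \sum_(n < N.+1) ((c ^+ n)%:C)%C * fs n x}.
Proof.
move=> [cfs fs0 ->].
have H n : {ae mu, forall x, proj n (fun x => \sum_(n < N.+1) fs n x) x = fs n x}.
  by have [] := proj_sum gmu n cfs fs0.
have := ae_foralln H; apply: filterS => x Hx.
by apply: eq_bigr => n _; rewrite Hx.
Qed.

(** [wickN] projects the output of [GammaN] once more, so the components of that output have to be
    identified. *)
Lemma GammaN_proj N c f fs n : decomposes N f fs -> (n <= N)%N ->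
  chaos n (proj n (GammaN mu N c f)) /\
  {ae mu, forall x, proj n (GammaN mu N c f) x = ((c ^+ n)%:C)%C * fs n x}.
Proof.
move=> [cfs fs0 ->] nN; set f' := fun x => _.
(* Built on the chosen [proj m f'] rather than on [fs m]: this makes [GammaN] equal to the sum of
   the [gs m] everywhere, as [proj_sum] requires. *)
pose gs m : X -> C := if (m <= N)%N then fun x => ((c ^+ m)%:C)%C * proj m f' x else fun=> 0.
have cgs m : chaos m (gs m).
  rewrite /gs; case: ifP => _; last exact: chaos0.
  by apply: chaosZ => //; have [] := proj_sum gmu m cfs fs0.
have gs0 m : (N < m)%N -> gs m = fun=> 0 by move=> Nm; rewrite /gs leqNgt Nm.
have -> : GammaN mu N c f' = fun x => \sum_(m < N.+1) gs m x.
  apply/funext => x; apply: eq_bigr => m _.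
  by rewrite /gs -ltnS ltn_ord.
have [cp pE] := proj_sum gmu n cgs gs0; split => //.
have [_ fE] := proj_sum gmu n cfs fs0.
by near=> x; rewrite (near pE x)// /gs nN (near fE x).
Unshelve. all: by end_near.
Qed.

Variables a b : R.
Hypothesis ab : a ^+ 2 + b ^+ 2 = 1.
Local Notation rot_prod := (rot_prod mu a b).

Lemma rot_prod_suml (I : Type) (r : seq I) (F : I -> X -> C) g x :
  (forall i, poly (F i)) -> poly g ->
  rot_prod (fun x => \sum_(i <- r) F i x) g x = \sum_(i <- r) rot_prod (F i) g x.
Proof.
move=> pF pg; elim: r => [|i r IH].
  rewrite big_nil /rot_prod /rot_ker -[RHS](cint_cst mu); congr cint.
  by apply/funext => y; rewrite big_nil mul0r.
have pS : poly (fun x => \sum_(j <- r) F j x) by exact: poly_sum.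
rewrite big_cons -IH /rot_prod -cintD.
- by congr cint; apply/funext => y; rewrite /rot_ker big_cons mulrDl.
- exact: (tens_slice gmu x (rot_ker_tpoly a b (pF i) pg)).
- exact: (tens_slice gmu x (rot_ker_tpoly a b pS pg)).
Qed.

Lemma rot_prod_sumr (I : Type) (r : seq I) (F : I -> X -> C) g x :
  (forall i, poly (F i)) -> poly g ->
  rot_prod g (fun x => \sum_(i <- r) F i x) x = \sum_(i <- r) rot_prod g (F i) x.
Proof.
move=> pF pg; elim: r => [|i r IH].
  rewrite big_nil /rot_prod /rot_ker -[RHS](cint_cst mu); congr cint.
  by apply/funext => y; rewrite big_nil mulr0.
have pS : poly (fun x => \sum_(j <- r) F j x) by exact: poly_sum.
rewrite big_cons -IH /rot_prod -cintD.
- by congr cint; apply/funext => y; rewrite /rot_ker big_cons mulrDr.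
- exact: (tens_slice gmu x (rot_ker_tpoly a b pg (pF i))).
- exact: (tens_slice gmu x (rot_ker_tpoly a b pg pS)).
Qed.

(** Each pair of components is settled by [proj_mul_chaos] off a null set. These sets are countably
    many, and [rot_prod] expands bilinearly at every point for polynomials. *)
Lemma wickN_rot_prod N f g : lowF N.+1 f -> lowF N.+1 g ->
  {ae mu, forall x, wickN mu N (GammaN mu N a f) (GammaN mu N b g) x = rot_prod f g x}.
Proof.
move=> lf lg; have [fs df] := chaos_decomp gmu lf; have [gs dg] := chaos_decomp gmu lg.
have [[cfs _ fE] [cgs _ gE]] := (df, dg).
pose P m n x := proj (m + n) (fun y => proj m (GammaN mu N a f) y *
  proj n (GammaN mu N b g) y) x = rot_prod (fs m) (gs n) x.
have H m n : {ae mu, forall x, (m <= N)%N -> (n <= N)%N -> P m n x}.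
  have [mN|] := leqP m N; last by move=> _; exact: aeW.
  have [nN|] := leqP n N; last by move=> _; exact: aeW.
  have [cF FE] := GammaN_proj a df mN; have [cG GE] := GammaN_proj b dg nN.
  have := proj_mul_chaos gmu ab (cfs m) (cgs n) (chaos_poly cF) (chaos_poly cG) FE GE.
  by apply: filterS => x Px _ _.
have := ae_foralln (fun m => ae_foralln (H m)).
apply: filterS => x Hx; rewrite fE gE.
rewrite rot_prod_suml; last 2 first.
- by move=> i; exact: chaos_poly (cfs i).
- by rewrite -gE; exists N.+1.
rewrite -fE -gE; apply: eq_bigr => m _; rewrite gE rot_prod_sumr; last 2 first.
- by move=> i; exact: chaos_poly (cgs i).
- exact: chaos_poly (cfs m).
by rewrite -gE; apply: eq_bigr => n _; apply: Hx; rewrite -ltnS.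
Qed.

(** The constant 1 lies in the chaos of order 0, so [rot_prod (fs n) 1] is the projection of
    [a^n fs n] onto its own chaos. *)
Lemma GammaN_rot_prod N f : lowF N.+1 f ->
  {ae mu, forall x, GammaN mu N a f x = rot_prod f (fun=> 1) x}.
Proof.
move=> lf; have [fs df] := chaos_decomp gmu lf; have [cfs _ fE] := df.
have c1 : chaos 0 (fun=> 1) by split => //; exact: lowF_cst.
have p1 := chaos_poly c1.
have H n : {ae mu, forall x, rot_prod (fs n) (fun=> 1) x = ((a ^+ n)%:C)%C * fs n x}.
  have cn := chaosZ gmu ((a ^+ n)%:C)%C (cfs n); have pn := chaos_poly cn.
  have := proj_mul_chaos gmu ab (cfs n) c1 pn p1 (aeW _ (fun x => erefl))
    (aeW _ (fun x => esym (mul1r 1))).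
  rewrite addn0; under [X in proj n X]eq_fun do rewrite mulr1.
  have [_ pE] := projP gmu pn cn (fun _ _ => erefl) => rE.
  by near=> x; rewrite -(near rE x)// (near pE x).
have := ae_foralln H; move=> {}H; near=> x.
rewrite (near (GammaN_ae a df) x)// fE rot_prod_suml//; last first.
  by move=> i; exact: chaos_poly (cfs i).
have Hx : forall n, rot_prod (fs n) (fun=> 1) x = ((a ^+ n)%:C)%C * fs n x by near: x.
by apply: eq_bigr => n _; rewrite Hx.
Unshelve. all: by end_near.
Qed.

End wick_rotation.

(** * Norm bounds and extension *)

Section norms.
Context {R : realType} {d : nat}.
Local Notation X := (d.-tuple R).
Local Notation C := (complex R).
Local Notation normc := Normc.normc.
Variables (mu : probability X R).
Implicit Types (f g : X -> C).

Lemma cnorm1E f : cnorm mu 1 f = (\int[mu]_x (normc (f x))%:E)%E.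
Proof.
rewrite /cnorm Lnorm1; apply: eq_integral => x _.
by rewrite /cabs gee0_abs// lee_fin normc_ge0.
Qed.

Lemma cnormE p f : cnorm mu p%:E f =
  ((\int[mu]_x (normc (f x) `^ p)%:E) `^ p^-1)%E.
Proof.
have <- : (\int[mu]_x (`|cabs f x| `^ p) = \int[mu]_x (normc (f x) `^ p)%:E)%E.
  apply: eq_integral => x _.
  by rewrite /cabs gee0_abs ?lee_fin ?normc_ge0// poweR_EFin.
by rewrite /cnorm unlock.
Qed.

Lemma measurable_normc_powR f p : cmeas f -> measurable_fun setT (fun x => normc (f x) `^ p).
Proof.
move=> cf; apply: (@measurableT_comp _ _ _ _ _ _ (@powR R ^~ p) _ (fun x => normc (f x))) => //.
exact: measurable_normc.
Qed.

Lemma cnorm_lty p f : 0 < p -> (cnorm mu p%:E f < +oo)%E ->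
  (\int[mu]_x (normc (f x) `^ p)%:E < +oo)%E.
Proof.
move=> p0; rewrite cnormE; set I := (\int[mu]_x _)%E.
have : (0 <= I)%E by apply: integral_ge0 => x _; rewrite lee_fin powR_ge0.
case: I => [s _ _| |//]; first exact: ltry.
by rewrite poweRyr// invr_eq0 gt_eqF.
Qed.

Lemma Lp_L1 p f : 1 <= p -> cmeas f -> (\int[mu]_x (normc (f x) `^ p)%:E < +oo)%E ->
  (\int[mu]_x (normc (f x))%:E < +oo)%E.
Proof.
move=> p1 cf fp; have mn := measurable_normc cf.
have mp := measurable_normc_powR p cf.
apply: (@le_lt_trans _ _ (\int[mu]_x (1 + normc (f x) `^ p)%:E)%E).
  apply: ge0_le_integral => //.
  - by move=> x _; rewrite lee_fin normc_ge0.
  - exact/measurable_EFinP.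
  - by apply/measurable_EFinP; exact: measurable_funD.
  - move=> x _; rewrite lee_fin; have [n1|n1] := lerP (normc (f x)) 1.
      by rewrite (le_trans n1)// lerDl powR_ge0.
    by rewrite (@le_trans _ _ (normc (f x) `^ p)) ?lerDr// le1r_powR// ltW.
under eq_integral do rewrite EFinD.
rewrite ge0_integralD//.
- rewrite integral_cst// mul1e lte_add_pinfty//; exact: prob_lty.
- by move=> x _; rewrite lee_fin powR_ge0.
- exact/measurable_EFinP.
Qed.

(** [normc_rot_prod_le] integrates a bound valid at every point, so the function is set to 0 where
    it exceeds its essential supremum. *)
Lemma bounded_representative g : cmeas g -> (cnorm mu +oo g < +oo)%E ->
  exists (K : R) (g' : X -> C), [/\ 0 <= K, cnorm mu +oo g = K%:E, cmeas g',
    forall x, normc (g' x) <= K & {ae mu, forall x, g x = g' x}].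
Proof.
move=> cg; have mu0 : (0 < mu setT)%E.
  by rewrite (_ : mu setT = 1%E)//; exact: probability_setT.
have -> : cnorm mu +oo g = ess_sup mu (fun x => (normc (g x))%:E).
  rewrite /cnorm unlock mu0; congr ess_sup; apply/funext => x /=.
  by rewrite ger0_norm ?normc_ge0.
have := ess_sup_ge mu (fun x => (normc (g x))%:E).
have : (0 <= ess_sup mu (fun x => (normc (g x))%:E))%E.
  by apply: ess_sup_gee => //; apply: aeW => x; rewrite lee_fin normc_ge0.
case: (ess_sup mu _) => [K K0 gK _| |]//.
have mK : measurable_fun setT (fun x => normc (g x) <= K).
  by apply: measurable_fun_ler => //; exact: measurable_normc.
exists K, (fun x => if normc (g x) <= K then g x else 0); split => //.
- by split; [under eq_fun do rewrite fun_if|under eq_fun do rewrite fun_if];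
    apply: measurable_fun_ifT => //; case: cg.
- by move=> x; case: ifP => // _; rewrite Normc.normc0.
- by apply: filterS gK => x; rewrite lee_fin => ->.
Qed.

Lemma comb10 (x y : X) : comb 1 0 x y = x.
Proof. by apply: eq_from_tnth => i; rewrite tnth_comb mul1r mul0r addr0. Qed.

Hypothesis gmu : is_std_gaussian mu.
Variables p r : R.
Hypotheses (p1 : 1 < p) (pr : p <= r).
Local Notation a := (Num.sqrt (p - 1) / Num.sqrt (r - 1)).
Local Notation b := (Num.sqrt (r - p) / Num.sqrt (r - 1)).

Lemma sqr_sum_sqrt_ratio : a ^+ 2 + b ^+ 2 = 1.
Proof.
have r1 : 0 < r - 1 by rewrite subr_gt0 (lt_le_trans p1).
rewrite !expr_div_n !sqr_sqrtr ?subr_ge0// ?(ltW p1)//; last by rewrite -subr_ge0 ltW.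
by rewrite -mulrDl addrC subrKA mulfV ?gt_eqF.
Qed.

Lemma sqrt_sub_sqr : b = Num.sqrt (1 - a ^+ 2).
Proof.
have <- : b ^+ 2 = 1 - a ^+ 2.
  by apply/eqP; rewrite eq_sym subr_eq addrC sqr_sum_sqrt_ratio.
by rewrite sqrtr_sqr ger0_norm ?divr_ge0 ?sqrtr_ge0.
Qed.

(** For [p = r] one has [a = 1] and [b = 0], and the average is the identity; [OU_norm_le] covers
    [p < r], where [a < 1]. *)
Lemma OU_norm_le_eq (f : X -> R) :
  measurable_fun setT f -> (forall x, 0 <= f x) ->
  (\int[mu]_x (f x `^ p)%:E < +oo)%E ->
  (\int[mu]_x ((\int[mu]_y f (comb a b x y)) `^ r)%:E <=
    ((\int[mu]_x (f x `^ p)) `^ (r / p))%:E)%E.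
Proof.
move=> mf f0 fp; have [plr|] := ltP p r.
  by rewrite sqrt_sub_sqr; exact: OU_norm_le.
move=> rp; have rE : r = p by apply/eqP; rewrite eq_le rp pr.
have p0 : 0 < p by exact: lt_trans p1.
have a1 : a = 1 by rewrite rE divff// gt_eqF// sqrtr_gt0 subr_gt0.
have b0 : b = 0 by rewrite rE subrr sqrtr0 mul0r.
rewrite a1 b0 rE divff ?gt_eqF// powRr1; last first.
  by apply: Rintegral_ge0 => x _; exact: powR_ge0.
under eq_integral => x _.
  under eq_Rintegral do rewrite comb10.
  rewrite Rint_cst; over.
rewrite fineK// ge0_fin_numE//.
by apply: integral_ge0 => x _; rewrite lee_fin powR_ge0.
Qed.

Lemma rot_prod_norm f g (K : R) : cmeas f -> cmeas g -> (forall x, normc (g x) <= K) ->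
  (cnorm mu p%:E f < +oo)%E ->
  (cnorm mu r%:E (rot_prod mu a b f g) <= cnorm mu p%:E f * K%:E)%E.
Proof.
move=> cf cg gK fp.
have p0 : 0 < p by exact: lt_trans p1.
have r0 : 0 < r by exact: lt_le_trans pr.
have K0 : 0 <= K by apply: le_trans (gK [tuple 0 | i < d]); exact: normc_ge0.
have {}fp := cnorm_lty p0 fp.
have f1 := Lp_L1 (ltW p1) cf fp.
have g1 : (\int[mu]_x (normc (g x))%:E < +oo)%E.
  apply: normc_integral_lty; apply: cintegrable_normc => //.
  apply: (@le_lt_trans _ _ (\int[mu]_x K%:E)%E).
    apply: ge0_le_integral => //.
    - by move=> x _; rewrite lee_fin normc_ge0.
    - exact/measurable_EFinP/measurable_normc.
    - by move=> x _; rewrite lee_fin.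
  rewrite integral_cst// lte_mul_pinfty// ?prob_lty//.
have ab := sqr_sum_sqrt_ratio.
pose h := rot_prod mu a b f g; have ch : cmeas h by exact: cmeas_rot_prod.
pose n x := normc (f x); have mn : measurable_fun setT n by exact: measurable_normc.
have n0 x : 0 <= n x by exact: normc_ge0.
pose P x := \int[mu]_y n (comb a b x y).
have P0 x : 0 <= P x by apply: Rintegral_ge0.
have hP : {ae mu, forall x, normc (h x) <= K * P x}.
  (* With second factor 1 the kernel is [f (comb a b x y)]. Its slices are integrable for almost
     every [x], and there the extended integral of the modulus equals [P x]. *)
  have c1 : cmeas (fun _ : X => 1 : C) by exact: cmeas_cst.
  have l1 : (\int[mu]_x (normc (1 : C))%:E < +oo)%E.
    by rewrite Normc.normc1 integral_cst// mul1e prob_lty.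
  have := rot_ker_ae_integrable gmu ab cf c1 f1 l1.
  apply: filterS => x; rewrite /rot_ker; under eq_fun do rewrite mulr1.
  move=> /normc_integrable/integrable_fin_num fin.
  have := normc_rot_prod_le mu a b x cf cg gK.
  by rewrite -[X in (_ <= _ * X)%E](fineK (fin measurableT)) -EFinM lee_fin.
have hr : (\int[mu]_x (normc (h x) `^ r)%:E <=
    (K `^ r * (\int[mu]_x (n x `^ p)) `^ (r / p))%:E)%E.
  have mP : measurable_fun setT P.
    apply: measurableT_comp => //.
    apply: (measurable_fun_fubini_tonelli_F (fun z => (n (comb a b z.1 z.2))%:E)) => //.
      by apply/measurable_EFinP; exact: (measurableT_comp mn (measurable_comb a b)).
    by move=> z; rewrite lee_fin.
  have mPr : measurable_fun setT (fun x => P x `^ r).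
    exact: (@measurableT_comp _ _ _ _ _ _ (@powR R ^~ r) _ P).
  apply: (@le_trans _ _ (\int[mu]_x ((K `^ r)%:E * (P x `^ r)%:E))%E).
    apply: ae_ge0_le_integral => //.
    - by move=> x _; rewrite lee_fin powR_ge0.
    - by apply/measurable_EFinP; exact: (measurable_normc_powR r ch).
    - by move=> x _; rewrite -EFinM lee_fin mulr_ge0 ?powR_ge0.
    - by apply: emeasurable_funM; [exact: measurable_cst|exact/measurable_EFinP].
    - apply: filterS hP => x hP _; rewrite -EFinM lee_fin -powRM//.
      by apply: ge0_ler_powR; rewrite ?nnegrE ?normc_ge0 ?mulr_ge0// ltW.
  rewrite ge0_integralZl_EFin ?powR_ge0//; last 2 first.
  - by move=> x _; rewrite lee_fin powR_ge0.
  - exact/measurable_EFinP.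
  by rewrite EFinM lee_wpmul2l ?lee_fin ?powR_ge0//; exact: OU_norm_le_eq.
rewrite !cnormE; set B := \int[mu]_x (n x `^ p) in hr.
have B0 : 0 <= B by apply: Rintegral_ge0 => x _; exact: powR_ge0.
have -> : (\int[mu]_x (normc (f x) `^ p)%:E)%E = B%:E.
  by rewrite fineK// ge0_fin_numE//; apply: integral_ge0 => x _; rewrite lee_fin powR_ge0.
rewrite poweR_EFin -EFinM.
have -> : ((B `^ p^-1 * K)%:E = (K `^ r * B `^ (r / p))%:E `^ r^-1)%E.
  rewrite poweR_EFin powRM ?powR_ge0// -!powRrM mulfV ?gt_eqF// powRr1//.
  by rewrite mulrC mulrAC mulfV ?gt_eqF// mul1r.
apply: gt0_ler_poweR => //; rewrite ?invr_ge0 ?(ltW r0)//.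
- by rewrite in_itv/= leey andbT; apply: integral_ge0 => x _; rewrite lee_fin powR_ge0.
- by rewrite in_itv/= leey andbT lee_fin mulr_ge0 ?powR_ge0.
Qed.

End norms.

(** * Continuous extension from polynomials to [L^1] *)

Section extension.
Context {R : realType} {d : nat}.
Local Notation X := (d.-tuple R).
Local Notation C := (complex R).
Local Notation normc := Normc.normc.
Variables (mu : probability X R).
Hypothesis gmu : is_std_gaussian mu.
Implicit Types (f g : X -> C).
Local Notation proj := (Defs.proj mu).
Local Notation L1 f := (\int[mu]_x (normc (f x))%:E < +oo)%E.

Lemma proj_chaos n f : poly f -> chaos mu n (proj n f).
Proof.
move=> [N lf]; have [fs [cfs fs0 ->]] := chaos_decomp gmu (lowF_le (leqnSn N) lf).
by have [] := proj_sum gmu n cfs fs0.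
Qed.

Lemma GammaN_poly N c f : poly f -> poly (GammaN mu N c f).
Proof.
move=> pf; apply: poly_sum => i; apply: polyZ.
exact: chaos_poly (proj_chaos i pf).
Qed.

Lemma wickN_poly N f g : poly f -> poly g -> poly (wickN mu N f g).
Proof.
move=> pf pg; apply: poly_sum => m; apply: poly_sum => n.
apply: chaos_poly (proj_chaos (m + n) _).
by apply: polyM; [exact: chaos_poly (proj_chaos m pf)|exact: chaos_poly (proj_chaos n pg)].
Qed.

Lemma cnorm1_ae f g : cmeas f -> cmeas g -> {ae mu, forall x, f x = g x} ->
  cnorm mu 1 f = cnorm mu 1 g.
Proof.
move=> cf cg fg; rewrite !cnorm1E; apply: ge0_ae_eq_integral => //.
- exact/measurable_EFinP/measurable_normc.
- exact/measurable_EFinP/measurable_normc.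
- by move=> x _; rewrite lee_fin normc_ge0.
- by move=> x _; rewrite lee_fin normc_ge0.
- by apply: filterS fg => x -> _.
Qed.

Lemma L1_triangle f g : cmeas f -> cmeas g ->
  (\int[mu]_x (normc (f x))%:E <=
   \int[mu]_x (normc (f x - g x))%:E + \int[mu]_x (normc (g x))%:E)%E.
Proof.
move=> cf cg; have cfg := measurable_normc (cmeasB cf cg).
have mf := measurable_normc cf; have mg := measurable_normc cg.
rewrite -ge0_integralD//; [|by move=> x _; rewrite lee_fin normc_ge0|exact/measurable_EFinP
  |by move=> x _; rewrite lee_fin normc_ge0|exact/measurable_EFinP].
apply: ge0_le_integral => //.
- by move=> x _; rewrite lee_fin normc_ge0.
- exact/measurable_EFinP.
- by apply: emeasurable_funD; exact/measurable_EFinP.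
- by move=> x _; rewrite -EFinD lee_fin -{1}(subrK (g x) (f x)); exact: (@le_normcD R).
Qed.

Lemma L1_fin_num f : L1 f -> (\int[mu]_x (normc (f x))%:E)%E \is a fin_num.
Proof. by move=> lf; rewrite ge0_fin_numE//; exact: L1_ge0. Qed.

Variables a b : R.
Hypothesis ab : a ^+ 2 + b ^+ 2 = 1.

(** In [rot_prod_L1B] the norm of [gk k] is at most that of [g] plus the error, so the distance is
    bounded by [u (v + B) + A v], which tends to 0. *)
Lemma rot_prod_cvg f g (fk gk : nat -> X -> C) :
  cmeas f -> cmeas g -> L1 f -> L1 g ->
  (forall k, cmeas (fk k) /\ L1 (fk k)) -> (forall k, cmeas (gk k) /\ L1 (gk k)) ->
  (fun k => \int[mu]_x (normc (fk k x - f x))%:E)%E @ \oo --> 0%E ->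
  (fun k => \int[mu]_x (normc (gk k x - g x))%:E)%E @ \oo --> 0%E ->
  (fun k => \int[mu]_x (normc (rot_prod mu a b (fk k) (gk k) x -
    rot_prod mu a b f g x))%:E)%E @ \oo --> 0%E.
Proof.
move=> cf cg lf lg Hf Hg ef eg.
set A := (\int[mu]_x (normc (f x))%:E)%E in lf.
set B := (\int[mu]_x (normc (g x))%:E)%E in lg.
set u := (fun k => _) in ef; set v := (fun k => _) in eg.
have fA : A \is a fin_num by exact: L1_fin_num.
have fB : B \is a fin_num by exact: L1_fin_num.
have vB : ((fun k => v k + B) @ \oo --> B)%E.
  have := @cvgeD _ _ _ _ v (cst B) 0%E B; rewrite add0e; apply => //; exact: cvg_cst.
have w : ((fun k => u k * (v k + B) + A * v k) @ \oo --> 0)%E.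
  have uvB : ((fun k => u k * (v k + B)) @ \oo --> 0)%E.
    have := @cvgeM _ _ _ _ u (fun k => v k + B)%E 0%E B; rewrite mul0e; apply => //.
    by rewrite mule_def_fin.
  have Av : ((fun k => A * v k) @ \oo --> 0)%E by have := cvgeZl fA eg; rewrite mule0.
  by have := @cvgeD _ _ _ _ (fun k => u k * (v k + B))%E (fun k => A * v k)%E 0%E 0%E;
    rewrite add0e; apply.
apply: (squeeze_cvge _ (cvg_cst 0%E) w).
near=> k; have [[cfk lfk] [cgk lgk]] := (Hf k, Hg k).
rewrite L1_ge0/=; apply: (le_trans (rot_prod_L1B gmu ab cf cg cfk cgk lf lg lfk lgk)).
rewrite leeD2r// lee_wpmul2l ?L1_ge0//; exact: L1_triangle.
Unshelve. all: by end_near.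
Qed.

Lemma poly_L1 f : poly f -> cmeas f /\ L1 f.
Proof.
move=> pf; split; first exact: (poly_cmeas gmu).
exact: normc_integral_lty (poly_cint gmu pf).
Qed.

(** On polynomial approximants [wickN] and [rot_prod] agree almost everywhere, and so do [g] and
    [g']; neither replacement changes an [L^1] norm. *)
Lemma wick_ext_rot_prod f g g' : cmeas f -> cmeas g -> cmeas g' -> L1 f -> L1 g' ->
  {ae mu, forall x, g x = g' x} -> wick_ext mu a b f g (rot_prod mu a b f g').
Proof.
move=> cf cg cg' lf lg' gg'; have ch := cmeas_rot_prod gmu ab cf cg' lf lg'.
split => // N fk gk pfg ef eg.
have pf k : poly (fk k) by have [pf _] := pfg k; exists (N k).+1.
have pg k : poly (gk k) by have [_ pg] := pfg k; exists (N k).+1.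
rewrite (_ : (fun k => _) = fun k => (\int[mu]_x (normc (rot_prod mu a b (fk k) (gk k) x -
    rot_prod mu a b f g' x))%:E)%E); last first.
  apply/funext => k; rewrite -[RHS]cnorm1E; apply: cnorm1_ae.
  - apply: cmeasB => //; apply: (poly_cmeas gmu).
    by apply: wickN_poly; exact: GammaN_poly.
  - have [cfk lfk] := poly_L1 (pf k); have [cgk lgk] := poly_L1 (pg k).
    by apply: cmeasB => //; exact: cmeas_rot_prod.
  - have [lfk lgk] := pfg k.
    by apply: filterS (wickN_rot_prod gmu ab lfk lgk) => x /= ->.
apply: rot_prod_cvg => // [k|k||]; [exact: poly_L1|exact: poly_L1| |].
- by move: ef; under eq_fun do rewrite cnorm1E.
- rewrite (_ : (fun k => _) = fun k => cnorm mu 1 (gk k \- g)); first exact: eg.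
  apply/funext => k; rewrite -cnorm1E; apply: cnorm1_ae.
  + by apply: cmeasB => //; exact: (poly_cmeas gmu).
  + by apply: cmeasB => //; exact: (poly_cmeas gmu).
  + by apply: filterS gg' => x /= ->.
Qed.

Lemma Gamma_ext_rot_prod f : cmeas f -> L1 f ->
  Gamma_ext mu a f (rot_prod mu a b f (fun=> 1)).
Proof.
move=> cf lf; have p1 : poly (fun _ : X => 1 : C) by exact: poly_cst.
have [c1 l1] := poly_L1 p1.
have ch := cmeas_rot_prod gmu ab cf c1 lf l1.
split => // N fk lfk ef.
have pf k : poly (fk k) by exists (N k).+1; exact: lfk.
rewrite (_ : (fun k => _) = fun k => (\int[mu]_x (normc (rot_prod mu a b (fk k) (fun=> 1) x -
    rot_prod mu a b f (fun=> 1) x))%:E)%E); last first.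
  apply/funext => k; rewrite -[RHS]cnorm1E; apply: cnorm1_ae.
  - by apply: cmeasB => //; apply: (poly_cmeas gmu); exact: GammaN_poly.
  - have [cfk lk] := poly_L1 (pf k).
    by apply: cmeasB => //; exact: cmeas_rot_prod.
  - by apply: filterS (GammaN_rot_prod gmu ab (lfk k)) => x /= ->.
apply: (rot_prod_cvg (fk := fk) (gk := fun=> fun=> 1)) => // [k||]; first exact: poly_L1.
- by move: ef; under eq_fun do rewrite cnorm1E.
- rewrite (_ : (fun k => _) = cst 0%E); first exact: cvg_cst.
  apply/funext => k; rewrite /cst -(integral0 mu setT); apply: eq_integral => x _.
  by rewrite subrr Normc.normc0.
Qed.

End extension.

Theorem theorem4p4 (R : realType) (d : nat) (mu : probability (d.-tuple R) R)
  (p r : R) (phi psi : d.-tuple R -> complex R) :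
  is_std_gaussian mu ->
  1 < p -> p <= r ->
  inLp mu p%:E phi -> inLp mu +oo%E psi ->
  let c1 := Num.sqrt (p - 1) / Num.sqrt (r - 1) in
  let c2 := Num.sqrt (r - p) / Num.sqrt (r - 1) in
  (exists h, wick_ext mu c1 c2 phi psi h /\ inLp mu r%:E h /\
     (cnorm mu r%:E h <= cnorm mu p%:E phi * cnorm mu +oo%E psi)%E) /\
  (exists g, Gamma_ext mu c1 phi g /\ inLp mu r%:E g /\
     (cnorm mu r%:E g <= cnorm mu p%:E phi)%E).
Proof.
move=> gmu p1 pr [cphi phip] [cpsi psioo] c1 c2.
have ab : c1 ^+ 2 + c2 ^+ 2 = 1 by exact: sqr_sum_sqrt_ratio.
have p0 : 0 < p by exact: lt_trans p1.
have l1 := Lp_L1 (ltW p1) cphi (cnorm_lty p0 phip).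
have phi0 : (0 <= cnorm mu p%:E phi)%E by exact: Lnorm_ge0.
have phifin : cnorm mu p%:E phi \is a fin_num by rewrite ge0_fin_numE.
split.
(* The bound [K] of the representative [psi'] is the essential supremum norm of [psi] itself, so no
   constant is lost. *)
- have [K [psi' [K0 psiK cpsi' psi'K psi'E]]] := bounded_representative cpsi psioo.
  have lpsi' : (\int[mu]_x (Normc.normc (psi' x))%:E < +oo)%E.
    apply: (@le_lt_trans _ _ (\int[mu]_x K%:E)%E).
      apply: ge0_le_integral => //.
      - by move=> x _; rewrite lee_fin normc_ge0.
      - exact/measurable_EFinP/measurable_normc.
      - by move=> x _; rewrite lee_fin.
    by rewrite integral_cst// lte_mul_pinfty// prob_lty.
  exists (rot_prod mu c1 c2 phi psi').
  have bound := rot_prod_norm gmu p1 pr cphi cpsi' psi'K phip.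
  split; first exact: wick_ext_rot_prod.
  split; last by rewrite psiK.
  split; first exact: (cmeas_rot_prod gmu ab cphi cpsi' l1 lpsi').
  by apply: le_lt_trans bound _; rewrite lte_mul_pinfty// ltry.
(* [Gamma] alone is the rotated product with the constant 1, so the same bound applies with
   [K = 1]. *)
- have one : Normc.normc (1 : complex R) <= 1 by rewrite Normc.normc1.
  have [c1m l1m] := poly_L1 gmu (poly_cst (d := d) (1 : complex R)).
  have := rot_prod_norm gmu p1 pr cphi c1m (fun=> one) phip; rewrite mule1 => bound.
  exists (rot_prod mu c1 c2 phi (fun=> 1)).
  split; first exact: Gamma_ext_rot_prod.
  split => //; split; first exact: (cmeas_rot_prod gmu ab cphi c1m l1 l1m).
  exact: le_lt_trans bound phip.
Qed.
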